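(* Let $\alpha\in(0,1)$, $T>0$, and let $\Omega\subset\mathbb{R}^N$, $N\ge1$, be a bounded domain of class $\mathcal{C}^{2+\alpha}$. Assume that $J$ and $\mathcal{G}$ satisfy the assumptions stated in the context, and that for a.e. $x\in\Omega$ the function $\mathcal{G}(x,s)$ is $\mathcal{C}^{1+\alpha}$ with respect to $s$. Set, for a.e. $x\in\Omega$, $$C(x)^{-1}=\tfrac12\,C(J)\,\mathcal{G}(x,0),\qquad \mu(x)=\frac{2\,\mathcal{G}'_s(x,0)}{\mathcal{G}(x,0)},$$ where $\mu:\overline\Omega\to\mathbb{R}$ is Hölder continuous with exponent $\alpha$. Let $v$ be a classical solution of $$\begin{cases} v_t(x,t)=\Delta v(x,t)+\mu(x)|\nabla v(x,t)|^2 & \text{in }\Omega\times(0,T),\\ v(x,t)=h_0(x,t) & \text{on }\partial\Omega\times(0,T),\\ v(x,0)=v_0(x) & \text{in }\Omega,\end{cases}$$ with $v_0\in\mathcal{C}^{1+\alpha}(\overline\Omega)$, and let $h\in\mathcal{C}^{1+\alpha}((\Omega_{J_\varepsilon}\setminus\Omega)\times(0,T])$ be such that $h|_{\partial\Omega\times(0,T)}=h_0$. For any $\varepsilon>0$ let $u^\varepsilon$ denote the (regular) solution of $$\begin{cases} u^\varepsilon_t(x,t)=\dfrac{C(x)}{\varepsilon^2}\displaystyle\int_{\Omega_{J_\varepsilon}}J_\varepsilon(x-y)\,u^\varepsilon(y;x,t)\,\mathcal{G}(x,u^\varepsilon(y;x,t))\,dy & \text{in }\overline\Omega\times(0,T),\\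 u^\varepsilon(x,t)=h(x,t) & \text{in }(\Omega_{J_\varepsilon}\setminus\overline\Omega)\times(0,T),\\ u^\varepsilon(x,0)=v_0(x) & \text{in }\overline\Omega.\end{cases}$$ Then $$\lim_{\varepsilon\to0}\ \sup_{t\in[0,T]}\big\|u^\varepsilon(\cdot,t)-v(\cdot,t)\big\|_{L^\infty(\Omega)}=0.$$
   Context: Notation: $u(y;x,t):=u(y,t)-u(x,t)$; $J_\varepsilon(s):=\varepsilon^{-N}J(s/\varepsilon)$; $\Omega_{J_\varepsilon}:=\Omega+\operatorname{supp}(J_\varepsilon)$; $\mathcal{G}'_s$ is the derivative of $\mathcal{G}$ with respect to its second variable. Assumptions on $J$: $J:\mathbb{R}^N\to\mathbb{R}$ is a nonnegative radially symmetric function with $J\in\mathcal{C}_c(\mathbb{R}^N)$, $\int_{\mathbb{R}^N}J(z)\,dz=1$ and $C(J):=\int_{\mathbb{R}^N}J(z)z_N^2\,dz<\infty$. Assumptions on $\mathcal{G}$: $\mathcal{G}:\mathbb{R}^N\times\mathbb{R}\to\mathbb{R}$ is a nonnegative Carathéodory function ($\mathcal{G}(\cdot,s)$ measurable for every $s\in\mathbb{R}$, $\mathcal{G}(x,\cdot)$ continuous for a.e. $x\in\mathbb{R}^N$) and there exist constants $\alpha_2\ge\alpha_1>0$ such that $$\alpha_1\le\frac{\mathcal{G}(x,s)s-\mathcal{G}(x,\sigma)\sigma}{s-\sigma}\le\alpha_2\qquad\text{for all } s,\sigma\in\mathbb{R},\ s\neq\sigma,\ \text{and a.e. }x\in\mathbb{R}^N.$$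 Classical solution (of the local problem): $v\in\mathcal{C}(\overline\Omega\times[0,T])\cap\mathcal{C}^{2+\alpha,1+\alpha/2}(\Omega\times(0,T))$ satisfying the equation and the boundary and initial conditions pointwise. Regular solution (of the nonlocal problem): $u^\varepsilon$, continuous in time with values in $\mathcal{C}(\overline\Omega)$, equal to $h$ on $(\Omega_{J_\varepsilon}\setminus\overline\Omega)\times(0,T)$, satisfying for every $x\in\overline\Omega$ and every $t$ the time-integrated equation $u^\varepsilon(x,t)=v_0(x)+\int_0^t\frac{C(x)}{\varepsilon^2}\int_{\Omega_{J_\varepsilon}}J_\varepsilon(x-y)u^\varepsilon(y;x,\tau)\mathcal{G}(x,u^\varepsilon(y;x,\tau))\,dy\,d\tau$, with $\lim_{t\to0^+}\|u^\varepsilon(\cdot,t)-v_0\|_{\mathcal{C}(\overline\Omega)}=0$.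
   Formalization: ''G(x,s) is C^{1+α} in s for a.e. x'' is taken with Hölder constants of G'_s(x,·) on bounded s-sets independent of x (with x-dependent constants the claim fails), and h has finite C^{1+α} norm up to t=0. *)

(* Defs.v *)
From HB Require Import structures.
From mathcomp Require Import all_boot all_order all_algebra.
From mathcomp Require Import all_classical all_reals all_analysis.

Set Implicit Arguments.
Unset Strict Implicit.
Unset Printing Implicit Defensive.

Import Order.TTheory GRing.Theory Num.Theory.
Import numFieldNormedType.Exports.

Local Open Scope classical_set_scope.
Local Open Scope ring_scope.

(* MathComp-Analysis has no Lebesgue measure on R^N for N > 1. It is built here
   by Caratheodory's method from the volume of boxes; its measurable sets are
   the Lebesgue measurable sets. *)
Section LebesgueMeasure.
Context {R : realType} (N : nat).
Implicit Types (a b x : 'rV[R]_N) (A : set 'rV[R]_N).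

Definition box a b : set 'rV[R]_N :=
  [set x | forall i, a 0 i < x 0 i <= b 0 i].

Definition box_volume a b : R := \prod_(i < N) Num.max 0 (b 0 i - a 0 i).

Definition box_cover A : set (nat -> 'rV[R]_N * 'rV[R]_N) :=
  [set B | A `<=` \bigcup_k box (B k).1 (B k).2].

Definition leb_outer A : \bar R :=
  ereal_inf [set (\sum_(k <oo) (box_volume (B k).1 (B k).2)%:E)%E
            | B in box_cover A].

Let vol (p : 'rV[R]_N * 'rV[R]_N) : \bar R := (box_volume p.1 p.2)%:E.

Let vol_ge0 p : (0 <= vol p)%E.
Proof.
by rewrite lee_fin; apply: prodr_ge0 => i _; rewrite le_max lexx.
Qed.

Lemma leb_outer_ge0 A : (0 <= leb_outer A)%E.
Proof.
apply/le_ereal_inf_tmp => _ [B _ <-].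
by apply: nneseries_ge0 => k _ _; exact: vol_ge0.
Qed.

Lemma leb_outer_le : {homo leb_outer : A B / A `<=` B >-> (A <= B)%E}.
Proof.
move=> A B AB; apply: le_ereal_inf => _ [C BC <-].
by exists C => //; exact: subset_trans AB BC.
Qed.

Lemma leb_outer_sigma_subadditive : sigma_subadditive leb_outer.
Proof.
move=> A; have [[i ioo]|] := pselect (exists i, leb_outer (A i) = +oo%E).
  rewrite (eseries_pinfty _ _ ioo) ?leey// => n _.
  by rewrite -ltNye (lt_le_trans _ (leb_outer_ge0 _)).
rewrite -forallNE => Aoo.
suff add2e (e : {posnum R}) : (leb_outer (\bigcup_n A n) <=
    \sum_(i <oo) leb_outer (A i) + e%:num%:E)%E.
  by apply/lee_addgt0Pr => _/posnumP[].
rewrite (le_trans _ (epsilon_trick _ _ _))//; last first.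
  by move=> n; exact: leb_outer_ge0.
pose P n B := box_cover (A n) B /\
  (\sum_(k <oo) vol (B k) <= leb_outer (A n) + (e%:num / (2 ^ n.+1)%:R)%:E)%E.
have [G PG] : {G : nat -> nat -> 'rV[R]_N * 'rV[R]_N & forall n, P n (G n)}.
  apply: (@choice _ _ P) => n; rewrite /P.
  have fin : leb_outer (A n) \is a fin_num.
    by rewrite ge0_fin_numE ?leb_outer_ge0// ltey; apply/eqP/Aoo.
  have en1 : 0 < e%:num / (2 ^ n.+1)%:R :> R by [].
  have [_ [B AB <-] /ltW le] := lb_ereal_inf_adherent en1 fin.
  by exists B.
have /card_esym/ppcard_eqP[f] := card_nat2.
pose H k := uncurry G (f k).
apply: (@le_trans _ _ (\sum_(k <oo) vol (H k))%E).
  apply: ereal_inf_lbound; exists H => // x [i _ Aix].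
  have [j _ Bx] := (PG i).1 _ Aix; exists (f^-1%FUN (i, j)) => //.
  by rewrite /H invK ?inE.
have -> : (\sum_(k <oo) vol (H k) = \sum_(i <oo) \sum_(j <oo) vol (G i j))%E.
  rewrite nneseries_esumT => [|k]; last exact: vol_ge0.
  rewrite -(reindex_esum [set: nat] [set: nat * nat] f (vol \o uncurry G))//.
  transitivity (\esum_(p in [set: nat] `*`` (fun=> [set: nat]))
    vol (G p.1 p.2))%E.
    by congr esum; [apply/seteqP; split => -[]|apply/funext => -[]].
  rewrite -(@esum_esum _ _ _ _ _ (fun i j => vol (G i j)))//.
  rewrite nneseries_esumT => [|n]; last by apply: nneseries_ge0 => *; exact: vol_ge0.
  by apply: eq_esum => n _; rewrite nneseries_esumT.
apply: lee_nneseries => [n _ _|n _]; first by apply: nneseries_ge0.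
exact: (PG n).2.
Qed.

End LebesgueMeasure.

Lemma leb_outer0 {R : realType} (n : nat) :
  leb_outer (@set0 'rV[R]_n.+1) = 0%E.
Proof.
apply/eqP; rewrite eq_le leb_outer_ge0 andbT.
apply: ereal_inf_lbound; exists (fun=> (0, 0)); first exact: sub0set.
rewrite eseries0// => k _ _.
by rewrite /box_volume big_ord_recl mxE subrr maxxx mul0r.
Qed.

HB.instance Definition _ (R : realType) (n : nat) :=
  isOuterMeasure.Build R 'rV[R]_n.+1 (@leb_outer R n.+1)
    (leb_outer0 n) (@leb_outer_ge0 R n.+1) (@leb_outer_le R n.+1)
    (@leb_outer_sigma_subadditive R n.+1).

Definition leb_outer_measure (R : realType) (n : nat) :
  {outer_measure set 'rV[R]_n.+1 -> \bar R} := @leb_outer R n.+1.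

Definition lebN (R : realType) (n : nat) :
  set (caratheodory_type (leb_outer_measure R n)) -> \bar R :=
  leb_outer_measure R n.

HB.instance Definition _ (R : realType) (n : nat) := Measure.on (@lebN R n).

Section FunctionSpaces.
Context {R : realType}.

(* The norms of 'rV[R]_N and 'rV[R]_N * R used in the Hoelder conditions are
   the sup norms of the library, which are equivalent to the Euclidean ones. *)
Definition holder (V : normedModType R) (al : R) (A : set V) (f : V -> R) :=
  exists M, forall x y, A x -> A y -> `|f x - f y| <= M * `|x - y| `^ al.

(* C^{1+al}(A) with finite norm, for A lying between an open set and its
   closure. *)
Definition C1_holder (V : normedModType R) (al : R) (A : set V) (f : V -> R) :=
  [/\ {within A, continuous f},
      forall x, A° x -> differentiable f x &
      exists M, forall x y v, A° x -> A° y ->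
        [/\ `|f x| <= M,
            `|'d f x v| <= M * `|v| &
            `|'d f x v - 'd f y v| <= M * `|x - y| `^ al * `|v|]].

Definition C2_holder (V : normedModType R) (al : R) (U : set V) (f : V -> R) :=
  let d2 v w x := 'd (fun z => 'd f z v) x w in
  [/\ forall x, U x -> differentiable f x,
      forall x v, U x -> differentiable (fun z => 'd f z v) x &
      exists M, forall x y v w, U x -> U y ->
        [/\ `|f x| <= M,
            `|'d f x v| <= M * `|v|,
            `|d2 v w x| <= M * `|v| * `|w| &
            `|d2 v w x - d2 v w y| <= M * `|x - y| `^ al * `|v| * `|w|]].

(* Near each boundary point, and up to relabelling and reversing a coordinate
   axis, Om is the region on one side of the graph of a C^{2+al} function of
   the remaining coordinates. *)
Definition C2_holder_domain (n : nat) (al : R) (Om : set 'rV[R]_n.+1) :=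
  [/\ Om !=set0, open Om, connected Om, bounded_set Om &
  forall x0, (closure Om `\` Om) x0 ->
    exists (i : 'I_n.+1) (b : bool) (r : R) (g : 'rV[R]_n -> R),
      [/\ 0 < r,
          C2_holder al (ball (col' i x0 : 'rV[R]_n) r) g &
          forall x, ball x0 r x ->
            (Om x <-> 0 < (-1) ^+ b * (x 0 i - g (col' i x)))]].

Definition sup_norm (T : Type) (A : set T) (f : T -> R) : \bar R :=
  ereal_sup [set `|f x|%:E | x in A].

Definition Linfty_norm (n : nat) (A : set 'rV[R]_n.+1) (f : 'rV[R]_n.+1 -> R) :
    \bar R :=
  'N[@lebN R n]_+oo[EFin \o (f \_ A)].

End FunctionSpaces.

Section LocalProblem.
Context {R : realType} {n : nat}.
Local Notation RN := 'rV[R]_n.+1.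

Definition enorm (x : RN) : R := Num.sqrt (\sum_i x 0 i ^+ 2).

Definition grad (f : RN -> R) (x : RN) : RN := \row_i 'D_'e_i f x.

Definition hess (f : RN -> R) (x : RN) : 'M[R]_n.+1 :=
  \matrix_(i, j) 'D_'e_j ('D_'e_i f) x.

Definition laplacian (f : RN -> R) (x : RN) : R := \tr (hess f x).

Definition dt (v : RN -> R -> R) (x : RN) (t : R) : R := 'D_1 (v x) t.

(* v belongs to C^{2+al,1+al/2}(Q), Q open: the parabolic Hoelder norm is
   finite on the compact subsets of Q. *)
Definition parabolic_C2_holder (al : R) (Q : set (RN * R)) (v : RN -> R -> R) :=
  (forall x t, Q (x, t) ->
    [/\ derivable (v x) t 1,
        forall i, derivable (v^~ t) x 'e_i &
        forall i j, derivable ('D_'e_i (v^~ t)) x 'e_j]) /\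
  (forall K, compact K -> K `<=` Q ->
    exists M,
      [/\ forall x t, K (x, t) ->
            [/\ `|v x t| <= M, `|grad (v^~ t) x| <= M,
                `|hess (v^~ t) x| <= M & `|dt v x t| <= M],
          forall x t s, K (x, t) -> K (x, s) ->
            `|grad (v^~ t) x - grad (v^~ s) x| <=
              M * `|t - s| `^ ((1 + al) / 2) &
          forall x t y s, K (x, t) -> K (y, s) ->
            `|hess (v^~ t) x - hess (v^~ s) y| <=
              M * (`|x - y| `^ al + `|t - s| `^ (al / 2)) /\
            `|dt v x t - dt v y s| <=
              M * (`|x - y| `^ al + `|t - s| `^ (al / 2))]).

Definition classical_solution (al T : R) (Om : set RN) (mu : RN -> R)
    (h0 : RN -> R -> R) (v0 : RN -> R) (v : RN -> R -> R) :=
  [/\ {within closure Om `*` `[0, T], continuous (uncurry v)},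
      parabolic_C2_holder al (Om `*` `]0, T[) v,
      forall x t, Om x -> t \in `]0, T[ ->
        dt v x t = laplacian (v^~ t) x + mu x * enorm (grad (v^~ t) x) ^+ 2,
      forall x t, (closure Om `\` Om) x -> t \in `]0, T[ -> v x t = h0 x t &
      forall x, Om x -> v x 0 = v0 x].

End LocalProblem.

Section NonlocalProblem.
Context {R : realType} {n : nat}.
Local Notation RN := 'rV[R]_n.+1.
Local Notation LN := (caratheodory_type (leb_outer_measure R n)).

Definition supp (f : RN -> R) : set RN := closure [set z | f z != 0].

Definition moment (J : RN -> R) : R :=
  \int[@lebN R n]_z (J z * (z : RN) 0 ord_max ^+ 2).

Definition kernel_assumptions (J : RN -> R) :=
  [/\ forall z, 0 <= J z,
      forall z w, enorm z = enorm w -> J z = J w,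
      continuous J /\ compact (supp J),
      (\int[@lebN R n]_z (J z)%:E = 1)%E &
      (\int[@lebN R n]_z (J z * (z : RN) 0 ord_max ^+ 2)%:E < +oo)%E].

Definition G_assumptions (G : RN -> R -> R) :=
  [/\ forall x s, 0 <= G x s,
      forall s, measurable_fun [set: LN] (fun x : LN => G x s),
      {ae @lebN R n, forall x, continuous (G x)} &
      exists a1 a2 : R, 0 < a1 <= a2 /\
        {ae @lebN R n, forall x, forall s s' : R, s != s' ->
          a1 <= (G x s * s - G x s' * s') / (s - s') <= a2}].

(* The Hoelder constants of G'_s(x, .) on bounded sets of s do not depend on x.
   With constants depending on x the convergence theorem fails. *)
Definition G_C1_holder (al : R) (Om : set RN) (G : RN -> R -> R) :=
  forall S : R, exists K : R,
    {ae @lebN R n, forall x, Om x ->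
      (forall s, derivable (G x) s 1) /\
      (forall s s', `|s| <= S -> `|s'| <= S ->
        `|'D_1 (G x) s - 'D_1 (G x) s'| <= K * `|s - s'| `^ al)}.

Definition Jeps (J : RN -> R) (eps : R) (z : RN) : R :=
  eps ^- n.+1 * J (eps^-1 *: z).

Definition OmJ (J : RN -> R) (eps : R) (Om : set RN) : set RN :=
  [set x + z | x in Om & z in supp (Jeps J eps)].

Definition nonlocal_op (J : RN -> R) (G : RN -> R -> R) (C : RN -> R)
    (Om : set RN) (eps : R) (w : RN -> R) (x : RN) : R :=
  C x / eps ^+ 2 *
  \int[@lebN R n]_(y in OmJ J eps Om)
    (Jeps J eps (x - y) * (w y - w x) * G x (w y - w x)).

Definition regular_solution (T : R) (J : RN -> R) (G : RN -> R -> R)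
    (C : RN -> R) (Om : set RN) (h : RN -> R -> R) (v0 : RN -> R) (eps : R)
    (u : RN -> R -> R) :=
  [/\ forall t, t \in `[0, T] -> {within closure Om, continuous (u^~ t)},
      forall t0, t0 \in `[0, T] ->
        sup_norm (closure Om) (fun x => u x t - u x t0)
          @[t --> within `[0, T] (nbhs t0)] --> 0%E,
      forall x t, (OmJ J eps Om `\` closure Om) x -> t \in `]0, T[ ->
        u x t = h x t,
      forall x t, closure Om x -> t \in `[0, T] ->
        u x t = v0 x + \int[lebesgue_measure]_(tau in `[0, t])
                         nonlocal_op J G C Om eps (u^~ tau) x &
      sup_norm (closure Om) (fun x => u x t - v0 x) @[t --> 0^'+] --> 0%E].

End NonlocalProblem.

(* Main.v *)
(** The nonlocal operator averages K x s = G x s * s over increments of the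
    solution, and K x is increasing, so regular solutions can be compared with
    local supersolutions of the time-integrated equation. As G is only
    controlled for almost every x, the comparison is run on a dense set of good
    points; continuity up to the boundary makes this enough.

    In the interior, v + w + d * t is a supersolution for small eps: the second
    order expansions of v in space and of K in s turn the kernel averages into
    Delta v + mu |grad v|^2. Near the initial time and the lateral boundary,
    where v need not be differentiable, the bound
    K x s <= G x 0 / k * (expR (k s) - 1) makes ln Psi / k a supersolution as
    soon as Psi is one for the linear averaging operator, and explicit Psi work:
    a paraboloid growing in time at t = 0, and A p - B p^2 plus a time parabola
    at the boundary, p being a quadratic function that vanishes at the boundary
    point and is positive on the rest of the domain near it. Compactness of the
    space-time cylinder gives u <= v + w for small eps, and the argument applied
    to -u and -v gives the other half. *)
Require Import Defs.
From mathcomp Require Import all_boot all_order all_algebra.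
From mathcomp Require Import all_classical all_reals all_analysis.
From mathcomp Require Import measurable_realfun ess_sup_inf.
From mathcomp Require Import perm ring lra.

Set Implicit Arguments.
Unset Strict Implicit.
Unset Printing Implicit Defensive.

Import Order.TTheory GRing.Theory Num.Theory.
Import numFieldNormedType.Exports.

Local Open Scope classical_set_scope.
Local Open Scope ring_scope.

(** * Lebesgue measure on R^N *)

Section LebesgueTheory.
Context {R : realType} {n : nat}.
Local Notation RN := 'rV[R]_n.+1.
Local Notation LN := (caratheodory_type (leb_outer_measure R n)).
Local Notation mu := (@lebN R n).
Implicit Types (a b x y : RN) (A : set RN) (i j : 'I_n.+1).

(** The nonlocal equation is known only in integrated form and at good points, so nothing can be
    differentiated at a maximum of [u - psi]. Supersolutions are therefore strict by a margin, which
    pays for moving to a nearby good point and for testing on a short time interval that ends at the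
    maximum. The exponential is the Cole-Hopf substitution, which linearises the local equation when
    [mu] is constant. Here only a one-sided bound survives, with one large [k] for all [x]; that is
    what a supersolution requires. Two obstacles come from the data. And [h] is given with a
    separate constant for each [eps], on exterior sets that need not be nested, the support of [J]
    possibly being an annulus; all its bounds are taken at one fixed scale, whose exterior set
    contains a full collar of the domain. *)

Lemma box_volume_ge0 a b : 0 <= box_volume a b.
Proof. by apply: prodr_ge0 => i _; rewrite le_max lexx. Qed.

Lemma leb_outer_box a b : (leb_outer (box a b) <= (box_volume a b)%:E)%E.
Proof.
apply: ereal_inf_lbound.
exists (fun k => if k == 0%N then (a, b) else (0, 0)).
  by move=> x abx; exists 0%N.
rewrite nneseries_recl//; last first.
  by move=> *; rewrite lee_fin box_volume_ge0.
rewrite /= eseries0 ?adde0// => -[//|k] _ _ /=.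
by rewrite /box_volume big_ord_recl mxE subrr maxxx mul0r.
Qed.

Lemma box_volumeD1 i a b : box_volume a b =
  Num.max 0 (b 0 i - a 0 i) *
  \prod_(j < n.+1 | j != i) Num.max 0 (b 0 j - a 0 j).
Proof. by rewrite /box_volume (bigD1 i). Qed.

Definition set_coord i (c : R) (a : RN) : RN :=
  \row_j (if j == i then c else a 0 j).

(** The hyperplane cuts each box of a cover into two boxes, obtained by clamping one end of side [i]
    at [c]. Their volumes add up to the original volume, even when one of them is empty, because
    side lengths are truncated at 0. *)
Lemma halfspace_caratheodory i c :
  (leb_outer_measure R n).-caratheodory [set x | x 0 i <= c].
Proof.
apply: le_caratheodory_measurable => X.
apply/le_ereal_inf_tmp => _ [B XB <-] /=.
pose lo k : RN * RN := ((B k).1, set_coord i (Num.min ((B k).2 0 i) c) (B k).2).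
pose hi k : RN * RN := (set_coord i (Num.max ((B k).1 0 i) c) (B k).1, (B k).2).
have vge0 (F : nat -> RN * RN) k : (0 <= (box_volume (F k).1 (F k).2)%:E)%E.
  by rewrite lee_fin box_volume_ge0.
have -> : (\sum_(k <oo) (box_volume (B k).1 (B k).2)%:E =
    \sum_(k <oo) ((box_volume (lo k).1 (lo k).2)%:E +
                  (box_volume (hi k).1 (hi k).2)%:E))%E.
  apply: eq_eseriesr => k _; rewrite -EFinD; congr EFin.
  rewrite !(box_volumeD1 i) /= !mxE eqxx.
  rewrite [X in _ = _ * X + _](_ : _ =
    \prod_(j < n.+1 | j != i) Num.max 0 ((B k).2 0 j - (B k).1 0 j)); last first.
    by apply: eq_bigr => j /negbTE ji; rewrite mxE ji.
  rewrite [X in _ = _ + _ * X](_ : _ =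
    \prod_(j < n.+1 | j != i) Num.max 0 ((B k).2 0 j - (B k).1 0 j)); last first.
    by apply: eq_bigr => j /negbTE ji; rewrite mxE ji.
  rewrite -mulrDl; congr (_ * _).
  set a := (B k).1 0 i; set b := (B k).2 0 i.
  rewrite /Num.max /Num.min; case: (ltP b c) => ?; case: (ltP a c) => ? /=;
  by repeat (case: ifPn; rewrite -?leNgt => ?); lra.
rewrite nneseriesD//; apply: leeD; apply: ereal_inf_lbound.
- exists lo => // x [/XB [k _ Bx] xc]; exists k => // j /=.
  rewrite mxE; case: eqVneq => [->|_]; last exact: Bx.
  by case/andP: (Bx i) => -> /= ?; rewrite le_min xc andbT.
- exists hi => // x [/XB [k _ Bx] /negP]; rewrite -ltNge => xc; exists k => // j /=.
  rewrite mxE; case: eqVneq => [->|_]; last exact: Bx.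
  by case/andP: (Bx i) => ? ->; rewrite gt_max xc andbT andbT.
Qed.

Lemma measurable_box a b : measurable (box a b : set LN).
Proof.
pose H i c : set LN := [set x : RN | x 0 i <= c].
have mH i c : measurable (H i c) by exact: halfspace_caratheodory.
have -> : box a b = \bigcap_(i in [set: 'I_n.+1]) (H i (b 0 i) `\` H i (a 0 i)).
  apply/seteqP; split => [x abx i _|x abx i]; rewrite /H /=.
    by case/andP: (abx i) => ? ?; split => //; apply/negP; rewrite -ltNge.
  by have [/= -> /negP] := abx i I; rewrite -ltNge => ->.
apply: fin_bigcap_measurable; first exact: finite_finset.
by move=> i _; apply: measurableD.
Qed.

Lemma open_measurableN (U : set RN) : open U -> measurable (U : set LN).
Proof.
move=> oU.
(* [U] is the union of the boxes with rational corners that it contains; a pair of corners whose box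
   leaves [U] contributes the empty set. *)
pose q (r : 'rV[rat]_n.+1) : RN := map_mx ratr r.
pose F (p : 'rV[rat]_n.+1 * 'rV[rat]_n.+1) : set LN :=
  [set x : RN | box (q p.1) (q p.2) x /\ box (q p.1) (q p.2) `<=` U].
have -> : U = \bigcup_p F p.
  apply/seteqP; split => [x Ux|x [p _ [px pU]]]; last exact: pU.
  move: oU => /(_ x Ux) /nbhs_ballP[e /= e0 eU].
  have lo_ (i : 'I_n.+1) : {r : rat | x 0 i - e < ratr r < x 0 i}.
    apply: cid; have [|r] := @rat_in_itvoo R (x 0 i - e) (x 0 i); first by lra.
    by rewrite in_itv => ?; exists r.
  have hi_ (i : 'I_n.+1) : {r : rat | x 0 i < ratr r < x 0 i + e}.
    apply: cid; have [|r] := @rat_in_itvoo R (x 0 i) (x 0 i + e); first by lra.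
    by rewrite in_itv => ?; exists r.
  exists (\row_i sval (lo_ i), \row_i sval (hi_ i)) => //; split.
    move=> i /=; rewrite !mxE.
    by case: (lo_ i) => r /= /andP[_ ->]; case: (hi_ i) => s /= /andP[/ltW ->].
  move=> y /= By; apply: eU; split => // i j; rewrite ord1.
  have := By j; rewrite !mxE; case: (lo_ j) => r /= /andP[r1 r2].
  case: (hi_ j) => s /= /andP[s1 s2] /andP[y1 y2].
  rewrite /ball /= ltr_distlC; apply/andP; split.
    by apply: (lt_trans _ y1).
  exact: (le_lt_trans y2).
apply: countable_bigcupT_measurable => [|p]; first exact: countableP.
have [pU|npU] := pselect (box (q p.1) (q p.2) `<=` U).
  rewrite (_ : F p = box (q p.1) (q p.2)); first exact: measurable_box.
  by apply/seteqP; split => [x []|x].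
rewrite (_ : F p = set0); first exact: measurable0.
by apply/seteqP; split => [x []|x].
Qed.

Lemma closed_measurableN (U : set RN) : closed U -> measurable (U : set LN).
Proof.
move=> cU; rewrite -(setCK U); apply: measurableC.
by apply: open_measurableN; exact: closed_openC.
Qed.

Lemma within_continuous_measurable (D : set RN) (f : RN -> R) :
  measurable (D : set LN) -> {within D, continuous f} ->
  measurable_fun (D : set LN) (f : LN -> R).
Proof.
move=> mD cf; apply: (measurability _ (measurable_realfun.RGenOInfty.measurableE R)).
move=> _ [_ [a ->] <-].
have oa : open (`]a, +oo[%classic : set R) by exact: interval_open.
have /open_subspaceP[V oV VD] := (continuousP (f : subspace D -> R)).1 cf _ oa.
rewrite setIC -VD; apply: measurableI => //.
exact: open_measurableN.
Qed.

Lemma continuous_measurableN (f : RN -> R) :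
  continuous f -> measurable_fun [set: LN] (f : LN -> R).
Proof.
move=> cf; apply: within_continuous_measurable => //.
exact: continuous_subspaceT.
Qed.

(** The slack [e] is there for maps that do not send half-open boxes to half-open boxes, such as
    reflections. The [k]-th box of a cover receives the share [e / 2 ^ k.+1], and the shares add up
    to [e]. *)
Lemma leb_outer_preimage_le (phi : RN -> RN) (c : R) A : 0 < c ->
  (forall a b (e : R), 0 < e -> exists a' b', phi @^-1` box a b `<=` box a' b' /\
     box_volume a' b' <= c * box_volume a b + e) ->
  (leb_outer (phi @^-1` A) <= c%:E * leb_outer A)%E.
Proof.
move=> c0 phibox; rewrite -lee_pdivrMl//.
apply/le_ereal_inf_tmp => _ [B AB <-] /=; rewrite lee_pdivrMl//.
have vge0 (F : nat -> RN * RN) k : (0 <= (box_volume (F k).1 (F k).2)%:E)%E.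
  by rewrite lee_fin box_volume_ge0.
apply/lee_addgt0Pr => e e0.
have e2 k : 0 < e / (2 ^ k.+1)%:R by rewrite divr_gt0// ltr0n expn_gt0.
have /choice[F PF] : forall k, exists F : RN * RN,
    phi @^-1` box (B k).1 (B k).2 `<=` box F.1 F.2 /\
    box_volume F.1 F.2 <= c * box_volume (B k).1 (B k).2 + e / (2 ^ k.+1)%:R.
  move=> k; have [a' [b' [ab vab]]] := phibox (B k).1 (B k).2 _ (e2 k).
  by exists (a', b').
apply: (@le_trans _ _ (\sum_(k <oo) (box_volume (F k).1 (F k).2)%:E)%E).
  apply: ereal_inf_lbound; exists F => // x /= /AB[k _ Bk].
  by exists k => //; apply: (PF k).1.
rewrite -nneseriesZl; [|by move=> k _; exact: (vge0 B k)].
apply: (@le_trans _ _ (\sum_(k <oo) (c%:E * (box_volume (B k).1 (B k).2)%:E +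
    (e / (2 ^ k.+1)%:R)%:E))%E).
  apply: lee_nneseries => [k _ _|k _]; first exact: vge0.
  by rewrite -EFinM -EFinD lee_fin; exact: (PF k).2.
by apply: epsilon_trick => [k|]; [rewrite mule_ge0// lee_fin ltW|exact: ltW].
Qed.

Definition leb_scaling (phi : RN -> RN) (c : R) :=
  0 < c /\ forall A, leb_outer (phi @^-1` A) = (c%:E * leb_outer A)%E.

(** One inequality is [leb_outer_preimage_le] for [phi]; the other is the same bound for the inverse
    [psi], applied to the preimage of [A]. *)
Lemma leb_scalingP (phi psi : RN -> RN) (c : R) : 0 < c ->
  cancel phi psi ->
  (forall a b (e : R), 0 < e -> exists a' b', phi @^-1` box a b `<=` box a' b' /\
     box_volume a' b' <= c * box_volume a b + e) ->
  (forall a b (e : R), 0 < e -> exists a' b', psi @^-1` box a b `<=` box a' b' /\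
     box_volume a' b' <= c^-1 * box_volume a b + e) ->
  cancel psi phi -> leb_scaling phi c.
Proof.
move=> c0 phiK h1 h2 psiK; split => // A; apply/eqP; rewrite eq_le.
rewrite leb_outer_preimage_le//=.
have c'0 : 0 < c^-1 by rewrite invr_gt0.
have := leb_outer_preimage_le (phi @^-1` A) c'0 h2.
rewrite -comp_preimage (_ : phi \o psi = id) ?preimage_id; last first.
  by apply/funext => x /=; rewrite psiK.
by rewrite lee_pdivlMl.
Qed.

Lemma leb_scaling_affine x0 (e : R) : 0 < e ->
  leb_scaling (fun z => x0 + e *: z) (e^-1 ^+ n.+1).
Proof.
have aux y (d : R) : 0 < d -> forall a b (r : R), 0 < r -> exists a' b',
   (fun z => y + d *: z) @^-1` box a b `<=` box a' b' /\
     box_volume a' b' <= d^-1 ^+ n.+1 * box_volume a b + r.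
  move=> d0 a b r r0; exists (d^-1 *: (a - y)), (d^-1 *: (b - y)); split.
    move=> z /= zab i; have := zab i; rewrite !mxE => /andP[z1 z2].
    rewrite ![d^-1 * _]mulrC ltr_pdivrMr// ler_pdivlMr//.
    by apply/andP; split; lra.
  rewrite ler_wpDr ?(ltW r0)//.
  have -> : d^-1 ^+ n.+1 = \prod_(i < n.+1) d^-1 by rewrite prodr_const card_ord.
  rewrite /box_volume -big_split/= le_eqVlt; apply/orP; left; apply/eqP.
  apply: eq_bigr => i _; rewrite !mxE maxr_pMr ?invr_ge0 ?ltW// mulr0.
  by congr (Num.max _ _); ring.
move=> e0; have e1 : 0 < e^-1 by rewrite invr_gt0.
apply: (@leb_scalingP _ (fun z => - (e^-1 *: x0) + e^-1 *: z)).
- by rewrite exprn_gt0.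
- by move=> z; rewrite scalerDr scalerA mulVf ?gt_eqF// scale1r addKr.
- exact: aux.
- by have := aux (- (e^-1 *: x0)) _ e1; rewrite -exprVn.
- move=> z; rewrite scalerDr scalerN !scalerA mulfV ?gt_eqF// !scale1r.
  by rewrite addrA subrr add0r.
Qed.

Definition flip i (x : RN) : RN := \row_j (if j == i then - x 0 j else x 0 j).

Lemma flipK i : involutive (flip i).
Proof.
by move=> x; apply/rowP => j; rewrite !mxE; case: eqP => // _; rewrite opprK.
Qed.

Lemma leb_scaling_flip i : leb_scaling (flip i) 1.
Proof.
have aux a b (e : R) : 0 < e -> exists a' b', flip i @^-1` box a b `<=` box a' b' /\
     box_volume a' b' <= 1 * box_volume a b + e.
  move=> e0; rewrite mul1r.
  pose r := \prod_(j < n.+1 | j != i) Num.max 0 (b 0 j - a 0 j).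
  have r0 : 0 <= r by apply: prodr_ge0 => j _; rewrite le_max lexx.
  (* The reflected side is closed on the left, so the box is lengthened there by [d]. This adds at
     most [d * r <= e] to the volume, [r] being the product of the other sides. *)
  pose d := e / (r + 1).
  have d0 : 0 < d by rewrite divr_gt0// ltr_wpDl.
  exists (set_coord i (- b 0 i - d) a), (set_coord i (- a 0 i) b); split.
    move=> x /= xab j; have := xab j; rewrite !mxE; case: eqVneq => [->|//].
    by move=> /andP[? ?]; apply/andP; split; lra.
  rewrite !(box_volumeD1 i) !mxE eqxx.
  rewrite [X in _ * X <= _](_ : _ = r); last first.
    by apply: eq_bigr => j /negbTE ji; rewrite !mxE ji.
  rewrite -/r; set m := Num.max 0 (b 0 i - a 0 i).
  apply: (@le_trans _ _ ((m + d) * r)).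
    apply: ler_wpM2r => //.
    by rewrite /m /Num.max; repeat (case: ifPn; rewrite -?leNgt => ?); lra.
  rewrite mulrDl lerD2l /d mulrAC ler_pdivrMr; last by lra.
  by rewrite ler_wpM2l//; lra.
by apply: (@leb_scalingP _ (flip i)) => //; rewrite ?invr1//; exact: flipK.
Qed.

Definition swap i j (x : RN) : RN := \row_k x 0 (tperm i j k).

Lemma swapK i j : involutive (swap i j).
Proof. by move=> x; apply/rowP => k; rewrite !mxE tpermK. Qed.

Lemma leb_scaling_swap i j : leb_scaling (swap i j) 1.
Proof.
have aux a b (e : R) : 0 < e -> exists a' b', swap i j @^-1` box a b `<=` box a' b' /\
     box_volume a' b' <= 1 * box_volume a b + e.
  move=> e0; exists (swap i j a), (swap i j b); split.
    by move=> x /= xab k; have := xab (tperm i j k); rewrite !mxE tpermK.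
  rewrite mul1r ler_wpDr ?(ltW e0)// le_eqVlt; apply/orP; left; apply/eqP.
  rewrite /box_volume [RHS](reindex_inj (@perm_inj _ (tperm i j)))/=.
  by apply: eq_bigr => k _; rewrite !mxE.
by apply: (@leb_scalingP _ (swap i j)) => //; rewrite ?invr1//; exact: swapK.
Qed.

(** A test set [X] is the preimage under [phi] of its preimage under [psi], so all three outer
    measures in the Caratheodory criterion carry the same factor [c]. *)
Lemma leb_scaling_measurable (phi psi : RN -> RN) c : leb_scaling phi c ->
  cancel psi phi -> cancel phi psi ->
  measurable_fun [set: LN] (phi : LN -> LN).
Proof.
move=> [c0 phic] psiK phiK _ A mA; rewrite setTI.
apply: le_caratheodory_measurable => X /=.
have XE : X = phi @^-1` (psi @^-1` X).
  by apply/seteqP; split => x /=; rewrite phiK.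
rewrite XE preimage_setC -!preimage_setI !phic -ge0_muleDr ?leb_outer_ge0//.
by rewrite lee_pmul2l// ?lte_fin// -(mA (psi @^-1` X)).
Qed.

Lemma leb_change_var (phi psi : RN -> RN) c (f : RN -> R) : leb_scaling phi c ->
  cancel psi phi -> cancel phi psi ->
  mu.-integrable [set: LN] (fun x : LN => (f x)%:E) ->
  \int[mu]_z f (phi z) = c * \int[mu]_x f x.
Proof.
move=> [c0 phic] psiK phiK fi.
have mphi := leb_scaling_measurable (conj c0 phic) psiK phiK.
have [mf _] := integrableP _ _ _ fi.
have key (g : LN -> \bar R) : measurable_fun [set: LN] g ->
    (forall x, 0 <= g x)%E ->
    (\int[mu]_z g (phi z) = c%:E * \int[mu]_x g x)%E.
  move=> mg g0; have c1 : 0 <= c by exact: ltW.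
  rewrite -(ge0_integral_mscale mu measurableT (NngNum c1))//.
  transitivity (\int[pushforward mu (phi : LN -> LN)]_x g x)%E.
    by rewrite ge0_integral_pushforward.
  by apply: eq_measure_integral => A mA _; exact: phic.
rewrite /Rintegral [in LHS]integralE [in RHS]integralE.
rewrite (_ : (fun x => (f (phi x))%:E)^\+ = (fun x => (EFin \o f)^\+ (phi x)))%E; last first.
  by apply/funext => z; rewrite !funeposE.
rewrite (_ : (fun x => (f (phi x))%:E)^\- = (fun x => (EFin \o f)^\- (phi x)))%E; last first.
  by apply/funext => z; rewrite !funenegE.
rewrite (key _ (measurable_funepos mf) (fun=> funepos_ge0 _ _)).
rewrite (key _ (measurable_funeneg mf) (fun=> funeneg_ge0 _ _)).
have fin1 := integrable_pos_fin_num measurableT fi.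
have fin2 := integrable_neg_fin_num measurableT fi.
rewrite -muleBr ?fin_num_adde_defr//.
by rewrite fineM// fin_numB fin1 fin2.
Qed.

End LebesgueTheory.

(** * Positivity of the measure on open sets *)

Section LebesguePositivity.
Context {R : realType} {n : nat}.
Local Notation RN := 'rV[R]_n.+1.
Local Notation LN := (caratheodory_type (leb_outer_measure R n)).
Local Notation mu := (@lebN R n).

Lemma coordN_continuous (i : 'I_n.+1) : continuous (fun x : RN => x 0 i).
Proof. exact: coord_continuous. Qed.

Lemma normr_coord_le (x : RN) i : `|x 0 i| <= `|x|.
Proof.
rewrite [`|x|]/Num.norm/= mx_normrE.
by apply: (le_bigmax _ (fun ij : 'I_1 * 'I_n.+1 => `|x ij.1 ij.2|) (0, i)).
Qed.

Lemma normr_row_le (x : RN) (r : R) : 0 <= r ->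
  (forall i, `|x 0 i| <= r) -> `|x| <= r.
Proof.
move=> r0 xr; rewrite [`|x|]/Num.norm/= mx_normrE.
by apply/bigmax_leP; split => // -[i j] _ /=; rewrite ord1.
Qed.

Lemma mu_ball_lty (r : R) : (mu [set x : RN | (`|x| <= r)%R] < +oo)%E.
Proof.
apply: (@le_lt_trans _ _ (box_volume (const_mx (- r - 1)) (const_mx r))%:E).
  apply: (le_trans _ (leb_outer_box _ _)); apply: leb_outer_le => x /= xr i.
  have := le_trans (normr_coord_le x i) xr; rewrite ler_norml !mxE => /andP[? ?].
  by apply/andP; split => //; lra.
exact: ltry.
Qed.

Lemma measurable_normle (r : R) : measurable ([set x : RN | `|x| <= r] : set LN).
Proof.
apply: closed_measurableN.
apply: (@closed_comp _ _ (fun x : RN => `|x|) [set y | y <= r]); last exact: closed_le.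
by move=> x _; exact: norm_continuous.
Qed.

(** If [U] were null, so would be every ball about 0, which lies in the preimage of [U] under a
    dilation, and hence the whole space. The positivity of the total measure will come from the unit
    mass of the kernel, which avoids computing the measure of a box. *)
Lemma mu_open_gt0 (U : set RN) : (0 < mu setT)%E -> open U -> U !=set0 ->
  (0 < mu U)%E.
Proof.
move=> mu0 oU [x0 Ux0]; rewrite lt0e measure_ge0 andbT; apply/eqP => U0.
move: oU => /(_ _ Ux0) /nbhs_ballP[e /= e0 eU].
have : (mu setT <= \sum_(k <oo) mu [set z : RN | (`|z| < k.+1%:R)%R])%E.
  apply: le_trans (leb_outer_sigma_subadditive _).
  apply: leb_outer_le => z _; exists (Num.truncn `|z|) => //=.
  by rewrite truncnS_gt.
rewrite eseries0 => [|k _ _]; first by rewrite leNgt mu0.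
apply/eqP; rewrite -measure_le0.
pose d := e / k.+1%:R; have d0 : 0 < d by rewrite divr_gt0.
apply: (@le_trans _ _ (leb_outer ((fun z => x0 + d *: z) @^-1` U))); last first.
  have [_ ->] := leb_scaling_affine x0 d0.
  by rewrite [leb_outer U](_ : _ = 0%E) ?mule0//; exact: U0.
apply: leb_outer_le => z /= zk; apply: eU; rewrite -ball_normE /=.
rewrite opprD addNKr normrN normrZ gtr0_norm// /d mulrAC ltr_pdivrMr//.
by rewrite ltr_pM2l.
Qed.

Lemma ae_dense (P : set RN) (U : set RN) : (0 < mu setT)%E ->
  {ae mu, forall x, P x} -> open U -> U !=set0 -> exists2 x, U x & P x.
Proof.
move=> mu0 [N [mN N0 PN]] oU U0; apply: contrapT => UP.
have := mu_open_gt0 mu0 oU U0; rewrite ltNge -N0 => /negP; apply.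
apply: le_measure; rewrite ?inE//; first exact: open_measurableN.
by move=> x Ux; apply: PN => /= Px; apply: UP; exists x.
Qed.

End LebesguePositivity.

(** * Averages against the kernel *)

Section Kernel.
Context {R : realType} {n : nat}.
Local Notation RN := 'rV[R]_n.+1.
Local Notation LN := (caratheodory_type (leb_outer_measure R n)).
Local Notation mu := (@lebN R n).
Context (J : RN -> R) (hJ : kernel_assumptions J).

Let J0 z : 0 <= J z. Proof. by have [] := hJ. Qed.
Let Jrad z w : enorm z = enorm w -> J z = J w.
Proof. by have [_ + _ _ _] := hJ; apply. Qed.
Let Jcont : continuous J. Proof. by have [_ _ []] := hJ. Qed.

Lemma kernel_support : exists2 r : R, 0 < r & forall z, J z != 0 -> `|z| <= r.
Proof.
have [_ _ [_ /compact_bounded[M [Mr HM]]] _ _] := hJ.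
exists (`|M| + 1) => [|z Jz]; first by rewrite ltr_wpDl.
by apply: HM; [rewrite (le_lt_trans (ler_norm M))// ltrDl|exact: subset_closure].
Qed.

Lemma kernel_bounded : exists M : R, forall z, J z <= M.
Proof.
have [_ _ [_ cK] _ _] := hJ.
have [K0|/set0P[k Kk]] := eqVneq (supp J) set0.
  exists 0 => z; rewrite leNgt; apply/negP => Jz.
  have : supp J z by apply: subset_closure; rewrite /= gt_eqF.
  by rewrite K0.
have [||c cK' Hc] := @compact_EVT_max _ _ J _ _ cK; first by exists k.
  exact: continuous_subspaceT.
exists (J c) => z; have [->|Jz] := eqVneq (J z) 0; first exact: J0.
by apply: Hc; rewrite inE; exact: subset_closure.
Qed.

(** The bound is asked only where [J] is nonzero, so that every continuous function qualifies, in
    particular coordinates and quadratic forms. *)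
Definition kernel_bdd (g : RN -> R) :=
  measurable_fun [set: LN] (g : LN -> R) /\
  exists M, forall z, J z != 0 -> `|g z| <= M.

(** An expectation, [J] being a probability density. *)
Definition Ev (g : RN -> R) : R := \int[mu]_z (J z * g z).

Lemma kernel_bdd_integrable g : kernel_bdd g ->
  mu.-integrable [set: LN] (fun z : LN => (J z * g z)%:E).
Proof.
move=> [mg [M gM]]; have [r r0 Jr] := kernel_support.
have [MJ JM] := kernel_bounded.
pose D : set LN := [set z : RN | `|z| <= r].
have mD : measurable D by exact: measurable_normle.
have -> : (fun z : LN => (J z * g z)%:E) = (fun z : LN => (J z * g z)%:E) \_ D.
  apply/funext => z; rewrite patchE; case: ifPn => // /negP zD.
  have [->|Jz] := eqVneq (J z) 0; first by rewrite mul0r.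
  by exfalso; apply: zD; rewrite inE; exact: Jr.
apply: (integrable_mkcond _ mD).1.
apply: (@measurable_bounded_integrable _ _ _ _ (fun z : LN => J z * g z)).
- exact: mD.
- exact: mu_ball_lty.
- apply: measurable_funTS; apply: measurable_funM; last exact: mg.
  exact: continuous_measurableN.
exists (`|MJ| * `|M|); split => // K KM z _ /=; rewrite normrM.
have [->|Jz] := eqVneq (J z) 0.
  by rewrite normr0 mul0r; apply: ltW; apply: le_lt_trans KM; rewrite mulr_ge0.
apply: ltW; apply: le_lt_trans KM; apply: ler_pM => //.
  by rewrite ger0_norm// (le_trans (JM z))// ler_norm.
by rewrite (le_trans (gM z Jz))// ler_norm.
Qed.

Lemma continuous_kernel_bdd g : continuous g -> kernel_bdd g.
Proof.
move=> cg; split; first exact: continuous_measurableN.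
have [_ _ [_ cK] _ _] := hJ.
have : compact (g @` supp J).
  by apply: continuous_compact => //; exact: continuous_subspaceT.
move=> /compact_bounded[M [Mr HM]]; exists (`|M| + 1) => z Jz.
apply: (HM (`|M| + 1)); first by rewrite (le_lt_trans (ler_norm M))// ltrDl.
by exists z => //; exact: subset_closure.
Qed.

Lemma kernel_bdd_cst c : kernel_bdd (fun=> c).
Proof. by apply: continuous_kernel_bdd => x; exact: cst_continuous. Qed.

Lemma kernel_bddD f g : kernel_bdd f -> kernel_bdd g -> kernel_bdd (f \+ g).
Proof.
move=> [mf [M fM]] [mg [M' gM]]; split; first exact: measurable_funD.
exists (M + M') => z Jz; rewrite (le_trans (ler_normD _ _))// lerD//.
  exact: fM.
exact: gM.
Qed.

Lemma kernel_bddM f g : kernel_bdd f -> kernel_bdd g -> kernel_bdd (f \* g).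
Proof.
move=> [mf [M fM]] [mg [M' gM]]; split; first exact: measurable_funM.
exists (M * M') => z Jz; rewrite normrM ler_pM//; [exact: fM|exact: gM].
Qed.

Lemma kernel_bddZ c g : kernel_bdd g -> kernel_bdd (fun z => c * g z).
Proof. by move=> ?; apply: kernel_bddM => //; exact: kernel_bdd_cst. Qed.

Lemma EvD f g : kernel_bdd f -> kernel_bdd g ->
  Ev (fun z => f z + g z) = Ev f + Ev g.
Proof.
move=> hf hg; rewrite /Ev -RintegralD//; try exact: kernel_bdd_integrable.
by apply: eq_Rintegral => z _; rewrite mulrDr.
Qed.

Lemma EvZ c g : kernel_bdd g -> Ev (fun z => c * g z) = c * Ev g.
Proof.
move=> hg; rewrite /Ev -RintegralZl//; try exact: kernel_bdd_integrable.
by apply: eq_Rintegral => z _; rewrite mulrCA.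
Qed.

Lemma Ev_le f g : kernel_bdd f -> kernel_bdd g ->
  (forall z, J z != 0 -> f z <= g z) -> Ev f <= Ev g.
Proof.
move=> hf hg fg; apply: le_Rintegral => //; try exact: kernel_bdd_integrable.
move=> z _; have [->|Jz] := eqVneq (J z) 0; first by rewrite !mul0r.
by apply: ler_wpM2l => //; exact: fg.
Qed.

Lemma Ev_cst c : Ev (fun=> c) = c.
Proof.
rewrite (_ : (fun=> c) = (fun=> c * 1)); last by rewrite mulr1.
rewrite EvZ; last exact: kernel_bdd_cst.
rewrite /Ev; under eq_Rintegral do rewrite mulr1.
by have [_ _ _ + _] := hJ; rewrite /Rintegral => ->; rewrite mulr1.
Qed.

Lemma Ev_leD f g c : kernel_bdd f -> kernel_bdd g ->
  (forall z, J z != 0 -> f z <= g z + c) -> Ev f <= Ev g + c.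
Proof.
move=> hf hg fg; have hc := kernel_bdd_cst c.
rewrite -[X in _ + X](Ev_cst c) -(EvD hg hc).
exact: (Ev_le hf (kernel_bddD hg hc)).
Qed.

Lemma Ev_norm_le f c : kernel_bdd f -> (forall z, J z != 0 -> `|f z| <= c) ->
  `|Ev f| <= c.
Proof.
move=> hf fc; rewrite ler_norml -{1}(Ev_cst (- c)) -{2}(Ev_cst c).
have hc d := kernel_bdd_cst d; apply/andP; split.
  by apply: (Ev_le (hc _) hf) => z /fc; rewrite ler_norml => /andP[].
by apply: (Ev_le hf (hc _)) => z /fc; rewrite ler_norml => /andP[].
Qed.

Lemma Ev_sum (I : Type) (s : seq I) (P : pred I) (F : I -> RN -> R) :
  (forall i, kernel_bdd (F i)) ->
  kernel_bdd (fun z => \sum_(i <- s | P i) F i z) /\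
  Ev (fun z => \sum_(i <- s | P i) F i z) = \sum_(i <- s | P i) Ev (F i).
Proof.
move=> hF; elim: s => [|i s [IH1 IH2]].
  rewrite big_nil; under eq_fun do rewrite big_nil; split; last exact: Ev_cst.
  exact: kernel_bdd_cst.
rewrite big_cons; under eq_fun do rewrite big_cons.
case: (P i); last by split; [exact: IH1|exact: IH2].
split; first exact: (kernel_bddD (hF i) IH1).
by rewrite (EvD (hF i) IH1) IH2.
Qed.

Lemma Ev_scaling (phi : RN -> RN) g : leb_scaling phi 1 -> involutive phi ->
  (forall z, enorm (phi z) = enorm z) -> kernel_bdd g ->
  Ev (g \o phi) = Ev g.
Proof.
move=> sphi phiK phiE hg.
rewrite /Ev -[RHS]mul1r -(leb_change_var sphi phiK phiK).
  by apply: eq_Rintegral => z _; rewrite (Jrad (phiE z)).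
exact: kernel_bdd_integrable.
Qed.

Lemma enorm_flip i (z : RN) : enorm (flip i z) = enorm z.
Proof.
rewrite /enorm; congr Num.sqrt; apply: eq_bigr => j _; rewrite mxE.
by case: eqP => // _; rewrite sqrrN.
Qed.

Lemma enorm_swap i j (z : RN) : enorm (swap i j z) = enorm z.
Proof.
rewrite /enorm; congr Num.sqrt.
rewrite [RHS](reindex_inj (@perm_inj _ (tperm i j)))/=.
by apply: eq_bigr => k _; rewrite mxE.
Qed.

Lemma Ev_odd i g : kernel_bdd g -> (forall z, g (flip i z) = - g z) -> Ev g = 0.
Proof.
move=> hg gN; have := Ev_scaling (leb_scaling_flip i) (flipK i) (enorm_flip i) hg.
rewrite (_ : g \o flip i = (fun z => -1 * g z)); last first.
  by apply/funext => z /=; rewrite gN mulN1r.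
by rewrite (EvZ _ hg); lra.
Qed.

Let kbc (i : 'I_n.+1) : kernel_bdd (fun z => z 0 i).
Proof. by apply: continuous_kernel_bdd; exact: coordN_continuous. Qed.

Lemma Ev_coord i : Ev (fun z => z 0 i) = 0.
Proof. by apply: (@Ev_odd i) => // z; rewrite mxE eqxx. Qed.

(** Off the diagonal, reflecting coordinate [i] changes the sign of the integrand. On the diagonal,
    a swap of coordinates reduces to the last coordinate, the one in [moment]. Both maps preserve
    the Euclidean norm and therefore the radial [J]. *)
Lemma Ev_coordM i j :
  Ev (fun z => z 0 i * z 0 j) = (i == j)%:R * moment J.
Proof.
have [->|ij] := eqVneq i j; last first.
  rewrite mul0r; apply: (@Ev_odd i) => [|z]; first exact: kernel_bddM.
  by rewrite !mxE eqxx eq_sym (negbTE ij) mulNr.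
rewrite mul1r -(Ev_scaling (leb_scaling_swap j ord_max) (swapK _ _)
  (enorm_swap _ _)); last exact: kernel_bddM.
by apply: eq_Rintegral => z _ /=; rewrite !mxE tpermL expr2.
Qed.

Definition dot (w z : RN) : R := \sum_i w 0 i * z 0 i.
Definition sq (z : RN) : R := dot z z.
Definition qform (H : 'M[R]_n.+1) (z : RN) : R :=
  \sum_i \sum_j H i j * (z 0 i * z 0 j).

Lemma kernel_bdd_dot w : kernel_bdd (dot w).
Proof. by apply: (Ev_sum _ _ _).1 => i; exact: kernel_bddZ. Qed.

Lemma kernel_bdd_sq : kernel_bdd sq.
Proof. by apply: (Ev_sum _ _ _).1 => i; exact: kernel_bddM. Qed.

Lemma kernel_bdd_qform H : kernel_bdd (qform H).
Proof.
apply: (Ev_sum _ _ _).1 => i; apply: (Ev_sum _ _ _).1 => j.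
by apply: kernel_bddZ; exact: kernel_bddM.
Qed.

Lemma Ev_dot w : Ev (dot w) = 0.
Proof.
rewrite /dot (Ev_sum _ _ _).2 => [|i]; last exact: kernel_bddZ.
by rewrite big1// => i _; rewrite EvZ// Ev_coord mulr0.
Qed.

Lemma Ev_qform H : Ev (qform H) = \tr H * moment J.
Proof.
rewrite /qform (Ev_sum _ _ _).2 => [|i]; last first.
  by apply: (Ev_sum _ _ _).1 => j; apply: kernel_bddZ; exact: kernel_bddM.
rewrite /mxtrace mulr_suml; apply: eq_bigr => i _.
rewrite (Ev_sum _ _ _).2 => [|j]; last by apply: kernel_bddZ; exact: kernel_bddM.
rewrite (bigD1 i)//= big1 => [|j /negbTE ji].
  by rewrite addr0 (EvZ _ (kernel_bddM (kbc i) (kbc i))) Ev_coordM eqxx mul1r.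
by rewrite (EvZ _ (kernel_bddM (kbc i) (kbc j))) Ev_coordM eq_sym ji mul0r mulr0.
Qed.

Lemma dot_sqr w z : dot w z ^+ 2 = qform (w^T *m w) z.
Proof.
rewrite expr2 /dot mulr_suml; apply: eq_bigr => i _; rewrite mulr_sumr.
by apply: eq_bigr => j _; rewrite !mxE big_ord1 !mxE; ring.
Qed.

Lemma Ev_dot_sqr w : Ev (fun z => dot w z ^+ 2) = sq w * moment J.
Proof.
rewrite (_ : (fun z => dot w z ^+ 2) = qform (w^T *m w)); last first.
  by apply/funext => z; rewrite dot_sqr.
rewrite Ev_qform; congr (_ * _); apply: eq_bigr => i _.
by rewrite mxE big_ord1 !mxE.
Qed.

Lemma sq_qform z : sq z = qform 1%:M z.
Proof.
apply: eq_bigr => i _; rewrite (bigD1 i)//= big1 => [|j /negbTE ji].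
  by rewrite mxE eqxx mul1r addr0.
by rewrite mxE [i == j]eq_sym ji mul0r.
Qed.

Lemma Ev_sq : Ev sq = n.+1%:R * moment J.
Proof.
rewrite (_ : sq = qform 1%:M) ?Ev_qform ?mxtrace1//.
by apply/funext => z; rewrite sq_qform.
Qed.

Lemma sq_flip i z : sq (flip i z) = sq z.
Proof.
apply: eq_bigr => j _; rewrite !mxE.
by case: eqP => // _; rewrite mulrNN.
Qed.

Lemma Ev_dotM_sq w : Ev (fun z => dot w z * sq z) = 0.
Proof.
rewrite (_ : (fun z => dot w z * sq z) =
    (fun z : RN => \sum_i w 0 i * z 0 i * sq z)); last first.
  by apply/funext => z; rewrite /dot mulr_suml.
have kb i : kernel_bdd (fun z => w 0 i * z 0 i * sq z).
  by apply: kernel_bddM; [exact: kernel_bddZ|exact: kernel_bdd_sq].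
rewrite (Ev_sum _ _ _).2// big1// => i _; apply: (@Ev_odd i) => // z.
by rewrite sq_flip mxE eqxx; ring.
Qed.

(** Over a null space [J] could not have integral 1. *)
Lemma mu_setT_gt0 : (0 < mu setT)%E.
Proof.
rewrite lt0e measure_ge0 andbT; apply/eqP => mu0.
have [_ _ _ + _] := hJ; rewrite null_set_integral; last exact: mu0.
- by move=> /eqP; rewrite eq_sym onee_eq0.
- exact: measurableT.
- by apply/measurable_EFinP; exact: continuous_measurableN.
Qed.

Lemma open_kernel_neq0 : open [set z | J z != 0].
Proof.
apply: (@open_comp _ _ J [set y | y != 0]); last exact: open_neq.
by move=> z _; exact: Jcont.
Qed.

(** [J] cannot vanish everywhere, and where it is nonzero it is nonzero on a neighbourhood, which
    leaves the hyperplane. This gives both the positivity of the moment and a sphere of positive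
    radius on which the radial [J] is nonzero. *)
Lemma kernel_neq0 : exists z : RN, J z != 0 /\ z 0 ord_max != 0.
Proof.
apply: contrapT => H.
have : Ev (fun=> 1) = 0.
  apply/eqP; rewrite eq_le; apply/andP; split.
    rewrite -(Ev_cst 0); apply: Ev_le; try exact: kernel_bdd_cst.
    move=> z Jz; exfalso.
    have /nbhs_ballP[e /= e0 eJ] := open_kernel_neq0 Jz.
    pose w := z + const_mx (e / 2) : RN.
    have [z0|z0] := eqVneq (z 0 ord_max) 0; last by apply: H; exists z.
    apply: H; exists w; split; last by rewrite !mxE z0 add0r; lra.
    apply: eJ; rewrite -ball_normE /= /w opprD addNKr normrN.
    apply: (@le_lt_trans _ _ (e / 2)); last by lra.
    apply: normr_row_le => [|i]; first by lra.
    by rewrite mxE gtr0_norm//; lra.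
  by rewrite -(Ev_cst 0); apply: Ev_le; try exact: kernel_bdd_cst.
by rewrite Ev_cst; apply/eqP; exact: oner_neq0.
Qed.

(** A zero integral would make the continuous nonnegative integrand vanish almost everywhere, hence
    somewhere in the nonempty open set where it is nonzero. *)
Lemma moment_gt0 : 0 < moment J.
Proof.
pose f (z : RN) := J z * z 0 ord_max ^+ 2.
have f0 z : 0 <= f z by rewrite mulr_ge0// sqr_ge0.
have kb : kernel_bdd (fun z => z 0 ord_max ^+ 2) by exact: kernel_bddM.
have fi := kernel_bdd_integrable kb.
have mfe := measurable_int _ fi.
rewrite lt_neqAle Rintegral_ge0 ?andbT; last by move=> z _; exact: f0.
apply/eqP => /esym m0.
have i0 : (\int[mu]_z `|(f z)%:E| = 0)%E.
  under eq_integral do rewrite gee0_abs ?lee_fin//.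
  have /fineK <- := integrable_fin_num measurableT fi.
  by rewrite -[fine _]/(moment J) m0.
have /(ae_eq_integral_abs _ measurableT mfe) ae0 := i0.
have [z0 [Jz0 zz0]] := kernel_neq0.
have cf : continuous f.
  have cc := @coordN_continuous R n ord_max.
  by move=> z; apply: (cvgM (@Jcont z) (cvgM (@cc z) (@cc z))).
have oU : open [set z | f z != 0].
  apply: (@open_comp _ _ f [set y | y != 0]); last exact: open_neq.
  by move=> z _; exact: cf.
have [|z fz] := ae_dense mu_setT_gt0 ae0 oU.
  by exists z0; rewrite /= mulf_neq0// sqrf_eq0.
by move=> /(_ I) /= [] /eqP; apply/negP.
Qed.

End Kernel.

(** * Calculus on segments *)

Section Calculus.
Context {R : realType}.

Lemma within_continuousP (V : normedModType R) (A : set V) (f : V -> R) :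
  {within A, continuous f} <->
  forall x, A x -> forall e, 0 < e -> exists2 d, 0 < d &
    forall y, A y -> `|y - x| < d -> `|f y - f x| < e.
Proof.
rewrite subspace_continuousP; split => H x Ax.
  move=> e e0; have /cvgrPdist_lt/(_ _ e0) := H x Ax.
  rewrite near_withinE => /nbhs_normP[d /= d0 dH]; exists d => // y Ay yx.
  by rewrite distrC; apply: dH => //=; rewrite distrC.
apply/cvgrPdist_lt => e e0; have [d d0 dH] := H x Ax e e0.
rewrite near_withinE; apply/nbhs_normP; exists d => // y /= yx Ay.
by rewrite distrC; apply: dH => //; rewrite distrC.
Qed.

Lemma derive_line (V : normedModType R) (f : V -> R) (p w : V) (s : R) :
  derivable f (p + s *: w) w ->
  is_derive s 1 (fun s => f (p + s *: w)) ('D_w f (p + s *: w)).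
Proof.
have E : (fun h : R => h^-1 *: (f (p + (h *: 1 + s) *: w) - f (p + s *: w))) =
    (fun h : R => h^-1 *: (f (h *: w + (p + s *: w)) - f (p + s *: w))).
  apply/funext => h; congr (_ *: (f _ - _)).
  by rewrite scalerDl [h *: 1]mulr1 addrCA.
move=> df; split; first by rewrite /derivable /= E.
by rewrite /derive /= E.
Qed.

Lemma segment_lipschitz (V : normedModType R) (f : V -> R) (p w : V) (c : R) :
  (forall s : R, 0 < s < 1 -> derivable f (p + s *: w) w /\
    `|'D_w f (p + s *: w)| <= c) ->
  {within `[0, 1], continuous (fun s : R => f (p + s *: w))} ->
  `|f (p + w) - f p| <= c.
Proof.
move=> fd cf; pose g (s : R) := f (p + s *: w).
have E : f (p + w) - f p = g 1 - g 0 by rewrite /g scale1r scale0r addr0.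
have gD (s : R) : s \in `]0, 1[ -> is_derive s 1 g ('D_w f (p + s *: w)).
  by rewrite in_itv => /fd[? _]; exact: derive_line.
rewrite E.
have [s s01 ->] := MVT (@ltr01 R) gD cf.
rewrite subr0 mulr1.
by rewrite in_itv in s01; have [] := fd _ s01.
Qed.

(** The starting point [p] may lie on the boundary of [A]: the mean value theorem needs derivatives
    on the open segment only, and continuity within [A] reaches the end. This is what allows
    segments that leave the domain from a boundary point. *)
Lemma C1_holder_segment (V : normedModType R) (al : R) (A : set V) (f : V -> R) :
  C1_holder al A f -> exists2 M, 0 <= M & (forall x, A° x -> `|f x| <= M) /\
    forall p w, A p -> (forall s : R, 0 < s <= 1 -> A° (p + s *: w)) ->
      `|f (p + w) - f p| <= M * `|w|.
Proof.
move=> [cf df [M HM]]; exists (Num.max 0 M); first by rewrite le_max lexx.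
have MM : M <= Num.max 0 M by rewrite le_max lexx orbT.
split => [x Ax|p w Ap Aw].
  by have [+ _ _] := HM x x 0 Ax Ax; move=> /le_trans; apply.
apply: segment_lipschitz => [s /andP[s0 s1]|].
  have Aps : A° (p + s *: w) by apply: Aw; rewrite s0 ltW.
  have dps := df _ Aps; split; first exact: diff_derivable.
  rewrite deriveE//; have [_ + _] := HM _ _ w Aps Aps.
  by move=> /le_trans; apply; rewrite ler_wpM2r.
have Aps (s : R) : s \in `[0, 1] -> A (p + s *: w).
  rewrite in_itv /= => /andP[]; rewrite le_eqVlt => /predU1P[<- _|s0 s1].
    by rewrite scale0r addr0.
  by apply: interior_subset; apply: Aw; rewrite s0.
apply/within_continuousP => s s01 e e0.
have [d d0 dH] := (within_continuousP A f).1 cf _ (Aps _ s01) e e0.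
exists (d / (`|w| + 1)) => [|t t01 ts]; first by rewrite divr_gt0// ltr_wpDl.
apply: dH; first exact: Aps.
rewrite opprD addrACA subrr add0r -scalerBl normrZ.
apply: (@le_lt_trans _ _ (`|t - s| * (`|w| + 1))).
  by rewrite ler_wpM2l// lerDl.
by rewrite -ltr_pdivlMr// ltr_wpDl.
Qed.

End Calculus.

(** * Monotone Lipschitz reaction terms *)

Section Reaction.
Context {R : realType} (a1 a2 : R) (g : R -> R).
Hypothesis slopes : forall s s' : R, s != s' ->
  a1 <= (g s * s - g s' * s') / (s - s') <= a2.
Local Notation K := (fun s => g s * s).

Lemma reaction_slope s s' : s' <= s ->
  a1 * (s - s') <= K s - K s' <= a2 * (s - s').
Proof.
rewrite le_eqVlt => /predU1P[->|ss]; first by rewrite !subrr !mulr0 lexx.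
have s0 : 0 < s - s' by rewrite subr_gt0.
have /slopes : s != s' by rewrite gt_eqF.
by rewrite ler_pdivlMr// ler_pdivrMr.
Qed.

Lemma reaction_le s s' : 0 <= a1 -> s' <= s -> K s' <= K s.
Proof.
move=> a10 ss; have /andP[H _] := reaction_slope ss.
by rewrite -subr_ge0 (le_trans _ H)// mulr_ge0// subr_ge0.
Qed.

Lemma reaction_lip s s' : 0 <= a1 -> `|K s - K s'| <= a2 * `|s - s'|.
Proof.
move=> a10; wlog ss : s s' / s' <= s.
  move=> H; have [/H//|/ltW/H] := leP s' s.
  by rewrite distrC [`|s' - s|]distrC.
rewrite ger0_norm ?subr_ge0; last exact: reaction_le.
by rewrite ger0_norm ?subr_ge0//; have /andP[] := reaction_slope ss.
Qed.

End Reaction.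

(** * Time intervals, compact cylinders and the reach of the kernel *)

Section Geometry.
Context {R : realType} {n : nat}.
Local Notation RN := 'rV[R]_n.+1.

Lemma lebesgue_itv_lty (b1 b2 : bool) (s t : R) :
  (lebesgue_measure [set` Interval (BSide b1 s) (BSide b2 t)] < +oo :> \bar R)%E.
Proof. by rewrite lebesgue_measure_itv /=; case: ifP => _ //; rewrite ltry. Qed.

Lemma lebesgue_itv_oo (s t : R) : s <= t ->
  fine (lebesgue_measure (`]s, t[%classic : set R)) = t - s.
Proof.
move=> st; rewrite lebesgue_measure_itv /= lte_fin.
by case: ltP => //= ts; rewrite (@le_anti _ _ s t) ?st ?subrr.
Qed.

Lemma prod_norm_lt (V W : normedModType R) (p q : V * W) (d : R) :
  (`|p - q| < d) = (`|p.1 - q.1| < d) && (`|p.2 - q.2| < d).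
Proof. by rewrite prod_normE gt_max. Qed.

Lemma continuous_slice (V : normedModType R) (f : V * R -> R) (y : V) (t : R) :
  {for (y, t), continuous f} -> {for y, continuous (fun y => f (y, t))}.
Proof.
move=> cf; apply: (@cvg_comp _ _ _ (fun y => (y, t)) f _ _ _ _ cf).
exact: (cvg_pair (@cvg_id _ _) (cvg_cst t)).
Qed.

Lemma continuous_scale_sub (V : normedModType R) (a : V) (e : R) :
  continuous (fun x : V => e *: (a - x)).
Proof.
by move=> x; apply: cvgZl_tmp; apply: cvgB; [exact: cvg_cst|exact: cvg_id].
Qed.

Lemma compact_closure_bounded (Om : set RN) :
  bounded_set Om -> compact (closure Om).
Proof.
move=> [M [_ HM]]; apply: bounded_closed_compact; last exact: closed_closure.
have cM : closed [set x : RN | `|x| <= M + 1].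
  apply: (@closed_comp _ _ (fun x : RN => `|x|) [set y | y <= M + 1]).
    by move=> x _; exact: norm_continuous.
  exact: closed_le.
have sub : closure Om `<=` [set x : RN | `|x| <= M + 1].
  rewrite [X in _ `<=` X](closure_id _).1//; apply: closure_subset => x Ox.
  by apply: (HM (M + 1)) => //; rewrite ltrDl.
exists (M + 1); split; first exact: num_real.
move=> K MK x /sub /= xM.
exact: le_trans xM (ltW MK).
Qed.

Lemma bounded_cylinder (Om : set RN) (T : R) (f : RN -> R -> R) : bounded_set Om ->
  {within closure Om `*` `[0, T], continuous (uncurry f)} ->
  exists M, forall x t, closure Om x -> 0 <= t <= T -> `|f x t| <= M.
Proof.
move=> bOm cf; have : compact (uncurry f @` (closure Om `*` `[0, T])).
  apply: continuous_compact => //; apply: compact_setX; last exact: segment_compact.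
  exact: compact_closure_bounded.
move=> /compact_bounded[M [_ HM]]; exists (M + 1) => x t clx tT.
apply: (HM (M + 1)); first by rewrite ltrDl.
by exists (x, t) => //; split => //=; rewrite in_itv.
Qed.

Context (J : RN -> R) (hJ : kernel_assumptions J) (eps : R) (eps0 : 0 < eps).
Context (Om : set RN).

Let epsN0 : eps != 0. Proof. by rewrite gt_eqF. Qed.

Lemma kernelN z : J (- z) = J z.
Proof.
have [_ + _ _ _] := hJ; apply; rewrite /enorm; congr Num.sqrt.
by apply: eq_bigr => i _; rewrite mxE sqrrN.
Qed.

Lemma JepsE x z : Jeps J eps (x - (x + eps *: z)) = eps ^- n.+1 * J z.
Proof.
by rewrite /Jeps opprD addNKr scalerN scalerA mulVf// scale1r kernelN.
Qed.

(** [OmJ] is built from points of [Om], but [J] is nonzero on an open set, so a boundary point [x]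
    can be replaced by a nearby point of [Om] that reaches the same target. *)
Lemma reach_OmJ x z : closure Om x -> J z != 0 -> OmJ J eps Om (x + eps *: z).
Proof.
move=> clx Jz; pose y := x + eps *: z.
have cf : continuous (fun x' : RN => eps^-1 *: (y - x')).
  exact: continuous_scale_sub.
have oU : open [set x' : RN | J (eps^-1 *: (y - x')) != 0].
  apply: (@open_comp _ _ (fun x' : RN => eps^-1 *: (y - x')) [set z | J z != 0]).
    by move=> x' _; exact: cf.
  exact: open_kernel_neq0.
have Ux : [set x' : RN | J (eps^-1 *: (y - x')) != 0] x.
  by rewrite /= /y [x + _]addrC addrK scalerA mulVf// scale1r.
have [x' [Ox' Jx']] := clx _ (open_nbhs_nbhs (conj oU Ux)).
exists x' => //; exists (y - x'); last by rewrite addrC subrK.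
by apply: subset_closure; rewrite /= /Jeps mulf_neq0// invr_eq0 expf_neq0.
Qed.

Lemma OmJ_reach x y : closure Om x -> Jeps J eps (x - y) != 0 -> OmJ J eps Om y.
Proof.
move=> clx; have yE : y = x + eps *: (eps^-1 *: (y - x)).
  by rewrite scalerA mulfV// scale1r addrC subrK.
rewrite {1}yE JepsE mulf_eq0 negb_or => /andP[_ Jz].
by rewrite yE; exact: reach_OmJ.
Qed.

Lemma open_OmJ : open Om -> open (OmJ J eps Om).
Proof.
move=> oOm; rewrite openE => _ [x Ox [z zJ <-]].
have /nbhs_ballP[e /= e0 eOm] := open_nbhs_nbhs (conj oOm Ox).
apply/nbhs_ballP; exists e => // y; rewrite -ball_normE /= => ye.
exists (y - z); last by exists z => //; rewrite subrK.
by apply: eOm; rewrite -ball_normE /= opprB addrA.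
Qed.

Lemma interior_prod (A : set RN) (T : R) (y : RN) (t : R) (U : set RN) :
  open U -> U `<=` A -> U y -> 0 < t < T -> (A `*` `]0, T]%classic)° (y, t).
Proof.
move=> oU UA Uy t0T.
exists (U, `]0, T[%classic).
  split; first exact: open_nbhs_nbhs.
  apply: open_nbhs_nbhs; split; first exact: interval_open.
  by rewrite /= in_itv.
move=> [y' t'] [/= Uy']; rewrite in_itv /= => /andP[t'0 t'T].
by split => /=; [exact: UA|rewrite in_itv /= t'0 ltW].
Qed.

End Geometry.

(** * The time-integrated nonlocal equation *)

Section NonlocalEquation.
Context {R : realType} {n : nat}.
Local Notation RN := 'rV[R]_n.+1.
Local Notation LN := (caratheodory_type (leb_outer_measure R n)).
Local Notation mu := (@lebN R n).
Context (al T eps : R) (Om : set RN) (J : RN -> R) (G : RN -> R -> R)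
  (C v0 : RN -> R) (h u : RN -> R -> R).
Hypotheses (hT : 0 < T) (eps0 : 0 < eps) (oOm : open Om) (bOm : bounded_set Om)
  (hJ : kernel_assumptions J)
  (hh : C1_holder al ((OmJ J eps Om `\` Om) `*` `]0, T]) (uncurry h))
  (hu : regular_solution T J G C Om h v0 eps u).
Local Notation cl := (closure Om).
Local Notation ext := (OmJ J eps Om `\` cl).

Let epsN0 : eps != 0. Proof. by rewrite gt_eqF. Qed.

Let open_ext : open ext.
Proof.
rewrite setDE; apply: openI; first exact: open_OmJ.
by apply: closed_openC; exact: closed_closure.
Qed.

Let interior_ext y t : ext y -> 0 < t < T ->
  ((OmJ J eps Om `\` Om) `*` `]0, T])° (y, t).
Proof.
move=> ey t0T; apply: (interior_prod open_ext) => // z [? nz]; split => //.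
by move=> Oz; apply: nz; exact: subset_closure.
Qed.

Lemma solution_exterior y t : ext y -> 0 < t < T -> u y t = h y t.
Proof.
move=> ey t0T; have [_ _ + _ _] := hu; apply; first exact: ey.
by rewrite in_itv.
Qed.

(** The constant belongs to the fixed [eps]. It serves the measurability and integrability of the
    operator, not the passage to the limit. *)
Lemma exterior_data_bounds : exists2 M, 0 <= M & forall y t, ext y -> 0 < t < T ->
  `|h y t| <= M /\ forall s, 0 < s < T -> `|h y s - h y t| <= M * `|s - t|.
Proof.
have [M M0 [HM Hseg]] := C1_holder_segment hh; exists M => // y t ey t0T.
split; first exact: (HM (y, t) (interior_ext ey t0T)).
move=> s s0T; have := Hseg (y, t) (0, s - t).
have -> : (y, t) + (0, s - t) = (y, s).
  by congr (_, _) => /=; [rewrite addr0|rewrite addrC subrK].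
have -> : `|(0 : RN, s - t)| = `|s - t|.
  by rewrite prod_normE /= normr0; apply/max_idPr.
apply; first by apply: interior_subset; exact: interior_ext.
move=> r /andP[r0 r1].
have -> : (y, t) + r *: (0, s - t) = (y, t + r * (s - t)).
  by congr (_, _) => /=; rewrite scaler0 addr0.
apply: interior_ext => //; case/andP: t0T => t0 tT; case/andP: s0T => s0 sT.
by apply/andP; split; nra.
Qed.

Lemma solution_time_continuous (t0 : R) : 0 <= t0 <= T -> forall e, 0 < e ->
  exists2 d, 0 < d & forall t, 0 <= t <= T -> `|t - t0| < d ->
    forall x, cl x -> `|u x t - u x t0| < e.
Proof.
move=> t0T e e0; have [_ + _ _ _] := hu; move=> /(_ t0).
rewrite in_itv /= => /(_ t0T) H.
have : nbhs 0%E [set y : \bar R | (y < e%:E)%E].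
  by apply: open_nbhs_nbhs; split; [exact: open_ereal_lt_ereal|rewrite /= lte_fin].
move=> /H; rewrite /nbhs /= => /nbhs_normP[d /= d0 dH]; exists d => // t tT td x clx.
rewrite -lte_fin; apply: (le_lt_trans _ (dH t _ _)).
- by apply: ereal_sup_ubound; exists x.
- by rewrite /= distrC.
- by rewrite /= in_itv.
Qed.

Lemma solution_continuous : {within cl `*` `[0, T], continuous (uncurry u)}.
Proof.
apply/within_continuousP => -[x0 t0] [/= clx0]; rewrite in_itv /= => t0T e e0.
have e2 : 0 < e / 2 by rewrite divr_gt0.
have [d d0 dH] := solution_time_continuous t0T e2.
have [+ _ _ _ _] := hu; move=> /(_ t0); rewrite in_itv /= => /(_ t0T).
move=> /within_continuousP/(_ x0 clx0 _ e2)[d' d'0 d'H].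
exists (Num.min d d') => [|[x t] [/= clx]]; first by rewrite lt_min d0.
rewrite in_itv /= prod_norm_lt /= !lt_min => tT /andP[/andP[_ xd'] /andP[td _]].
have -> : u x t - u x0 t0 = (u x t - u x t0) + (u x t0 - u x0 t0) by ring.
apply: (le_lt_trans (ler_normD _ _)).
by rewrite [e]splitr ltrD//; [exact: dH|exact: d'H].
Qed.

Lemma solution_bounded : exists M, forall x t, cl x -> 0 <= t <= T -> `|u x t| <= M.
Proof.
exact: bounded_cylinder bOm solution_continuous.
Qed.

(** Nothing is known about [u] beyond [OmJ], so it is replaced by 0 there. For [0 < t < T] the
    result is measurable and bounded on the whole space, and agrees with [u] wherever the kernel
    looks. *)
Definition patched (t : R) : RN -> R :=
  (fun y => (u^~ t \_ cl) y + (h^~ t \_ ext) y).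

Lemma patched_cl t x : cl x -> patched t x = u x t.
Proof.
move=> clx; rewrite /patched !patchE mem_set// memNset ?addr0//.
by move=> [].
Qed.

Lemma patched_OmJ t y : 0 < t < T -> OmJ J eps Om y -> patched t y = u y t.
Proof.
move=> t0T Jy; have [clx|ncl] := pselect (cl y); first exact: patched_cl.
rewrite /patched !patchE memNset// mem_set// add0r solution_exterior//.
Qed.

Lemma patched_out t y : ~ cl y -> ~ OmJ J eps Om y -> patched t y = 0.
Proof.
by move=> ncl nJ; rewrite /patched !patchE !memNset//; [exact: addr0|case].
Qed.

Lemma patched_reach t x z : 0 < t < T -> cl x -> J z != 0 ->
  patched t (x + eps *: z) = u (x + eps *: z) t.
Proof. by move=> t0T clx Jz; apply: patched_OmJ => //; exact: reach_OmJ. Qed.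

Lemma measurable_patched (t : R) : 0 < t < T ->
  measurable_fun [set: LN] (patched t : LN -> R).
Proof.
move=> t0T; have mcl : measurable (cl : set LN).
  by apply: closed_measurableN; exact: closed_closure.
have mext : measurable (ext : set LN) by exact: open_measurableN.
apply: measurable_funD.
- apply: (measurable_restrictT _ mcl).1.
  apply: (@within_continuous_measurable R n cl (u^~ t) mcl).
  have [+ _ _ _ _] := hu; move=> /(_ t); apply.
  by rewrite in_itv /= !ltW//; case/andP: t0T.
- apply: (measurable_restrictT _ mext).1.
  apply: (@within_continuous_measurable R n ext (h^~ t) mext).
  apply: continuous_in_subspaceT => y; rewrite inE => ey.
  have [_ + _] := hh; move=> /(_ _ (interior_ext ey t0T)) /differentiable_continuous.
  exact: (@continuous_slice _ _ (uncurry h)).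
Qed.

Lemma patched_bounded : exists M, forall t y, 0 < t < T -> `|patched t y| <= M.
Proof.
have [M HM] := solution_bounded; have [M' M'0 HM'] := exterior_data_bounds.
exists (`|M| + M') => t y t0T.
have [clx|ncl] := pselect (cl y).
  rewrite patched_cl// (le_trans (HM _ _ clx _))//.
    by case/andP: t0T => ? ?; rewrite !ltW.
  by rewrite (le_trans (ler_norm M))// lerDl.
have [Jy|nJ] := pselect (OmJ J eps Om y); last first.
  by rewrite patched_out// normr0 addr_ge0.
rewrite patched_OmJ// solution_exterior//.
by have [+ _] := HM' y t (conj Jy ncl) t0T; move=> /le_trans; apply; rewrite lerDr.
Qed.

Lemma patched_time_continuous (t0 : R) : 0 < t0 < T -> forall e, 0 < e ->
  exists2 d, 0 < d & forall t, 0 < t < T -> `|t - t0| < d ->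
    forall y, `|patched t y - patched t0 y| <= e.
Proof.
move=> t0T e e0.
have [d d0 dH] : exists2 d, 0 < d & forall t, 0 <= t <= T -> `|t - t0| < d ->
    forall x, cl x -> `|u x t - u x t0| < e.
  by apply: solution_time_continuous => //; case/andP: t0T => ? ?; rewrite !ltW.
have [M M0 HM] := exterior_data_bounds.
exists (Num.min d (e / (M + 1))).
  by rewrite lt_min d0 divr_gt0// ltr_wpDl.
move=> t tT; rewrite lt_min => /andP[td te] y.
have [clx|ncl] := pselect (cl y).
  rewrite !patched_cl// ltW// dH//.
  by case/andP: tT => ? ?; rewrite !ltW.
have [Jy|nJ] := pselect (OmJ J eps Om y); last first.
  by rewrite !patched_out// subr0 normr0 ltW.
rewrite !patched_OmJ// !solution_exterior//.
have [_ /(_ _ tT)] := HM y t0 (conj Jy ncl) t0T; move=> /le_trans; apply.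
rewrite ltr_pdivlMr ?ltr_wpDl// in te.
by rewrite (le_trans _ (ltW te))// mulrC ler_wpM2l// lerDl.
Qed.

Section GoodPoint.
Context (a1 a2 : R) (x : RN).
Hypotheses (a10 : 0 < a1) (a12 : a1 <= a2) (Ox : Om x) (cG : continuous (G x)).
Hypothesis slopes : forall s s' : R, s != s' ->
  a1 <= (G x s * s - G x s' * s') / (s - s') <= a2.
Local Notation K := (fun s => G x s * s).

Let clx : cl x. Proof. exact: subset_closure. Qed.
Let K_lip s s' : `|K s - K s'| <= a2 * `|s - s'|.
Proof. exact: (reaction_lip slopes _ _ (ltW a10)). Qed.

Definition increments (t : R) : RN -> R :=
  fun z => K (patched t (x + eps *: z) - u x t).

Lemma increments_bdd (t : R) : 0 < t < T -> kernel_bdd J (increments t).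
Proof.
move=> t0T; split.
  have cK : continuous K.
    by move=> s; apply: (cvgM (@cG s)); exact: cvg_id.
  apply: (@measurableT_comp _ _ _ _ _ _ (K : R -> R)).
    exact: continuous_measurable_fun.
  apply: measurable_funB; last exact: measurable_cst.
  apply: (@measurableT_comp _ _ _ _ _ _ (patched t : LN -> R)).
    exact: measurable_patched.
  apply: (leb_scaling_measurable (leb_scaling_affine x eps0)
    (psi := fun y => eps^-1 *: (y - x))) => z.
    by rewrite scalerA mulfV// scale1r addrC subrK.
  by rewrite [x + _]addrC addrK scalerA mulVf// scale1r.
have [M HM] := patched_bounded; exists (a2 * (M + M)) => z Jz.
have := K_lip (patched t (x + eps *: z) - u x t) 0.
rewrite mulr0 !subr0 => /le_trans; apply.
rewrite ler_wpM2l ?(le_trans (ltW a10))//.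
rewrite (le_trans (ler_normB _ _))// lerD ?HM//.
by rewrite -(patched_cl t clx) HM.
Qed.

(** The change of variables [y = x + eps z], combined with the evenness of [J]. Passing from [OmJ]
    to the whole space adds nothing, since the kernel centred at [x] vanishes outside [OmJ]. *)
Lemma nonlocal_opE (t : R) : 0 < t < T ->
  nonlocal_op J G C Om eps (u^~ t) x = C x / eps ^+ 2 * Ev J (increments t).
Proof.
move=> t0T; rewrite /nonlocal_op; congr (_ * _).
pose f (z : RN) := eps ^- n.+1 * (J z * increments t z).
pose phi (y : RN) := - (eps^-1 *: x) + eps^-1 *: y.
have e'0 : 0 < eps^-1 by rewrite invr_gt0.
have phiE y : y = x + eps *: phi y.
  rewrite /phi scalerDr scalerN !scalerA mulfV// !scale1r.
  by rewrite addrA subrr add0r.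
have phiK z : phi (x + eps *: z) = z.
  by rewrite /phi scalerDr scalerA mulVf// scale1r addKr.
have fi := kernel_bdd_integrable hJ (increments_bdd t0T).
have := leb_change_var (leb_scaling_affine (- (eps^-1 *: x)) e'0)
  (psi := fun z => x + eps *: z) phiK (fun y => esym (phiE y)) (f := f).
rewrite invrK => H.
transitivity (eps ^+ n.+1 * \int[mu]_z f z); last first.
  by rewrite /f RintegralZl// mulrA mulfV ?mul1r// expf_neq0.
rewrite -H; last first.
  rewrite /f; under eq_fun do rewrite EFinM.
  exact: integrableZl.
rewrite Rintegral_mkcond; apply: eq_Rintegral => y _; rewrite patchE.
rewrite -/(phi y) /f /increments -phiE.
have JE : Jeps J eps (x - y) = eps ^- n.+1 * J (phi y).
  by rewrite {1}(phiE y) JepsE.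
case: ifPn => [|/negP]; rewrite inE => Jy.
  by rewrite JE patched_OmJ//; ring.
have : Jeps J eps (x - y) = 0.
  by apply/eqP; apply/negPn/negP => Jn; apply: Jy; exact: OmJ_reach Jn.
by rewrite JE => JE0; rewrite (mulrA (eps ^- n.+1)) JE0 mul0r.
Qed.

Lemma Ev_increments_continuous (t0 : R) : 0 < t0 < T -> forall e, 0 < e ->
  exists2 d, 0 < d & forall t, 0 < t < T -> `|t - t0| < d ->
    `|Ev J (increments t) - Ev J (increments t0)| <= e.
Proof.
move=> t0T e e0; have a20 : 0 < a2 by apply: lt_le_trans a12.
pose e' := e / (2 * a2).
have e'0 : 0 < e' by rewrite divr_gt0// mulr_gt0.
have [d d0 dH] := patched_time_continuous t0T e'0.
have key t s z : (forall y, `|patched t y - patched s y| <= e') ->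
    increments t z <= increments s z + e.
  move=> ts; rewrite -lerBlDl (le_trans (ler_norm _))//.
  apply: (le_trans (K_lip _ _)).
  apply: (@le_trans _ _ (a2 * (e' + e'))); last first.
    by rewrite /e' le_eqVlt; apply/orP; left; apply/eqP; field; rewrite gt_eqF.
  rewrite ler_wpM2l ?(ltW a20)//.
  set A := patched t _; set B := patched s _.
  have -> : A - u x t - (B - u x s) = (A - B) - (u x t - u x s) by ring.
  rewrite (le_trans (ler_normB _ _))// lerD//; first exact: ts.
  by rewrite -!(patched_cl _ clx); exact: ts.
exists d => // t tT td; rewrite ler_distlC lerBlDr; apply/andP; split.
  apply: (Ev_leD hJ (increments_bdd tT) (increments_bdd t0T)).
  by move=> z _; apply: key => y; exact: dH.
apply: (Ev_leD hJ (increments_bdd t0T) (increments_bdd tT)).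
by move=> z _; apply: key => y; rewrite distrC; exact: dH.
Qed.

Local Notation F := (fun t => nonlocal_op J G C Om eps (u^~ t) x).

(** In the open time interval the operator is continuous, because the solution and the exterior data
    vary in time uniformly in space. *)
Lemma nonlocal_op_integrable : lebesgue_measure.-integrable `[0, T] (EFin \o F).
Proof.
have [M HM] := patched_bounded.
have oF : measurable_fun `]0, T[ F.
  apply: open_continuous_measurable_fun; first exact: interval_open.
  move=> t0; rewrite inE /= in_itv /= => t0T.
  apply/cvgrPdist_lt => e e0; rewrite nonlocal_opE//.
  pose c := C x / eps ^+ 2.
  have e'0 : 0 < e / (2 * (`|c| + 1)) by rewrite divr_gt0// mulr_gt0// ltr_wpDl.
  have [d d0 dH] := Ev_increments_continuous t0T e'0.
  have oT : nbhs t0 (`]0, T[%classic : set R).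
    by apply: open_nbhs_nbhs; split; [exact: interval_open|rewrite /= in_itv].
  near=> t.
  have tT : 0 < t < T.
    by have : (`]0, T[%classic : set R) t by near: t; exact: oT.
  rewrite nonlocal_opE// -mulrBr normrM -/c distrC.
  have td : `|t - t0| < d.
    near: t; apply/nbhs_normP; exists d => // y /=; rewrite distrC//.
  apply: (@le_lt_trans _ _ (`|c| * (e / (2 * (`|c| + 1))))).
    by rewrite ler_wpM2l// dH.
  rewrite mulrCA -[X in _ < X]mulr1 ltr_pM2l// ltr_pdivrMr ?mulr_gt0 ?ltr_wpDl//.
  by rewrite mul1r; have := normr_ge0 c; lra.
have mF : measurable_fun `[0, T] F.
  by apply/measurable_fun_itv_obnd_cbndP/measurable_fun_itv_bndo_bndcP.
apply: measurable_bounded_integrable => //.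
  exact: lebesgue_itv_lty.
pose B0 := `|C x / eps ^+ 2| * (a2 * (M + M)).
have FB (t : R) : 0 < t < T -> `|F t| <= B0.
  move=> tT; rewrite nonlocal_opE// normrM ler_wpM2l//.
  have bz z : `|increments t z| <= a2 * (M + M).
    have := K_lip (patched t (x + eps *: z) - u x t) 0.
    rewrite mulr0 !subr0 => /le_trans; apply.
    rewrite ler_wpM2l ?(le_trans (ltW a10))//.
    rewrite (le_trans (ler_normB _ _))// lerD ?HM//.
    by rewrite -(patched_cl t clx) HM.
  by apply: (Ev_norm_le hJ (increments_bdd tT)) => z _; exact: bz.
(* At times 0 and [T] the exterior condition says nothing about [u], so the operator is bounded
   there by its own values. *)
exists (`|B0| + `|F 0| + `|F T|); split; first exact: num_real.
move=> B MB t /=; rewrite in_itv /= => /andP[t0 tT].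
apply: ltW; apply: le_lt_trans MB.
have := normr_ge0 (F 0); have := normr_ge0 (F T); have := normr_ge0 B0.
move: t0; rewrite le_eqVlt => /predU1P[<-|t0]; first by lra.
move: tT; rewrite le_eqVlt => /predU1P[->|tT]; first by lra.
have : `|F t| <= B0 by apply: FB; rewrite t0.
by have := ler_norm B0; lra.
Unshelve. all: by end_near. Qed.

Lemma solution_increment s t : 0 <= s -> s <= t -> t <= T ->
  u x t - u x s = \int[lebesgue_measure]_(tau in `]s, t]) F tau.
Proof.
move=> s0 st tT; have [_ _ _ + _] := hu => hE.
rewrite !hE//= ?in_itv /= ?(le_trans s0 st) ?s0 ?(le_trans st tT)//.
rewrite opprD addrACA subrr add0r (@Rintegral_itvB _ _ (BLeft 0) (BRight t))//.
- apply: integrableS nonlocal_op_integrable => //.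
  by apply: subset_itvl; rewrite bnd_simp.
Qed.

(** The bound is asked on the open interval only, since at the endpoint [T] the exterior values are
    not prescribed; the endpoint is null. *)
Lemma Rintegral_le_cst (f : R -> R) s t c : s <= t ->
  lebesgue_measure.-integrable `]s, t] (EFin \o f) ->
  (forall tau, s < tau < t -> f tau <= c) ->
  \int[lebesgue_measure]_(tau in `]s, t]) f tau <= c * (t - s).
Proof.
move=> st fi fc.
have fi' : lebesgue_measure.-integrable `]s, t[ (EFin \o f).
  by apply: integrableS fi => //; apply: subset_itvl; rewrite bnd_simp.
rewrite -Rintegral_itv_bndo_bndc//.
have -> : c * (t - s) = \int[lebesgue_measure]_(tau in `]s, t[) c.
  rewrite Rintegral_cst//; congr (_ * _); exact/esym/lebesgue_itv_oo.
apply: le_Rintegral => //.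
  apply: measurable_bounded_integrable => //.
    exact: lebesgue_itv_lty.
  by exists `|c|; split; [exact: num_real|move=> B cB tau _; exact: ltW].
Qed.

Lemma Rintegral_ge_cst (f : R -> R) s t c : s <= t ->
  lebesgue_measure.-integrable `]s, t] (EFin \o f) ->
  (forall tau, s < tau < t -> c <= f tau) ->
  c * (t - s) <= \int[lebesgue_measure]_(tau in `]s, t]) f tau.
Proof.
move=> st fi fc; rewrite -lerN2 -mulNr -[X in X <= _]mulN1r -RintegralZl//.
apply: Rintegral_le_cst => // [|tau /fc]; last by rewrite mulN1r lerN2.
have -> : EFin \o (fun tau => -1 * f tau) = (fun tau => (-1)%:E * (EFin \o f) tau)%E.
  by apply/funext => tau /=; rewrite -EFinM.
exact: integrableZl.
Qed.

Hypothesis Cx0 : 0 <= C x.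

Let integrable_oc s t : 0 <= s -> t <= T ->
  lebesgue_measure.-integrable `]s, t] (EFin \o F).
Proof.
move=> s0 tT; apply: integrableS nonlocal_op_integrable => //.
by apply: subset_itv; rewrite bnd_simp.
Qed.

Let Ceps0 : 0 <= C x / eps ^+ 2.
Proof. by rewrite divr_ge0// exprn_ge0// ltW. Qed.

(** The comparison argument sees the dynamics only through this lemma and its mirror image. The
    majorant [b] may depend on the time [tau]; the rate [c] may not. *)
Lemma solution_increment_le s t c : 0 <= s -> s <= t -> t <= T ->
  (forall tau, s < tau < t -> exists b, [/\ kernel_bdd J b,
     forall z, J z != 0 -> K (u (x + eps *: z) tau - u x tau) <= b z &
     C x / eps ^+ 2 * Ev J b <= c]) ->
  u x t - u x s <= c * (t - s).
Proof.
move=> s0 st tT H; rewrite solution_increment//.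
apply: Rintegral_le_cst => //; first exact: integrable_oc.
move=> tau /andP[stau taut].
have tau0T : 0 < tau < T by rewrite (le_lt_trans s0)// (lt_le_trans taut).
have [|b [bb Kb]] := H tau; first by rewrite stau.
apply: le_trans; rewrite nonlocal_opE// ler_wpM2l//.
apply: (Ev_le hJ (increments_bdd tau0T) bb) => z Jz.
by rewrite /increments patched_reach//; exact: Kb.
Qed.

Lemma solution_increment_ge s t c : 0 <= s -> s <= t -> t <= T ->
  (forall tau, s < tau < t -> exists b, [/\ kernel_bdd J b,
     forall z, J z != 0 -> b z <= K (u (x + eps *: z) tau - u x tau) &
     c <= C x / eps ^+ 2 * Ev J b]) ->
  c * (t - s) <= u x t - u x s.
Proof.
move=> s0 st tT H; rewrite solution_increment//.
apply: Rintegral_ge_cst => //; first exact: integrable_oc.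
move=> tau /andP[stau taut].
have tau0T : 0 < tau < T by rewrite (le_lt_trans s0)// (lt_le_trans taut).
have [|b [bb Kb /le_trans]] := H tau; first by rewrite stau.
apply; rewrite nonlocal_opE// ler_wpM2l//.
apply: (Ev_le hJ bb (increments_bdd tau0T)) => z Jz.
by rewrite /increments patched_reach//; exact: Kb.
Qed.

End GoodPoint.
End NonlocalEquation.

Lemma continuous_increment (R : realType) (V : normedModType R) (P : V -> R) (x : V)
  (e : R) : continuous P -> continuous (fun z => P (x + e *: z) - P x).
Proof.
move=> cP z; apply: cvgB; last exact: cvg_cst.
apply: (@cvg_comp _ _ _ (fun z => x + e *: z) P _ _ _ _ (@cP (x + e *: z))).
by apply: cvgD; [exact: cvg_cst|apply: cvgZl_tmp; exact: cvg_id].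
Qed.

Lemma continuous_separated (R : realType) (V : normedModType R) (P : V -> R)
    (Th : R -> R) :
  continuous P -> continuous Th -> continuous (fun p : V * R => P p.1 + Th p.2).
Proof.
move=> cP cTh [x t]; apply: cvgD.
  by apply: (@cvg_comp _ _ _ fst P _ _ _ _ (@cP x)); exact: cvg_fst.
by apply: (@cvg_comp _ _ _ snd Th _ _ _ _ (@cTh t)); exact: cvg_snd.
Qed.

Lemma exists_lt_all (R : realType) (s : seq R) : all (fun x => 0 < x) s ->
  exists2 r, 0 < r & all (fun x => r < x) s.
Proof.
elim: s => [|x s IH] /=; first by exists 1.
move=> /andP[x0 /IH[r r0 rs]]; exists (Num.min (x / 2) r).
  by rewrite lt_min divr_gt0.
rewrite gt_min ltr_pdivrMr// ltr_pMr// ltr1n /=.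
by apply: sub_all rs => y ry; rewrite gt_min ry orbT.
Qed.

Lemma closed_dist_le (R : realType) (V : normedModType R) (x0 : V) (r : R) :
  closed [set x : V | `|x - x0| <= r].
Proof.
apply: (@closed_comp _ _ (fun x : V => `|x - x0|) [set y | y <= r]).
  by move=> y _; apply: cvg_norm; apply: cvgB; [exact: cvg_id|exact: cvg_cst].
exact: closed_le.
Qed.

Lemma continuous_prodr (R : realType) (V : normedModType R) (f g : V -> R) :
  continuous f -> continuous g -> continuous (fun x => f x * g x).
Proof. by move=> cf cg x; apply: (cvgM (@cf x) (@cg x)). Qed.

Lemma continuous_addr (R : realType) (V : normedModType R) (f g : V -> R) :
  continuous f -> continuous g -> continuous (fun x => f x + g x).
Proof. by move=> cf cg x; apply: (cvgD (@cf x) (@cg x)). Qed.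

Lemma continuous_subr_cst (R : realType) (V : normedModType R) (f : V -> R) c :
  continuous f -> continuous (fun x => f x - c).
Proof. by move=> cf x; apply: (cvgB (@cf x) (cvg_cst c)). Qed.

Lemma continuous_affine_cst (R : realType) (V : normedModType R) (a b : R)
    (f : V -> R) : continuous f -> continuous (fun x => a + b * f x).
Proof.
by move=> cf x; apply: (cvgD (cvg_cst a) (cvgM (cvg_cst b) (@cf x))).
Qed.

Lemma continuous_sumr (R : realType) (V : normedModType R) (I : Type) (s : seq I)
    (F : I -> V -> R) :
  (forall i, continuous (F i)) -> continuous (fun x => \sum_(i <- s) F i x).
Proof.
move=> cF; elim: s => [|i s IH] x.
  rewrite (_ : (fun x => _) = fun=> 0); last by apply/funext => y; rewrite big_nil.
  exact: cvg_cst.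
rewrite (_ : (fun x => _) = fun x => F i x + \sum_(j <- s) F j x); last first.
  by apply/funext => y; rewrite big_cons.
by apply: (cvgD (@cF i x) (@IH x)).
Qed.

(** * The Euclidean quadratic form against the sup norm *)

Section Quadratic.
Context {R : realType} {n : nat}.
Local Notation RN := 'rV[R]_n.+1.
Implicit Types a b w z : RN.
Local Notation N := (n.+1%:R : R).

Lemma dotDl a b z : dot (a + b) z = dot a z + dot b z.
Proof. by rewrite -big_split; apply: eq_bigr => i _; rewrite mxE mulrDl. Qed.

Lemma dotDr w a b : dot w (a + b) = dot w a + dot w b.
Proof. by rewrite -big_split; apply: eq_bigr => i _; rewrite mxE mulrDr. Qed.

Lemma dotZl (c : R) a z : dot (c *: a) z = c * dot a z.
Proof. by rewrite mulr_sumr; apply: eq_bigr => i _; rewrite mxE mulrA. Qed.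

Lemma dotZr (c : R) a z : dot a (c *: z) = c * dot a z.
Proof. by rewrite mulr_sumr; apply: eq_bigr => i _; rewrite mxE mulrCA. Qed.

Lemma sqZ (c : R) z : sq (c *: z) = c ^+ 2 * sq z.
Proof. by rewrite /sq dotZl dotZr mulrA. Qed.

Lemma sqD a b : sq (a + b) = sq a + 2 * dot a b + sq b.
Proof.
rewrite /sq dotDl !dotDr.
have -> : dot b a = dot a b by apply: eq_bigr => i _; rewrite mulrC.
by ring.
Qed.

Lemma sq_ge0 z : 0 <= sq z.
Proof. by apply: sumr_ge0 => i _; rewrite -expr2 sqr_ge0. Qed.

Lemma sqr_norm_le_sq z : `|z| ^+ 2 <= sq z.
Proof.
rewrite -[leRHS](sqr_sqrtr (sq_ge0 z)) lerXn2r// ?nnegrE ?sqrtr_ge0//.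
apply: normr_row_le => [|i]; first exact: sqrtr_ge0.
rewrite -sqrtr_sqr ler_wsqrtr// /sq /dot (bigD1 i)//= -expr2 lerDl.
by apply: sumr_ge0 => j _; rewrite -expr2 sqr_ge0.
Qed.

Lemma norm_dot_le a b : `|dot a b| <= N * `|a| * `|b|.
Proof.
apply: (le_trans (ler_norm_sum _ _ _)).
apply: (@le_trans _ _ (\sum_(i < n.+1) `|a| * `|b|)).
  by apply: ler_sum => i _; rewrite normrM ler_pM ?normr_coord_le.
by rewrite sumr_const card_ord -(mulr_natl (`|a| * `|b|)) mulrA.
Qed.

Lemma sq_le_norm z : sq z <= N * `|z| ^+ 2.
Proof. by rewrite expr2 mulrA (le_trans (ler_norm _))// norm_dot_le. Qed.

Lemma continuous_dot (l x0 : RN) : continuous (fun x : RN => dot l (x - x0)).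
Proof.
apply: continuous_sumr => i.
rewrite (_ : (fun x => _) = fun x : RN => l 0 i * (x 0 i - x0 0 i)); last first.
  by apply/funext => y; rewrite !mxE.
apply: continuous_prodr; first by move=> x; exact: cst_continuous.
exact/continuous_subr_cst/coordN_continuous.
Qed.

Lemma continuous_sq (x0 : RN) : continuous (fun x : RN => sq (x - x0)).
Proof.
apply: continuous_sumr => i.
rewrite (_ : (fun x => _) =
  fun x : RN => (x 0 i - x0 0 i) * (x 0 i - x0 0 i)); last first.
  by apply/funext => y; rewrite !mxE.
by apply: continuous_prodr; exact/continuous_subr_cst/coordN_continuous.
Qed.

End Quadratic.

Lemma nbhs_dist_lt (R : realType) (V : normedModType R) (x0 : V) (r : R) :
  0 < r -> nbhs x0 [set x | `|x - x0| < r].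
Proof. by move=> r0; apply/nbhs_normP; exists r => // x /=; rewrite distrC. Qed.

(** * Comparison and barriers *)

Section Convergence.
Context {R : realType} {n : nat}.
Local Notation RN := 'rV[R]_n.+1.

(* Everything the upper bound needs, in a form invariant under negating [u] and
   [v] (see [setup_neg]). [K x s] is [G x s * s], with [G0] and [G1] its Taylor
   coefficients at [0], and [m] is the coefficient [mu]. [setup_le] and
   [setup_ge] are the nonlocal equation; the bound [b] is only required where
   the kernel is nonzero. *)
Record setup (J : RN -> R) (T a1 a2 : R) (Om good : set RN)
    (C G0 G1 m : RN -> R) (K : RN -> R -> R) (u : R -> RN -> R -> R)
    (v : RN -> R -> R) : Prop := Setup {
  setup_J : kernel_assumptions J;
  setup_T : 0 < T;
  setup_a1 : 0 < a1;
  setup_a12 : a1 <= a2;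
  setup_open : open Om;
  setup_bounded : bounded_set Om;
  setup_good : good `<=` Om;
  setup_dense : forall (x : RN) (r : R), closure Om x -> 0 < r ->
    exists2 y, good y & `|y - x| < r;
  setup_K0 : forall x : RN, good x -> K x 0 = 0;
  setup_slope : forall (x : RN) (s s' : R), good x -> s' <= s ->
    a1 * (s - s') <= K x s - K x s' <= a2 * (s - s');
  setup_taylor : forall w : R, 0 < w -> exists2 s0 : R, 0 < s0 &
    forall (x : RN) (s : R), good x ->
    `|s| <= s0 -> `|K x s - G0 x * s - G1 x * s ^+ 2| <= w * s ^+ 2;
  setup_G0 : forall x, good x -> a1 <= G0 x <= a2;
  setup_G1 : exists b : R, forall x, good x -> `|G1 x| <= b;
  setup_C : forall x, good x -> C x * G0 x = 2 / moment J;
  setup_mu : forall x, good x -> C x * G1 x * moment J = m x;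
  setup_cont : forall eps : R, 0 < eps ->
    {within closure Om `*` `[0, T], continuous (uncurry (u eps))};
  setup_init : forall (eps : R) (x : RN), 0 < eps -> closure Om x -> u eps x 0 = v x 0;
  setup_le : forall (eps : R) (x : RN) (s t c : R), 0 < eps -> good x ->
    0 <= s -> s <= t -> t <= T ->
    (forall tau : R, s < tau < t -> exists b, [/\ kernel_bdd J b,
       forall z, J z != 0 -> K x (u eps (x + eps *: z) tau - u eps x tau) <= b z &
       C x / eps ^+ 2 * Ev J b <= c]) ->
    u eps x t - u eps x s <= c * (t - s);
  setup_ge : forall (eps : R) (x : RN) (s t c : R), 0 < eps -> good x ->
    0 <= s -> s <= t -> t <= T ->
    (forall tau : R, s < tau < t -> exists b, [/\ kernel_bdd J b,
       forall z, J z != 0 -> b z <= K x (u eps (x + eps *: z) tau - u eps x tau) &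
       c <= C x / eps ^+ 2 * Ev J b]) ->
    c * (t - s) <= u eps x t - u eps x s;
  setup_ext : exists e1 M : R, 0 < e1 /\ forall (eps : R) (x z : RN) (t : R), 0 < eps < e1 ->
    closure Om x -> J z != 0 -> ~ closure Om (x + eps *: z) -> 0 < t < T ->
    `|u eps (x + eps *: z) t| <= M;
  setup_bdry : forall (x0 : RN) (t0 w : R), closure Om x0 -> ~ Om x0 -> 0 <= t0 <= T -> 0 < w ->
    exists2 r : R, 0 < r & forall (eps : R) (x z : RN) (t : R), 0 < eps < r ->
    closure Om x -> J z != 0 -> ~ closure Om (x + eps *: z) -> 0 < t < T ->
    `|x + eps *: z - x0| < r -> `|t - t0| < r ->
    `|u eps (x + eps *: z) t - v x0 t0| <= w;
  setup_vcont : {within closure Om `*` `[0, T], continuous (uncurry v)};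
  setup_pde : forall (x0 : RN) (t0 : R), Om x0 -> 0 < t0 < T -> exists vt : R,
    forall w : R, 0 < w ->
    exists B r : R, 0 < r /\ forall (x : RN) (t : R), `|x - x0| < r -> `|t - t0| < r ->
    [/\ Om x, 0 < t < T,
      forall s : R, `|s - t0| < r -> `|v x t - v x s - vt * (t - s)| <= w * `|t - s| &
      exists (gr : RN) (H : 'M[R]_n.+1), [/\ forall y : RN, `|y| < r ->
          `|v (x + y) t - v x t - dot gr y - qform H y / 2| <= w * sq y,
        `|gr| <= B, `|H| <= B &
        `|\tr H + m x * sq gr - vt| <= w]];
  setup_sphere : forall x0 : RN, closure Om x0 -> ~ Om x0 ->
    exists (l : RN) (M r : R),
    [/\ l != 0, 0 <= M, 0 < r & forall x, closure Om x -> `|x - x0| < r ->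
      - M * sq (x - x0) <= dot l (x - x0)] }.

Context (J : RN -> R) (T a1 a2 : R) (Om good : set RN)
  (C G0 G1 m : RN -> R) (K : RN -> R -> R) (u : R -> RN -> R -> R)
  (v : RN -> R -> R).
Hypothesis S : setup J T a1 a2 Om good C G0 G1 m K u v.
Local Notation cl := (closure Om).
Local Notation N := (n.+1%:R : R).

Let hJ := setup_J S.
Let mJ0 : 0 < moment J := moment_gt0 hJ.
Let a10 := setup_a1 S.
Let a20 : 0 < a2 := lt_le_trans a10 (setup_a12 S).
Let T0 := setup_T S.
Let N0 : 0 < N. Proof. by rewrite ltr0n. Qed.
Ltac slra := clear - S hJ mJ0 a10 a20 T0 N0; lra.

Lemma good_closure x : good x -> cl x.
Proof. by move=> /(setup_good S); exact: subset_closure. Qed.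

Lemma C_bound x : good x -> 0 < C x <= 2 / moment J / a1.
Proof.
move=> gx; have /andP[G1x _] := setup_G0 S gx.
have G0x : 0 < G0 x by exact: lt_le_trans G1x.
have CG := setup_C S gx; have p0 : 0 < 2 / moment J by rewrite divr_gt0.
have C0 : 0 < C x by rewrite -(pmulr_lgt0 _ G0x) CG.
by rewrite C0 ler_pdivlMr// -CG ler_pM2l.
Qed.

(* [psi] is a strict supersolution near [(xs, ts)], tested backwards in time and
   at good points only; [b] dominates the reaction of the increments of [psi]. *)
Definition local_super (eps : R) (X : set RN) (t1 : R) (psi : RN -> R -> R)
    (xs : RN) (ts : R) :=
  exists c d r : R, [/\ 0 < d, 0 < r & forall x, good x -> `|x - xs| < r -> X x /\
    forall s : R, t1 < s -> ts - r < s -> s < ts ->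
      (c + d) * (ts - s) <= psi x ts - psi x s /\
      exists b, [/\ kernel_bdd J b,
        forall z, J z != 0 ->
          (X (x + eps *: z) \/ ~ cl (x + eps *: z) /\
             u eps (x + eps *: z) s <= psi (x + eps *: z) s) /\
          K x (psi (x + eps *: z) s - psi x s) <= b z &
        C x / eps ^+ 2 * Ev J b <= c]].

(** At a positive maximum of [u - psi], the space increments of [u] are dominated by those of [psi].
    Just before the maximum [u] therefore grows at a rate near [c] at most, while [psi] grows at
    rate [c + d] at least, so [u - psi] was larger earlier. All this is read at a good point near
    the maximum, where maximality holds up to small errors. *)
Lemma comparison (eps : R) (X : set RN) (t1 t2 : R) (psi : RN -> R -> R) :
  0 < eps -> compact X -> X `<=` cl -> 0 <= t1 -> t2 <= T ->
  {within X `*` `[t1, t2], continuous (uncurry psi)} ->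
  (forall x, X x -> u eps x t1 <= psi x t1) ->
  (forall (x : RN) (t : R), X x -> t1 < t <= t2 -> psi x t < u eps x t ->
    local_super eps X t1 psi x t) ->
  forall (x : RN) (t : R), X x -> t1 <= t <= t2 -> u eps x t <= psi x t.
Proof.
move=> eps0 cX Xcl t10 t2T cpsi init loc x0 t0 Xx0 t0t.
rewrite leNgt; apply/negP => up.
pose D (p : RN * R) := uncurry (u eps) p - uncurry psi p.
have cD : {within X `*` `[t1, t2], continuous D}.
  apply: within_continuousB => //.
  apply: continuous_subspaceW (setup_cont S eps0) => -[x t] [/= Xx].
  rewrite !in_itv /= => /andP[t1t tt2]; split => /=; first exact: Xcl.
  by rewrite (le_trans t10 t1t) (le_trans tt2 t2T).
have cXT : compact (X `*` `[t1, t2]).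
  by apply: compact_setX => //; exact: segment_compact.
have X0 : (X `*` `[t1, t2]) !=set0.
  by exists (x0, t0); split => //=; rewrite in_itv.
have [[xs ts]] := compact_EVT_max X0 cXT cD.
rewrite inE /= => -[/= Xxs]; rewrite in_itv /= => /andP[t1ts tst2] Dmax.
have Dle x t : X x -> t1 <= t <= t2 -> D (x, t) <= D (xs, ts).
  by move=> Xx tt; apply: Dmax; rewrite inE; split => //=; rewrite in_itv.
have Dpos : 0 < D (xs, ts).
  by apply: (lt_le_trans _ (Dle _ _ Xx0 t0t)); rewrite /D /= subr_gt0.
have t1ts' : t1 < ts.
  rewrite lt_neqAle t1ts andbT; apply/eqP => t1E.
  by move: Dpos; rewrite ltNge => /negP; apply; rewrite /D /= -t1E subr_le0 init.
have [||c [d [r [d0 r0 Hloc]]]] := loc _ _ Xxs (_ : t1 < ts <= t2).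
- by rewrite t1ts'.
- by move: Dpos; rewrite /D /= subr_gt0.
pose Cm := 2 / moment J / a1.
have Cm0 : 0 < Cm by rewrite /Cm !divr_gt0.
(* The error allowed in the space increments: through the slope bound [a2] and [C x <= Cm] it costs
   [Cm / eps ^+ 2 * (a2 * w0) = d / 4] in the growth rate of [u]. *)
pose w0 := d / 4 * eps ^+ 2 / (Cm * a2).
have w00 : 0 < w0.
  apply: divr_gt0; last exact: mulr_gt0.
  by apply: mulr_gt0; [lra|exact: exprn_gt0].
have xsP : (X `*` `[t1, t2]) (xs, ts).
  by split => //=; rewrite in_itv /= t1ts.
have [r1 r10 Hr1] := (within_continuousP _ _).1 cD _ xsP _ w00.
pose s' := Num.max t1 (Num.max (ts - r) (ts - r1)).
have s'ts : s' < ts by rewrite /s' !gt_max t1ts' /= !ltrBlDr !ltrDl r0 r10.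
pose s := (s' + ts) / 2.
have s's : s' < s by rewrite /s; lra.
have sts : s < ts by rewrite /s; lra.
have [t1s rs r1s] : [/\ t1 < s, ts - r < s & ts - r1 < s].
  by move: s's; rewrite /s' !gt_max => /and3P[].
(* The order of choices matters: [w0] fixes a time window, [s] is taken in it, and only then the
   good point [x], so close to [xs] that at time [ts] the loss stays below [w1], the amount by which
   [psi] outgrows [u] between [s] and [ts]. *)
pose w1 := 3 / 4 * d * (ts - s).
have w10 : 0 < w1 by rewrite /w1 !mulr_gt0 ?subr_gt0//; lra.
have [r2 r20 Hr2] := (within_continuousP _ _).1 cD _ xsP _ w10.
pose rr := Num.min r (Num.min r1 r2).
have rr0 : 0 < rr by rewrite /rr !lt_min r0 r10 r20.
have [x gx] := setup_dense S (Xcl _ Xxs) rr0.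
rewrite /rr !lt_min => /and3P[xr xr1 xr2].
have [Xx Hx] := Hloc x gx xr.
have t1t (t : R) : s <= t -> t <= ts -> t1 <= t <= t2.
  by move=> st tts; rewrite (le_trans (ltW t1s) st) (le_trans tts tst2).
have Dclose (t : R) : s <= t -> t <= ts -> D (xs, ts) - w0 < D (x, t).
  move=> st tts; have : `|D (x, t) - D (xs, ts)| < w0.
    apply: Hr1; first by split => //=; rewrite in_itv /= t1t.
    rewrite prod_norm_lt /= xr1 /= ltr_norml.
    by apply/andP; split; move: st tts r1s r10; slra.
  by rewrite ltr_norml => /andP[]; slra.
have Dts : D (xs, ts) - w1 < D (x, ts).
  have : `|D (x, ts) - D (xs, ts)| < w1.
    apply: Hr2; first by split => //=; rewrite in_itv /= t1t// ltW.
    by rewrite prod_norm_lt /= xr2 /= subrr normr0.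
  by rewrite ltr_norml => /andP[]; slra.
have [psis _] := Hx s t1s rs sts.
have ule : u eps x ts - u eps x s <= (c + d / 4) * (ts - s).
  apply: (setup_le S) => //; [exact: le_trans (ltW t1s)|exact: ltW|exact: le_trans t2T|].
  move=> tau /andP[stau tauts].
  have [_ [b [bb bK bc]]] := Hx tau (lt_trans t1s stau) (lt_trans rs stau) tauts.
  exists (fun z => b z + a2 * w0); split.
  - exact: (kernel_bddD bb (kernel_bdd_cst hJ _)).
  - move=> z Jz; have [yX yK] := bK z Jz; set y := x + eps *: z in yX yK *.
    (* At an exterior point the difference is at most 0, hence below the positive maximum. *)
    have Dy : u eps y tau - psi y tau <= D (xs, ts).
      case: yX => [Xy|[_ yle]]; last by apply: (le_trans _ (ltW Dpos)); rewrite subr_le0.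
      by apply: (Dle y tau Xy); rewrite t1t// ltW.
    have := Dclose tau (ltW stau) (ltW tauts); rewrite {2}/D /= => Dx.
    set A := u eps y tau - u eps x tau.
    set B := psi y tau - psi x tau in yK *.
    have AB : A <= B + w0 by move: Dy Dx; rewrite /A /B; slra.
    have /andP[K1 _] := setup_slope S gx AB.
    have /andP[_ K2] : a1 * (B + w0 - B) <= K x (B + w0) - K x B <= a2 * (B + w0 - B).
      by apply: (setup_slope S) => //; rewrite lerDl ltW.
    have : 0 <= a1 * (B + w0 - A) by rewrite mulr_ge0 ?subr_ge0// ltW.
    have Bw : B + w0 - B = w0 by ring.
    by move: K1 K2 yK; rewrite Bw; slra.
  - rewrite EvD//; last exact: kernel_bdd_cst.
    rewrite Ev_cst// mulrDr lerD//.
    have /andP[Cx0 CxCm] := C_bound gx.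
    have e2 : 0 < eps ^+ 2 by rewrite exprn_gt0.
    apply: (@le_trans _ _ (Cm / eps ^+ 2 * (a2 * w0))).
      apply: ler_wpM2r; first by rewrite mulr_ge0// ltW.
      by apply: ler_wpM2r => //; rewrite invr_ge0 ltW.
    rewrite /w0 le_eqVlt; apply/orP; left; apply/eqP.
    by field; rewrite ?gt_eqF.
have Dx := Dle x s Xx (t1t s (lexx s) (ltW sts)).
move: Dts Dx; rewrite {2 3}/D /= => Dts Dx.
have : w1 = 3 / 4 * d * (ts - s) by [].
move: psis ule; rewrite !mulrDl; lra.
Qed.

(* Under this bound [expR (k * u)] satisfies a linear inequality. *)
Definition exp_dominated (k : R) := forall (x : RN) (s : R), good x ->
  K x s <= G0 x / k * (expR (k * s) - 1).

(** The square of [1 + X / 2 <= expR (X / 2)], whose left side is nonnegative in the stated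
    range. *)
Lemma expR_ge_quadratic (X : R) : -2 <= X -> X + X ^+ 2 / 4 <= expR X - 1.
Proof.
move=> X2; have -> : expR X = expR (X / 2) ^+ 2.
  by rewrite expr2 -expRD; congr expR; field.
have := expR_ge1Dx (X / 2) => H.
have : (1 + X / 2) ^+ 2 <= expR (X / 2) ^+ 2.
  by rewrite lerXn2r// nnegrE; [lra|exact: expR_ge0].
by nra.
Qed.

(** Three ranges of [s]. For [s < - 2 / k] monotonicity reduces to the endpoint, where [K] is
    already below [- G0 x / k]. For [|s| <= s0] the Taylor bound of [K] is compared with
    [expR_ge_quadratic]. For [s > s0] the linear bound [a2 * s] lies below the quadratic term. *)
Lemma exp_dominated_exists : exists2 k, 0 < k & exp_dominated k.
Proof.
have [s0 s00 tay] := setup_taylor S (@ltr01 R).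
have [b Hb] := setup_G1 S.
pose m1 := `|b| + 1; have m10 : 0 < m1 by rewrite ltr_wpDl.
have quad x s : good x -> `|s| <= s0 -> K x s <= G0 x * s + m1 * s ^+ 2.
  move=> gx ss; have := tay x s gx ss.
  have : G1 x * s ^+ 2 <= `|b| * s ^+ 2.
    rewrite ler_wpM2r ?sqr_ge0// (le_trans (ler_norm _))// (le_trans (Hb _ gx))//.
    exact: ler_norm.
  by rewrite ler_norml /m1 => ? /andP[]; lra.
(* One summand for each requirement: [4 m1 <= a1 k] beats the second order coefficient,
   [4 a2 <= a1 s0 k] beats linear growth beyond [s0], and [2 / k <= s0] puts the endpoint of the
   negative range where the Taylor bound holds. *)
pose k := 4 * m1 / a1 + 4 * a2 / (a1 * s0) + 2 / s0.
have p1 : 0 < 4 * m1 / a1 by rewrite divr_gt0// mulr_gt0.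
have p2 : 0 < 4 * a2 / (a1 * s0) by rewrite divr_gt0 ?mulr_gt0.
have p3 : 0 < 2 / s0 by rewrite divr_gt0.
have k0 : 0 < k by rewrite !addr_gt0.
have k1 : 4 * m1 <= a1 * k.
  by rewrite [leRHS]mulrC -ler_pdivrMr// /k; lra.
have k2 : 4 * a2 <= a1 * s0 * k.
  by rewrite [leRHS]mulrC -ler_pdivrMr ?mulr_gt0// /k; lra.
have k3 : 2 / k <= s0.
  by rewrite ler_pdivrMr// [leRHS]mulrC -ler_pdivrMr// /k; lra.
exists k => // x s gx.
have /andP[G0x _] := setup_G0 S gx.
have Gk : 0 < G0 x / k by rewrite divr_gt0//; exact: lt_le_trans G0x.
have G1k : 4 * m1 <= G0 x * k.
  by rewrite (le_trans k1)// ler_wpM2r// ltW.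
have [sk|ks] := leP (- (2 / k)) s; last first.
  have /andP[mono _] := setup_slope S gx (ltW ks).
  have Kk : K x (- (2 / k)) <= - (G0 x / k).
    have := @quad x (- (2 / k)) gx; rewrite normrN gtr0_norm ?divr_gt0// => /(_ k3).
    move/le_trans; apply.
    have -> : G0 x * - (2 / k) + m1 * (- (2 / k)) ^+ 2 =
       - (2 * (G0 x / k)) + (4 * m1) / k / k by field; rewrite gt_eqF.
    have : 4 * m1 / k / k <= G0 x / k.
      by rewrite ler_wpM2r ?invr_ge0 ?(ltW k0)// ler_pdivrMr.
    lra.
  have p4 : 0 <= a1 * (- (2 / k) - s) by apply: mulr_ge0; rewrite ?subr_ge0 ltW.
  have p5 : 0 <= G0 x / k * expR (k * s) by apply: mulr_ge0; rewrite ?expR_ge0// ltW.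
  rewrite mulrBr mulr1; move: (G0 x / k) (K x (- (2 / k))) p5 Kk mono p4 => g K2.
  move: (g * expR _) (a1 * _) => ge aa; lra.
have kX : -2 <= k * s by rewrite mulrC -ler_pdivrMr// mulNr.
have key : G0 x * s + G0 x * k / 4 * s ^+ 2 <= G0 x / k * (expR (k * s) - 1).
  have -> : G0 x * s + G0 x * k / 4 * s ^+ 2 = G0 x / k * (k * s + (k * s) ^+ 2 / 4).
    by field; rewrite gt_eqF.
  by rewrite ler_wpM2l ?(ltW Gk)//; exact: expR_ge_quadratic.
apply: (le_trans _ key).
have [ss|ss] := leP `|s| s0.
  apply: (le_trans (quad x s gx ss)); rewrite lerD2l ler_wpM2r ?sqr_ge0//.
  lra.
have s0s : s0 < s.
  move: ss; rewrite ltr_normr => /orP[//|]; lra.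
have /andP[_ up] := setup_slope S gx (ltW (lt_trans s00 s0s)).
move: up; rewrite (setup_K0 S gx) !subr0 => /le_trans; apply.
have G00 : 0 < G0 x by exact: lt_le_trans G0x.
have s1 : 0 < s by exact: lt_trans s0s.
have G0s : 0 <= G0 x * s by rewrite mulr_ge0 ?ltW.
apply: (@le_trans _ _ (G0 x * k / 4 * s ^+ 2)); last by lra.
rewrite expr2 mulrA; apply: ler_wpM2r; first exact: ltW.
have : a1 * s0 * k <= G0 x * k * s.
  have -> : a1 * s0 * k = a1 * k * s0 by ring.
  apply: ler_pM => //; [by rewrite ltW// mulr_gt0|exact: ltW| |exact: ltW].
  by rewrite ler_pM2r.
by move: k2; lra.
Qed.

Lemma le_ln_div (k a y : R) : 0 < k -> 0 < y -> (a <= ln y / k) = (expR (k * a) <= y).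
Proof.
by move=> k0 y0; rewrite ler_pdivlMr// mulrC -[in LHS]ler_expR lnK.
Qed.

(** For [ln Psi / k] with [Psi = P + Th], exponential domination bounds the nonlocal operator by
    [1 / (k Psi)] times the linear averaging of [P]; the factor [2 / (moment J * eps ^+ 2)] is
    [C x * G0 x / eps ^+ 2], and [Th] drops out of space increments. So a linear inequality between
    the average of [P] and the growth of [Th], with margin [d], suffices. *)
Lemma barrier (eps k : R) (x0 : RN) (r t1 t2 c1 d : R) (P : RN -> R) (Th : R -> R) :
  0 < eps -> 0 < k -> exp_dominated k -> 0 < r -> 0 <= t1 -> t1 <= t2 -> t2 <= T -> 0 < d ->
  continuous P -> continuous Th ->
  (forall z, J z != 0 -> `|eps *: z| <= r / 4) ->
  (forall (x : RN) (t : R), cl x -> `|x - x0| <= r -> t1 <= t <= t2 -> 0 < P x + Th t) ->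
  (forall x, cl x -> `|x - x0| <= r -> expR (k * u eps x t1) <= P x + Th t1) ->
  (forall (x : RN) (t : R), cl x -> r / 2 <= `|x - x0| <= r -> t1 < t <= t2 ->
    expR (k * u eps x t) <= P x + Th t) ->
  (forall (x z : RN) (t : R), cl x -> `|x - x0| < r / 2 -> J z != 0 -> ~ cl (x + eps *: z) ->
    t1 < t < t2 -> expR (k * u eps (x + eps *: z) t) <= P (x + eps *: z) + Th t) ->
  (forall x, cl x -> `|x - x0| < r / 2 ->
    2 / (moment J * eps ^+ 2) * Ev J (fun z => P (x + eps *: z) - P x) <= c1) ->
  (forall s t : R, t1 <= s -> s <= t -> t <= t2 -> (c1 + d) * (t - s) <= Th t - Th s) ->
  forall (x : RN) (t : R), cl x -> `|x - x0| <= r -> t1 <= t <= t2 ->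
    expR (k * u eps x t) <= P x + Th t.
Proof.
move=> eps0 k0 domk r0 t10 t12 t2T d0 cP cTh reach pos init lat ext gen time.
pose Psi (x : RN) t := P x + Th t.
pose X : set RN := cl `&` [set x | `|x - x0| <= r].
have posX x t : X x -> t1 <= t <= t2 -> 0 < Psi x t by move=> [? ?]; exact: pos.
have cPsi : continuous (uncurry Psi).
  rewrite (_ : uncurry Psi = fun p : RN * R => P p.1 + Th p.2); last first.
    by apply/funext => -[].
  exact: continuous_separated.
have cX : compact X.
  apply: compact_closedI; first exact: compact_closure_bounded (setup_bounded S).
  exact: closed_dist_le.
pose psi x t := ln (Psi x t) / k.
have cmp : forall x t, X x -> t1 <= t <= t2 -> u eps x t <= psi x t.
  apply: (comparison eps0 cX) => //.
  - by move=> x [].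
  - rewrite (_ : uncurry psi = (fun y => ln y / k) \o uncurry Psi); last first.
      by apply/funext => -[].
    apply: within_continuous_comp.
      move=> y; rewrite inE => -[[x t] [/= Xx]]; rewrite in_itv /= => tt <-.
      by apply: cvgM; [exact: continuous_ln (posX _ _ Xx tt)|exact: cvg_cst].
    exact: continuous_subspaceT.
  - move=> x Xx; have [clx xr] := Xx.
    by rewrite le_ln_div ?posX ?lexx//; exact: init.
  move=> xs ts Xxs /andP[t1ts tst2]; have [clxs xsr] := Xxs.
  have ts12 : t1 <= ts <= t2 by rewrite ltW.
  have Ps0 : 0 < Psi xs ts by exact: posX.
  rewrite ltNge le_ln_div// => /negP nle.
  (* By [lat] a contact lies in the inner half of the ball, from where the kernel, of reach at most
     [r / 4], stays within radius [r]. *)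
  have xsr2 : `|xs - x0| < r / 2.
    rewrite ltNge; apply/negP => rxs; apply: nle; apply: lat => //; first by rewrite rxs.
    by rewrite t1ts.
  pose A := Psi xs ts.
  (* The rates [c1 / (k Psi)] and [(c1 + d) / (k Psi)] vary with the point. Replacing [Psi] by its
     value [A] at the contact, from which it differs by at most [w], costs a third of [d] in each;
     the last third is the margin of the local supersolution. *)
  pose w := d / 3 * A / (`|c1| + d + 1).
  have cd0 : 0 < `|c1| + d + 1 by have := normr_ge0 c1; lra.
  have w0 : 0 < w.
    by apply: divr_gt0 => //; apply: mulr_gt0 => //; lra.
  have wE : (`|c1| + d) * w <= d / 3 * A.
    rewrite /w mulrA ler_pdivrMr// [leLHS]mulrC ler_wpM2l ?lerDl//.
    by apply: mulr_ge0; [lra|exact: ltW].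
  have [r1 r10 Hr1] : exists2 r1, 0 < r1 & forall x t, `|x - xs| < r1 ->
      `|t - ts| < r1 -> `|Psi x t - A| <= w.
    have /cvgrPdist_le/(_ _ w0)/nbhs_normP[r1 /= r10 Hr1] := cPsi (xs, ts).
    exists r1 => // x t xr tr; rewrite distrC; apply: (Hr1 (x, t)).
    have : `|(xs, ts) - (x, t)| < r1 by rewrite prod_norm_lt /= distrC xr distrC.
    by [].
  exists ((c1 + d / 3) / (k * A)), (d / 3 / (k * A)).
  exists (Num.min r1 (r / 2 - `|xs - x0|)).
  have kA : 0 < k * A by exact: mulr_gt0.
  split; first by rewrite divr_gt0// divr_gt0.
    by rewrite lt_min r10 subr_gt0.
  move=> x gx; rewrite lt_min => /andP[xr1 xr].
  have clx : cl x by exact: (good_closure gx).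
  have xr2 : `|x - x0| < r / 2.
    have -> : x - x0 = (x - xs) + (xs - x0) by rewrite addrA subrK.
    by rewrite (le_lt_trans (ler_normD _ _))//; lra.
  have Xx : X x by split => //=; lra.
  split => // s t1s; rewrite ltrBlDr => tsr sts.
  have tsr1 : `|s - ts| < r1.
    have : ts < s + r1.
      by apply: (lt_le_trans tsr); rewrite lerD2l ge_min lexx.
    by move=> tsr1; rewrite ltr_norml; apply/andP; split; move: sts tsr1 r10; slra.
  have s12 : t1 <= s <= t2 by rewrite ltW//= (le_trans _ tst2)// ltW.
  have Pxs0 : 0 < Psi x s by exact: posX.
  have Pxt0 : 0 < Psi x ts by exact: posX.
  have hc (c : R) : `|c| <= `|c1| + d -> forall y, `|y - A| <= w ->
      `|c * (y - A)| <= d / 3 * A.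
    move=> cc y yA; rewrite normrM (le_trans _ wE)//.
    exact: ler_pM.
  have cb (e : R) : 0 <= e <= d -> `|c1 + e| <= `|c1| + d.
    by move=> /andP[e0 ed]; rewrite (le_trans (ler_normD _ _))// lerD2l ger0_norm.
  have hs : c1 / (k * Psi x s) <= (c1 + d / 3) / (k * A).
    rewrite ler_pdivrMr ?mulr_gt0// mulrAC ler_pdivlMr//.
    have := hc (c1 + d / 3) _ (Psi x s) (Hr1 _ _ xr1 tsr1).
    have /cb h3 : 0 <= d / 3 <= d by apply/andP; split; move: d0; slra.
    move=> /(_ h3); rewrite ler_norml => /andP[h1 h2].
    have : 0 <= k * ((c1 + d / 3) * Psi x s - c1 * A).
      by rewrite mulr_ge0 ?(ltW k0)//; move: h1; slra.
    slra.
  have ht : (c1 + 2 * (d / 3)) / (k * A) <= (c1 + d) / (k * Psi x ts).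
    rewrite ler_pdivrMr ?mulr_gt0// mulrAC ler_pdivlMr ?mulr_gt0//.
    have := hc (c1 + 2 * (d / 3)) _ (Psi x ts) (Hr1 _ _ xr1 _).
    have /cb h3 : 0 <= 2 * (d / 3) <= d by apply/andP; split; move: d0; slra.
    rewrite subrr normr0 => /(_ h3 r10); rewrite ler_norml => /andP[h1 h2].
    have : 0 <= k * ((c1 + d) * A - (c1 + 2 * (d / 3)) * Psi x ts).
      by rewrite mulr_ge0 ?(ltW k0)//; move: h2; slra.
    slra.
  split.
    have -> : (c1 + d / 3) / (k * A) + d / 3 / (k * A) = (c1 + 2 * (d / 3)) / (k * A).
      by rewrite -mulrDl; congr (_ / _); ring.
    apply: (@le_trans _ _ ((c1 + d) / (k * Psi x ts) * (ts - s))).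
      by apply: ler_wpM2r => //; rewrite subr_ge0 ltW.
    (* The intermediate term comes from [ln q <= q - 1] at [q = Psi x s / Psi x ts], which bounds
       the increment of [ln Psi] from below. *)
    apply: (@le_trans _ _ ((1 - Psi x s / Psi x ts) / k)).
      have -> : (c1 + d) / (k * Psi x ts) * (ts - s) =
          ((c1 + d) * (ts - s) / Psi x ts) / k by field; rewrite !gt_eqF.
      rewrite ler_pM2r ?invr_gt0// ler_pdivrMr// mulrBl mul1r divfK ?gt_eqF//.
      have := time s ts (ltW t1s) (ltW sts) tst2; rewrite /Psi; slra.
    rewrite /psi -mulrBl ler_pM2r ?invr_gt0//.
    have q0 : 0 < Psi x s / Psi x ts by rewrite divr_gt0.
    have : ln (Psi x s / Psi x ts) <= Psi x s / Psi x ts - 1.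
      have := @le_ln1Dx _ (Psi x s / Psi x ts - 1).
      by rewrite addrCA subrr addr0; apply; move: q0; slra.
    rewrite ln_div ?posrE//; slra.
  exists (fun z => G0 x / (k * Psi x s) * (P (x + eps *: z) - P x)).
  have bP : kernel_bdd J (fun z => P (x + eps *: z) - P x).
    exact/(continuous_kernel_bdd hJ)/continuous_increment.
  split.
  - exact: (kernel_bddZ hJ).
  - move=> z Jz; set y := x + eps *: z.
    have yr : `|y - x0| <= r.
      have -> : y - x0 = (x - x0) + eps *: z by rewrite /y addrAC.
      rewrite (le_trans (ler_normD _ _))//.
      by have := reach _ Jz; move: xr2 r0; slra.
    have Py : 0 < Psi y s /\ (X y \/ ~ cl y /\ u eps y s <= psi y s).
      have [cly|ncly] := pselect (cl y).
        by split; [apply: posX => //; split|left; split].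
      have e1 : expR (k * u eps y s) <= Psi y s.
        by apply: ext => //; rewrite t1s (lt_le_trans sts).
      have Py0 : 0 < Psi y s by rewrite (lt_le_trans _ e1)// expR_gt0.
      by split => //; right; split => //; rewrite le_ln_div.
    case: Py => Py0 Py; split => //.
    (* [expR] of [k] times an increment of [psi] is a quotient of two values of [Psi], so the bound
       becomes linear in [Psi]. *)
    apply: (le_trans (domk _ _ gx)).
    have -> : k * (psi y s - psi x s) = ln (Psi y s / Psi x s).
      rewrite ln_div ?posrE// /psi -mulrBl mulrC divfK//.
      by rewrite gt_eqF.
    rewrite lnK ?posrE ?divr_gt0// le_eqVlt; apply/orP; left; apply/eqP.
    have -> : P y - P x = Psi y s - Psi x s by rewrite /Psi; ring.
    by field; rewrite !gt_eqF.
  rewrite (EvZ hJ)//.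
  apply: (le_trans _ hs).
  have := gen x clx xr2; set E := Ev J _ => gE.
  have CG := setup_C S gx.
  have -> : C x / eps ^+ 2 * (G0 x / (k * Psi x s) * E) =
      2 / (moment J * eps ^+ 2) * E / (k * Psi x s).
    have -> : C x / eps ^+ 2 * (G0 x / (k * Psi x s) * E) =
      (C x * G0 x) / eps ^+ 2 * E / (k * Psi x s) by field; rewrite !gt_eqF.
    by rewrite CG; field; rewrite !gt_eqF.
  by rewrite ler_pM2r// invr_gt0 mulr_gt0.
move=> x t clx xr tt; have Xx : X x by split.
by rewrite -le_ln_div ?posX//; exact: cmp.
Qed.

Lemma limit_bounded : exists M : R, forall (x : RN) (t : R), cl x -> 0 <= t <= T -> `|v x t| <= M.
Proof. exact: bounded_cylinder (setup_bounded S) (setup_vcont S). Qed.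

(** [M + t] is a strict supersolution: it has no space increments and slope 1 in time, while [M]
    exceeds the initial values and the exterior values. *)
Lemma uniform_bound : exists e1 M : R, 0 < e1 /\ forall (eps : R) (x : RN) (t : R), 0 < eps < e1 ->
  cl x -> 0 <= t <= T -> u eps x t <= M.
Proof.
have [e1 [M1 [e10 H1]]] := setup_ext S; have [M2 H2] := limit_bounded.
pose M := `|M1| + `|M2|; exists e1, (M + T); split => // eps x t epsP clx tT.
have /andP[eps0 _] := epsP.
apply: (@le_trans _ _ (M + t)); last by case/andP: tT => *; rewrite lerD2l.
apply: (comparison eps0 (X := cl) (t1 := 0) (t2 := T)
  (psi := fun _ t => M + t)) => //.
- exact: compact_closure_bounded (setup_bounded S).
- apply: continuous_subspaceT.
  rewrite (_ : uncurry _ = fun p : RN * R => (fun=> M) p.1 + id p.2); last first.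
    by apply/funext => -[].
  have cM : continuous (fun _ : RN => M) by move=> y; exact: cst_continuous.
  have ci : continuous (id : R -> R) by move=> y; exact: cvg_id.
  exact: (@continuous_separated _ _ (fun=> M) id cM ci).
- move=> y cly; rewrite (setup_init S eps0 cly) addr0.
  have := H2 y 0 cly; rewrite lexx ltW// => /(_ isT).
  have := ler_norm (v y 0); have := ler_norm M2; have := normr_ge0 M1.
  by rewrite /M; lra.
move=> xs ts clxs /andP[ts0 tsT] _; exists 0, 1, 1; split => // y gy _.
split; first exact: (good_closure gy).
move=> s s0 _ sts; split; first by lra.
exists (fun=> 0); split; first exact: kernel_bdd_cst.
  move=> z Jz; split; last by rewrite subrr (setup_K0 S gy).
  have [?|ncl] := pselect (cl (y + eps *: z)); [by left|right; split => //].
  have := H1 eps y z s epsP (good_closure gy) Jz ncl.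
  rewrite s0 (lt_le_trans sts tsT) => /(_ isT).
  have := ler_norm (u eps (y + eps *: z) s); have := ler_norm M1.
  by have := normr_ge0 M2; rewrite /M; lra.
by rewrite Ev_cst// mulr0.
Qed.

Lemma Ev_sq_increment (eps : R) (y : RN) :
  Ev J (fun z => sq (y + eps *: z) - sq y) = eps ^+ 2 * (N * moment J).
Proof.
have -> : (fun z => sq (y + eps *: z) - sq y) =
    (fun z => (2 * eps) * dot y z + eps ^+ 2 * sq z).
  by apply/funext => z; rewrite sqD dotZr sqZ; ring.
have k1 := kernel_bdd_dot hJ y; have k2 := kernel_bdd_sq hJ.
rewrite (EvD hJ (kernel_bddZ hJ (2 * eps) k1) (kernel_bddZ hJ (eps ^+ 2) k2)).
by rewrite (EvZ hJ _ k1) (EvZ hJ _ k2) Ev_dot// Ev_sq// mulr0 add0r.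
Qed.

(** Here [Psi] is [expR (k * c) + A |x - x0|^2 + B (t - t1)]. The radius [rho] depends on [M], [r]
    and [w] but not on [x0], [t1] or [c], so the barrier can be started both at time 0 and shortly
    before [T]. *)
Lemma forward_barrier (M r w : R) : 0 < r -> 0 < w ->
  exists2 rho : R, 0 < rho & forall (eps : R) (x0 : RN) (t1 t2 c : R),
    0 < eps < rho -> 0 <= t1 -> t1 <= t2 -> t2 <= T -> t2 - t1 <= rho ->
    `|c| <= M ->
    (forall (x : RN) (t : R), cl x -> 0 <= t <= T -> u eps x t <= M) ->
    (forall x, cl x -> `|x - x0| <= r -> u eps x t1 <= c) ->
    (forall (x z : RN) (t : R), cl x -> J z != 0 -> ~ cl (x + eps *: z) ->
      t1 < t < t2 -> `|x + eps *: z - x0| <= r -> u eps (x + eps *: z) t <= c) ->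
    forall (x : RN) (t : R), cl x -> `|x - x0| <= rho -> t1 <= t <= t2 ->
      u eps x t <= c + w.
Proof.
move=> r0 w0; have [k k0 domk] := exp_dominated_exists.
have [rJ rJ0 HJ] := kernel_support hJ.
(* [A (r / 2)^2 = expR (k * M)], so the paraboloid alone exceeds [expR (k * u)] on the outer half of
   the ball. [B] exceeds by 1 the value [2 A N] of the averaging operator on the paraboloid. *)
pose A := expR (k * M) * 4 / r ^+ 2.
have A0 : 0 < A by rewrite divr_gt0 ?mulr_gt0 ?expR_gt0 ?exprn_gt0.
pose B := 2 * A * N + 1.
have AN0 : 0 < A * N by exact: mulr_gt0.
have B0 : 0 < B by rewrite /B; lra.
(* A lower bound, valid for all [|c| <= M], for the gain of [expR (k * (c + w))] over
   [expR (k * c)]. The paraboloid and the time term get half of it each. *)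
pose q := expR (- (k * M)) * (k * w).
have q0 : 0 < q by apply: mulr_gt0; [exact: expR_gt0|exact: mulr_gt0].
have p1 : 0 < 2 * A * N by rewrite -mulrA mulr_gt0.
have [|rho rho0 /= /and5P[h1' /ltW h2 /ltW h3 /ltW h4 /andP[/ltW h5 _]]] := @exists_lt_all R
    [:: r / (4 * rJ); r; 1; q / (2 * A * N); q / (2 * B)].
  by rewrite /= r0 ltr01 !divr_gt0// mulr_gt0.
exists rho => // eps x0 t1 t2 c /andP[eps0 epsr] t10 t12 t2T t21 cM uM init ext.
move=> x t clx xr tt.
have h1 : eps * (4 * rJ) < r.
  by rewrite -ltr_pdivlMr ?mulr_gt0//; exact: lt_trans h1'.
rewrite ler_pdivlMr// in h4; rewrite ler_pdivlMr ?mulr_gt0// in h5.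
have reach z : J z != 0 -> `|eps *: z| <= r / 4.
  move=> /HJ zr; rewrite normrZ gtr0_norm//.
  have : eps * `|z| <= eps * rJ by rewrite ler_wpM2l// ltW.
  lra.
pose a := expR (k * c).
have Asq0 y : 0 <= A * sq (y - x0) by apply: mulr_ge0; [exact: ltW|exact: sq_ge0].
have Bt0 s : t1 <= s -> 0 <= B * (s - t1).
  by move=> t1s; apply: mulr_ge0; [exact: ltW|rewrite subr_ge0].
have ua y s : u eps y s <= c -> expR (k * u eps y s) <= a.
  by move=> uc; rewrite ler_expR ler_pM2l.
have bar : expR (k * u eps x t) <= (a + A * sq (x - x0)) + B * (t - t1).
  apply: (barrier (P := fun x => a + A * sq (x - x0)) (Th := fun t => B * (t - t1))
    (c1 := 2 * A * N) (d := 1) eps0 k0 domk r0 t10 t12 t2T) => //.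
  - move=> y; apply: continuous_affine_cst; exact: continuous_sq.
  - by move=> y; apply: cvgM; [exact: cvg_cst|apply: cvgB; [exact: cvg_id|exact: cvg_cst]].
  - move=> y s _ _ /andP[t1s _].
    by rewrite -addrA ltr_wpDr ?expR_gt0// addr_ge0 ?Bt0.
  - move=> y cly yr; rewrite subrr mulr0 addr0.
    by rewrite (le_trans (ua _ _ (init _ cly yr)))// lerDl.
  - move=> y s cly /andP[ry _] /andP[t1s st2].
    have us : u eps y s <= M.
      by apply: uM => //; rewrite (le_trans t10 (ltW t1s)) (le_trans st2).
    apply: (@le_trans _ _ (expR (k * M))); first by rewrite ler_expR ler_pM2l.
    have : (r / 2) ^+ 2 <= `|y - x0| ^+ 2.
      by rewrite !expr2; apply: ler_pM => //; move: ry r0; slra.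
    have := sqr_norm_le_sq (y - x0) => s1 s2.
    have : A * (r / 2) ^+ 2 <= A * sq (y - x0).
      by rewrite ler_wpM2l ?(ltW A0)// (le_trans s2).
    have -> : A * (r / 2) ^+ 2 = expR (k * M) by rewrite /A; field; rewrite gt_eqF.
    have := Bt0 s (ltW t1s); have : 0 < a := expR_gt0 _; lra.
  - move=> y z s cly yr Jz ncl /andP[t1s st2].
    have yz : `|y + eps *: z - x0| <= r.
      have -> : y + eps *: z - x0 = (y - x0) + eps *: z by rewrite addrAC.
      rewrite (le_trans (ler_normD _ _))//; have := reach _ Jz; lra.
    have := ua _ _ (ext y z s cly Jz ncl (introT andP (conj t1s st2)) yz).
    by have := Asq0 (y + eps *: z); have := Bt0 s (ltW t1s); lra.
  - move=> y cly yr.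
    have -> : (fun z => a + A * sq (y + eps *: z - x0) - (a + A * sq (y - x0))) =
        (fun z => A * (sq ((y - x0) + eps *: z) - sq (y - x0))).
      by apply/funext => z; rewrite [y + _ - _]addrAC; ring.
    rewrite (EvZ hJ); last first.
      apply: (continuous_kernel_bdd hJ).
      apply: (continuous_increment (P := @sq R n)) => z.
      by have := @continuous_sq R n 0 z; rewrite (_ : (fun x => _) = @sq R n)//;
        apply/funext => x'; rewrite subr0.
    rewrite Ev_sq_increment le_eqVlt; apply/orP; left; apply/eqP.
    by field; rewrite !gt_eqF.
  - by move=> s s' _ ss' _; rewrite -mulrBr /B; lra.
  - exact: (le_trans xr).
rewrite -(ler_pM2l k0) -ler_expR; apply: (le_trans bar).
have e1 : expR (k * (c + w)) >= a + q.
  rewrite mulrDr expRD -/a; have := expR_ge1Dx (k * w) => e1.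
  have : a * (1 + k * w) <= a * expR (k * w) by rewrite ler_wpM2l ?expR_ge0.
  have : q <= a * (k * w).
    rewrite ler_wpM2r ?(ltW (mulr_gt0 k0 w0))// ler_expR -mulrN ler_pM2l//.
    by move: cM; rewrite ler_norml => /andP[].
  lra.
apply: le_trans e1; rewrite -addrA lerD2l.
have : A * sq (x - x0) <= A * (N * rho).
  rewrite ler_wpM2l ?(ltW A0)// (le_trans (sq_le_norm _))// ler_wpM2l ?(ltW N0)//.
  rewrite expr2 -[leRHS]mulr1; apply: ler_pM => //.
  exact: le_trans xr h3.
have : B * (t - t1) <= B * rho.
  by case/andP: tt => _ tt2; rewrite ler_wpM2l ?(ltW B0)//; lra.
lra.
Qed.

(** For [M > 0] and [l] nonzero it is negative exactly in an open Euclidean ball with 0 on its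
    sphere: the exterior ball that touches the domain. *)
Definition paraboloid (l : RN) (M : R) (y : RN) : R := dot l y + M * sq y.

Lemma paraboloidD l M y h : paraboloid l M (y + h) =
  paraboloid l M y + dot (l + (2 * M) *: y) h + M * sq h.
Proof. by rewrite /paraboloid dotDr sqD dotDl dotZl; ring. Qed.

(** The expansion in [eps] is a polynomial. Its odd terms average to 0, its second order terms give
    the right-hand side with [|grad p|^2] in place of [lam], and the quartic term is nonpositive, so
    the bound holds for every [eps]. The negative term [- 2 B lam] is the purpose of [- B p^2]. *)
Lemma Ev_paraboloid_le l M (A B lam : R) (eps : R) y : 0 <= M -> 0 <= B -> 0 < eps ->
  0 <= paraboloid l M y -> lam <= sq (l + (2 * M) *: y) ->
  2 / (moment J * eps ^+ 2) *
    Ev J (fun z => (A * paraboloid l M (y + eps *: z) - B * paraboloid l M (y + eps *: z) ^+ 2)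
                 - (A * paraboloid l M y - B * paraboloid l M y ^+ 2))
  <= 2 * (A - 2 * B * paraboloid l M y) * M * N - 2 * B * lam.
Proof.
move=> M0 B0 eps0 p0 lamle; set q := paraboloid l M y; pose g := l + (2 * M) *: y.
have kg : kernel_bdd J (dot g) by exact: kernel_bdd_dot.
have ks : kernel_bdd J sq by exact: kernel_bdd_sq.
have kgg : kernel_bdd J (fun z => dot g z ^+ 2).
  rewrite (_ : (fun z => _) = dot g \* dot g); first exact: kernel_bddM.
  by apply/funext => z; rewrite expr2.
have kgs := kernel_bddM kg ks; have kss := kernel_bddM ks ks.
pose c := A - 2 * B * q.
have E : (fun z => (A * paraboloid l M (y + eps *: z) - B * paraboloid l M (y + eps *: z) ^+ 2)
    - (A * q - B * q ^+ 2)) = (fun z => c * eps * dot g z + (c * eps ^+ 2 * M * sq z +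
      (- B * eps ^+ 2 * dot g z ^+ 2 + (- 2 * B * eps ^+ 3 * M * (dot g z * sq z) +
       - B * eps ^+ 4 * M ^+ 2 * (sq z * sq z))))).
  by apply/funext => z; rewrite paraboloidD -/q -/g dotZr sqZ /c; ring.
have k1 := kernel_bddZ hJ (c * eps) kg.
have k2 := kernel_bddZ hJ (c * eps ^+ 2 * M) ks.
have k3 := kernel_bddZ hJ (- B * eps ^+ 2) kgg.
have k4 := kernel_bddZ hJ (- 2 * B * eps ^+ 3 * M) kgs.
have k5 := kernel_bddZ hJ (- B * eps ^+ 4 * M ^+ 2) kss.
have k45 := kernel_bddD k4 k5; have k345 := kernel_bddD k3 k45.
rewrite E (EvD hJ k1 (kernel_bddD k2 k345)) (EvD hJ k2 k345) (EvD hJ k3 k45) (EvD hJ k4 k5).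
rewrite (EvZ hJ _ kg) (EvZ hJ _ ks) (EvZ hJ _ kgg) (EvZ hJ _ kgs) (EvZ hJ _ kss).
rewrite Ev_dot// Ev_sq// Ev_dot_sqr// Ev_dotM_sq// !mulr0 !add0r.
have kss0 : 0 <= B * eps ^+ 4 * M ^+ 2 * Ev J (fun z => sq z * sq z).
  rewrite !mulr_ge0 ?exprn_ge0 ?(ltW eps0)// -(Ev_cst hJ 0).
  by apply: (Ev_le hJ (kernel_bdd_cst hJ 0) kss) => z _; rewrite mulr_ge0 ?sq_ge0.
apply: (@le_trans _ _ (2 / (moment J * eps ^+ 2) *
   (c * eps ^+ 2 * M * (N * moment J) + (- B * eps ^+ 2 * (sq g * moment J))))).
  apply: ler_wpM2l; first by rewrite divr_ge0 ?mulr_ge0 ?exprn_ge0 ?ltW.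
  by move: kss0; slra.
have -> : 2 / (moment J * eps ^+ 2) *
   (c * eps ^+ 2 * M * (N * moment J) + (- B * eps ^+ 2 * (sq g * moment J))) =
   2 * c * M * N - 2 * B * sq g by field; rewrite !gt_eqF.
by rewrite /c lerD2l lerN2 ler_wpM2l// mulr_ge0.
Qed.

Lemma paraboloid_norm_le l M y : 0 <= M -> `|y| <= 1 ->
  `|paraboloid l M y| <= N * (`|l| + M) * `|y|.
Proof.
move=> M0 y1; rewrite (le_trans (ler_normD _ _))// mulrDr mulrDl lerD ?norm_dot_le//.
rewrite normrM !ger0_norm ?sq_ge0// [N * M]mulrC -mulrA ler_wpM2l//.
rewrite (le_trans (sq_le_norm _))// ler_wpM2l ?(ltW N0)//.
by rewrite expr2 -[leRHS]mulr1 ler_wpM2l.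
Qed.

(** At the starting time before [t0] only the uniform bound is known about [u], so the time parabola
    must be large there and decrease until [t0]. The concave term [- B p^2] compensates for this
    decrease by making the averaging operator sufficiently negative. *)
Lemma boundary_barrier (x0 : RN) (t0 w : R) : cl x0 -> ~ Om x0 -> 0 < t0 <= T ->
  0 < w -> exists2 rho : R, 0 < rho & forall (eps : R) (x : RN) (t : R),
    0 < eps < rho -> cl x -> 0 <= t <= T -> `|x - x0| < rho -> `|t - t0| < rho ->
    u eps x t <= v x0 t0 + w.
Proof.
move=> clx0 nOx0 /andP[t00 t0T] w0; have [k k0 domk] := exp_dominated_exists.
have [rJ rJ0 HJ] := kernel_support hJ.
have [e1 [Mu [e10 HMu]]] := uniform_bound.
have w2 : 0 < w / 2 by rewrite divr_gt0.
have t0P : 0 <= t0 <= T by rewrite ltW.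
have [r1 r10 Hbd] := setup_bdry S clx0 nOx0 t0P w2.
have [l [M' [rs [l0 M'0 rs0 Hs]]]] := setup_sphere S clx0 nOx0.
move: (v x0 t0) Hbd => c Hbd {t0P w2}.
have [a [a' [q [a0 a'a q0 [a'E qE]]]]] : exists a a' q : R, [/\ 0 < a, a' < a, 0 < q &
    a' = expR (k * (c + w / 2)) /\ expR (k * (c + w)) = a + q].
  (* [a'] bounds the exterior data. The gap [a - a'] absorbs slightly negative values of [p] at
     exterior points, and [q] is the room left for the conclusion. *)
  pose a := expR (k * (c + 3 / 4 * w)).
  exists a, (expR (k * (c + w / 2))), (expR (k * (c + w)) - a).
  split; [exact: expR_gt0| | |by split => //; rewrite addrCA subrr addr0].
    by rewrite ltr_expR ltr_pM2l//; move: w0; slra.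
  by rewrite subr_gt0 ltr_expR ltr_pM2l//; move: w0; slra.
(* The extra 1 improves the sphere condition to [|x - x0|^2 <= p (x - x0)] on the closure, hence
   strict positivity away from [x0]. *)
pose M := M' + 1; have M0 : 0 < M by rewrite /M ltr_wpDl.
have {}Hs x : cl x -> `|x - x0| < rs ->
    sq (x - x0) <= paraboloid l M (x - x0).
  move=> clx xr; have := Hs x clx xr; rewrite /paraboloid /M mulrDl.
  by slra.
clearbody M; clear M'0 M'; pose p y := paraboloid l M y.
have sql0 : 0 < sq l by rewrite (lt_le_trans _ (sqr_norm_le_sq l))// exprn_gt0// normr_gt0.
have [lam lamE lam0] : exists2 lam : R, lam = sq l / 4 & 0 < lam.
  by exists (sq l / 4) => //; rewrite divr_gt0.
have [L LE L0] : exists2 L : R, L = N * (`|l| + 2 * M) & 0 < L.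
  by exists (N * (`|l| + 2 * M)) => //; rewrite mulr_gt0// ltr_wpDl// mulr_gt0.
have MN0 : 0 < M * N + 1 by rewrite ltr_wpDl// mulr_ge0// ltW.
have [pm pmE pm0] : exists2 pm : R, pm = lam / (2 * (M * N + 1)) & 0 < pm.
  by exists (lam / (2 * (M * N + 1))) => //; rewrite divr_gt0// mulr_gt0.
(* With [r * g0 <= sq l], the squared length of the gradient [l + 2 M y] of [p] stays above
   [lam = sq l / 4] for [|y| <= r]. *)
have [g0 g0E g00] : exists2 g : R, g = 16 * M ^+ 2 * N + sq l & 0 < g.
  exists (16 * M ^+ 2 * N + sq l) => //.
  by rewrite ltr_wpDl// !mulr_ge0// ?exprn_ge0// ltW.
have [|r r0 /= /and5P[rrs rr1 /ltW r1' rpm' /and3P[rL' rg' _]]] :=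
    @exists_lt_all R [:: rs; r1; 1; pm / L; L^-1; sq l / g0].
  by rewrite /= rs0 r10 ltr01 !divr_gt0// invr_gt0 L0.
have rpm : L * r <= pm by rewrite mulrC -ler_pdivlMr// ltW.
have rL : L * r <= 1 by rewrite mulrC -ler_pdivlMr// mul1r ltW.
have rg : r * g0 <= sq l by rewrite -ler_pdivlMr// ltW.
have psq x : cl x -> `|x - x0| <= r -> sq (x - x0) <= p (x - x0).
  by move=> clx xr; exact: Hs x clx (le_lt_trans xr rrs).
have p_le y : `|y| <= r -> `|p y| <= L * `|y|.
  move=> yr; apply: (le_trans (paraboloid_norm_le l (ltW M0) (le_trans yr r1'))).
  rewrite ler_wpM2r// LE ler_wpM2l ?(ltW N0)// lerD2l.
  by move: M0; slra.
have p_pm y : `|y| <= r -> `|p y| <= pm /\ `|p y| <= 1.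
  move=> yr; have ply := p_le y yr.
  have Lr : L * `|y| <= L * r by rewrite ler_wpM2l// ltW.
  by split; apply: (le_trans ply); exact: (le_trans Lr).
have glam y : `|y| <= r -> lam <= sq (l + (2 * M) *: y).
  move=> yr; set b := (2 * M) *: y.
  have h1 : sq l / 2 - sq b <= sq (l + b).
    by have := sq_ge0 (l + 2 *: b); rewrite !sqD !dotZr !sqZ; slra.
  have h2 : sq b <= 4 * M ^+ 2 * N * r.
    rewrite /b sqZ.
    have -> : 4 * M ^+ 2 * N * r = (2 * M) ^+ 2 * (N * r) by ring.
    rewrite ler_wpM2l ?sqr_ge0// (le_trans (sq_le_norm _))// ler_wpM2l ?(ltW N0)//.
    rewrite expr2 -[leRHS]mulr1; apply: ler_pM => //.
    exact: le_trans yr r1'.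
  have : 0 <= r * sq l by rewrite mulr_ge0// ltW.
  by move: rg h1 h2; rewrite g0E lamE; slra.
have [|tau tau0 /= /and3P[taut0 taur1 _]] := @exists_lt_all R [:: t0; r1].
  by rewrite /= t00 r10.
have [t1 t1E] : exists t1, t1 = t0 - tau by exists (t0 - tau).
have [t2 [t2T t2t t0t2 t2E]] : exists t2, [/\ t2 <= T, t2 <= t0 + tau, t0 <= t2 &
    forall t, t <= T -> t <= t0 + tau -> t <= t2].
  exists (Num.min T (t0 + tau)); split.
  - by rewrite ge_min lexx.
  - by rewrite ge_min lexx orbT.
  - by rewrite le_min t0T lerDl ltW.
  - by move=> t tT tt; rewrite le_min tT.
have t10 : 0 <= t1 by rewrite t1E subr_ge0 ltW.
have t12 : t1 <= t2 by rewrite (le_trans _ t0t2)// t1E gerBl ltW.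
have [E EE E0] : exists2 E : R, E = expR (k * Mu) & 0 < E.
  by exists (expR (k * Mu)) => //; exact: expR_gt0.
(* The time parabola equals [E] at [t1 = t0 - tau], where [E] bounds [expR (k * u)]. [La] exceeds by
   1 the largest speed [2 D tau] of its decrease. *)
have [D DE D0] : exists2 D : R, D * tau ^+ 2 = E & 0 < D.
  exists (E / tau ^+ 2); first by rewrite divfK// expf_neq0// gt_eqF.
  by rewrite divr_gt0// exprn_gt0.
have [La LaE La0] : exists2 La : R, La = 2 * D * tau + 1 & 0 < La.
  exists (2 * D * tau + 1) => //; apply: addr_gt0 => //.
  by apply: mulr_gt0 => //; exact: mulr_gt0.
(* On the outer half of the ball [p >= (r / 2)^2], so the first bound gives [A p / 2 >= E] there;
   the second enters the choice of [B]. *)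
have [A [AE LaA A0]] : exists A, [/\ 8 * E / r ^+ 2 <= A, La <= A & 0 < A].
  have A1 : 0 < 8 * E / r ^+ 2.
    by apply: divr_gt0; [exact: mulr_gt0|exact: exprn_gt0].
  exists (La + 8 * E / r ^+ 2); split; first by rewrite lerDr ltW.
    by rewrite lerDl ltW.
  exact: addr_gt0.
(* The equation makes the averaging operator at most [- 2 La]. The last bound, which uses [La <= A],
   gives [A p - B p^2 >= A p / 2] as long as [0 <= p <= pm]. *)
have [B [BE B0 Bpm]] : exists B, [/\ B * lam = A * M * N + La, 0 < B & B * pm <= A / 2].
  have AMN0 : 0 < A * M * N by apply: mulr_gt0 => //; exact: mulr_gt0.
  exists ((A * M * N + La) / lam); split.
  - by rewrite divfK// gt_eqF.
  - by apply: divr_gt0 => //; exact: addr_gt0.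
  - have -> : (A * M * N + La) / lam * pm = (A * M * N + La) / (2 * (M * N + 1)).
      rewrite pmE; move: MN0; set X := M * N + 1 => X0.
      by field; rewrite !gt_eqF.
    rewrite ler_pdivrMr ?mulr_gt0//.
    by move: LaA; slra.
pose P x := a + (A * p (x - x0) - B * p (x - x0) ^+ 2).
pose Th t := D * (t - t0) ^+ 2.
have Phalf y : `|y| <= r -> 0 <= p y -> A * p y / 2 <= A * p y - B * p y ^+ 2.
  move=> yr py; have [ppm _] := p_pm y yr; rewrite ger0_norm// in ppm.
  have h1 : B * p y * p y <= B * pm * p y.
    by rewrite ler_wpM2r// ler_wpM2l// ltW.
  have h2 : B * pm * p y <= A / 2 * p y by rewrite ler_wpM2r.
  by rewrite expr2; move: h1 h2; slra.
have Th0 s : 0 <= Th s by rewrite mulr_ge0 ?sqr_ge0 ?ltW.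
have cp0 x : cl x -> `|x - x0| <= r -> 0 <= p (x - x0).
  by move=> clx xr; rewrite (le_trans (sq_ge0 _) (psq x clx xr)).
have cAp x : cl x -> `|x - x0| <= r -> 0 <= A * p (x - x0).
  by move=> clx xr; rewrite mulr_ge0 ?cp0// ltW.
have cP x : cl x -> `|x - x0| <= r -> a + A * p (x - x0) / 2 <= P x.
  by move=> clx xr; rewrite lerD2l; apply: Phalf => //; exact: cp0.
clear Bpm MN0 rg g00 g0E rpm' rpm rL' rL rg' rrs pm0 sql0 rs0 Hs.
have ABLr : 0 < (A + B) * L * rJ + 1.
  by apply: addr_gt0 => //; rewrite !mulr_gt0// addr_gt0.
have AL0 : 0 < 2 * A * L by apply: mulr_gt0 => //; exact: mulr_gt0.
have Dt0 : 0 < 2 * D * tau by apply: mulr_gt0 => //; exact: mulr_gt0.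
have [|rho rho0 /= /and5P[rho_e1 rho_r1 rho_r rho_a /and5P[rho_r' rho_tau rho_A rho_D _]]] :=
    @exists_lt_all R [:: e1; r1; r / (4 * rJ); (a - a') / ((A + B) * L * rJ + 1);
      r; tau; q / (2 * A * L); q / (2 * D * tau)].
  by rewrite /= e10 r10 r0 tau0 !divr_gt0// ?subr_gt0// mulr_gt0.
rewrite ltr_pdivlMr ?mulr_gt0// in rho_r; rewrite ltr_pdivlMr// in rho_a.
rewrite ltr_pdivlMr// in rho_A; rewrite ltr_pdivlMr// in rho_D.
exists rho => // eps x t /andP[eps0 epsr] clx tT xrho trho.
have h3 : eps * (4 * rJ) < r.
  by apply: lt_trans rho_r; rewrite ltr_pM2r// mulr_gt0.
have h4 : eps * ((A + B) * L * rJ + 1) < a - a'.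
  by apply: lt_trans rho_a; rewrite ltr_pM2r.
have h1 : eps < e1 by exact: lt_trans rho_e1.
have h2 : eps < r1 by exact: lt_trans rho_r1.
have reach z : J z != 0 -> `|eps *: z| <= r / 4.
  move=> /HJ zr; rewrite normrZ gtr0_norm//.
  have : eps * `|z| <= eps * rJ by rewrite ler_wpM2l// ltW.
  by move: h3; slra.
have ubd y s : cl y -> 0 <= s <= T -> expR (k * u eps y s) <= E.
  by move=> cly sT; rewrite EE ler_expR ler_pM2l//; apply: HMu; rewrite ?eps0.
have bar : expR (k * u eps x t) <= P x + Th t.
  apply: (barrier (c1 := - 2 * La) (d := 1) (r := r) (x0 := x0)
    eps0 k0 domk r0 t10 t12 t2T) => //.
  - have cdot := @continuous_dot R n l x0; have csq := @continuous_sq R n x0.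
    have cp : continuous (fun x : RN => p (x - x0)).
      rewrite (_ : (fun x : RN => p (x - x0)) =
        fun x : RN => dot l (x - x0) + (0 + M * sq (x - x0))); last first.
        by apply/funext => y; rewrite add0r.
      apply: continuous_addr; first exact: cdot.
      by apply: continuous_affine_cst; exact: csq.
    rewrite (_ : P = fun x : RN =>
      a + 1 * (p (x - x0) * (A + (- B) * p (x - x0)))); last first.
      by apply/funext => y; rewrite /P; ring.
    apply: continuous_affine_cst; apply: continuous_prodr; first exact: cp.
    by apply: continuous_affine_cst; exact: cp.
  - rewrite (_ : Th = fun s => 0 + D * ((s - t0) * (s - t0))); last first.
      by apply/funext => s; rewrite /Th; ring.
    have ci : continuous (fun s : R => s - t0).
      by apply: continuous_subr_cst => s; exact: cvg_id.
    by apply: continuous_affine_cst; apply: continuous_prodr; exact: ci.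
  - move=> y s cly yr _; have := cP y cly yr; have := cAp y cly yr.
    have := Th0 s; move: a0; slra.
  - move=> y cly yr; have := cP y cly yr; have := ubd y t1 cly.
    rewrite t10 (le_trans t12 t2T) => /(_ isT).
    have -> : Th t1 = E by rewrite -DE /Th t1E; ring.
    have := cAp y cly yr; move: a0; slra.
  - move=> y s cly /andP[ry yr] /andP[t1s st2].
    have := ubd y s cly; rewrite (le_trans t10 (ltW t1s)) (le_trans st2 t2T) => /(_ isT) uE.
    have EA : E <= A * p (y - x0) / 2.
      have h9 : (r / 2) ^+ 2 <= p (y - x0).
        apply: (le_trans _ (psq y cly yr)).
        apply: (le_trans _ (sqr_norm_le_sq _)).
        have r20 : 0 <= r / 2 by rewrite divr_ge0// ltW.
        by rewrite !expr2; apply: ler_pM.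
      have h10 : 8 * E / r ^+ 2 * (r / 2) ^+ 2 <= A * p (y - x0).
        apply: ler_pM => //; last exact: sqr_ge0.
        by apply: divr_ge0; [apply: mulr_ge0 => //; exact: ltW|exact: sqr_ge0].
      have h11 : 8 * E / r ^+ 2 * (r / 2) ^+ 2 = 2 * E by field; rewrite gt_eqF.
      by move: h10; rewrite h11; slra.
    move: uE EA (cP y cly yr) (Th0 s) a0; slra.
  - move=> y z s cly yr2 Jz ncl /andP[t1s st2].
    have yr : `|y - x0| <= r.
      by apply: ltW; apply: (lt_le_trans yr2); rewrite ler_pdivrMr// ler_peMr ?ltW// ltrDl.
    set g := y + eps *: z.
    have gE : g - x0 = (y - x0) + eps *: z by rewrite /g addrAC.
    have gr : `|g - x0| <= r.
      rewrite gE (le_trans (ler_normD _ _))//; have := reach _ Jz.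
      by move: yr2 r0; slra.
    have s0T : 0 < s < T by rewrite (le_lt_trans t10)//= (lt_le_trans st2).
    have st0 : `|s - t0| < r1.
      rewrite ltr_distl; apply/andP; split.
        by apply: (le_lt_trans _ t1s); rewrite t1E lerB// ltW.
      by apply: (lt_le_trans st2); rewrite (le_trans t2t)// lerD2l ltW.
    have eps1 : 0 < eps < r1 by rewrite eps0.
    have := Hbd eps y z s eps1 cly Jz ncl s0T (le_lt_trans gr rr1) st0.
    rewrite -/g ler_norml => /andP[_ ucw].
    have ua' : expR (k * u eps g s) <= a'.
      rewrite a'E ler_expR ler_pM2l//.
      by move: ucw; slra.
    have [pg|pg] := leP 0 (p (g - x0)).
      have := Phalf _ gr pg.
      have : 0 <= A * p (g - x0) by rewrite mulr_ge0// ltW.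
      rewrite /P; move: (Th0 s) ua' a'a; slra.
    have [_ pg1] := p_pm _ gr; rewrite ltr0_norm// in pg1.
    (* The exterior point is within [eps * rJ] of the point [y] of the closure, where [p] is
       nonnegative, so [p] is negative there by a multiple of [eps] at worst. *)
    have plow : - (L * (eps * rJ)) <= p (g - x0).
      rewrite gE /p paraboloidD -/(p (y - x0)).
      have py0 := cp0 y cly yr.
      have Ms0 : 0 <= M * sq (eps *: z) by rewrite mulr_ge0 ?sq_ge0// ltW.
      have : `|dot (l + (2 * M) *: (y - x0)) (eps *: z)| <= L * (eps * rJ).
        apply: (le_trans (norm_dot_le _ _)); apply: ler_pM => //.
        - rewrite LE ler_wpM2l ?(ltW N0)// (le_trans (ler_normD _ _))// lerD2l.
          rewrite normrZ gtr0_norm ?mulr_gt0// -[leRHS]mulr1 ler_wpM2l//.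
            by rewrite ltW// mulr_gt0.
          exact: le_trans yr r1'.
        - by rewrite normrZ gtr0_norm// ler_wpM2l ?(ltW eps0)// HJ.
      rewrite ler_norml => /andP[+ _]; move: py0 Ms0.
      by slra.
    have hB : B * p (g - x0) ^+ 2 <= - (B * p (g - x0)).
      rewrite -mulrN ler_wpM2l ?(ltW B0)// -sqrrN expr2 ler_piMl//.
      by rewrite oppr_ge0 ltW.
    have AB : (A + B) * - (L * (eps * rJ)) <= (A + B) * p (g - x0).
      by rewrite ler_wpM2l// addr_ge0// ltW.
    rewrite /P; move: (Th0 s) ua' h4 AB hB eps0.
    by slra.
  - move=> y cly yr2; have yr : `|y - x0| <= r.
      by apply: ltW; apply: (lt_le_trans yr2); rewrite ler_pdivrMr// ler_peMr ?ltW// ltrDl.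
    have := @Ev_paraboloid_le l M A B lam eps (y - x0) (ltW M0) (ltW B0) eps0
      (cp0 y cly yr) (glam _ yr).
    rewrite -/(p (y - x0)).
    have -> : (fun z => P (y + eps *: z) - P y) =
      (fun z => A * paraboloid l M (y - x0 + eps *: z) -
          B * paraboloid l M (y - x0 + eps *: z) ^+ 2 -
          (A * p (y - x0) - B * p (y - x0) ^+ 2)).
      by apply/funext => z; rewrite /P /p [y + _ - x0]addrAC; ring.
    move/le_trans; apply.
    have : 0 <= 4 * (B * p (y - x0) * M * N).
      by rewrite !mulr_ge0 ?cp0//; exact: ltW.
    by move: BE; slra.
  - move=> s s' t1s ss' s't2.
    have -> : Th s' - Th s = (s' - s) * (D * (s' + s - 2 * t0)) by rewrite /Th; ring.
    rewrite mulrC; apply: ler_wpM2l; first by rewrite subr_ge0.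
    apply: (@le_trans _ _ (D * (- (2 * tau)))).
      have : 0 <= D * tau by apply: mulr_ge0; exact: ltW.
      by rewrite LaE; slra.
    rewrite ler_wpM2l ?(ltW D0)//; move: t1s ss'; rewrite t1E.
    by slra.
  - exact: ltW (lt_trans xrho rho_r').
  - move: (lt_trans trho rho_tau); rewrite ltr_distl => /andP[b1 b2].
    case/andP: tT => _ tT; apply/andP; split; first by rewrite t1E ltW.
    by apply: t2E => //; exact: ltW.
have xr : `|x - x0| <= r := ltW (lt_trans xrho rho_r').
rewrite -(ler_pM2l k0) -ler_expR; apply: (le_trans bar).
have hp : A * p (x - x0) <= q / 2.
  have := p_le _ xr => pl.
  have : A * p (x - x0) <= A * (L * rho).
    rewrite ler_wpM2l ?(ltW A0)// (le_trans (ler_norm _))// (le_trans pl)//.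
    by rewrite ler_wpM2l ?(ltW L0)// ltW.
  by move: rho_A; slra.
have hB : 0 <= B * p (x - x0) ^+ 2 by rewrite mulr_ge0 ?sqr_ge0// ltW.
have ht : Th t <= q / 2.
  apply: (@le_trans _ _ (D * (tau * rho))); last by move: rho_D; slra.
  rewrite /Th ler_wpM2l ?(ltW D0)// -real_normK ?num_real// expr2.
  by apply: ler_pM => //; [exact: ltW (lt_trans trho rho_tau)|exact: ltW].
by rewrite /P qE; move: hp hB ht; slra.
Qed.

Lemma norm_entry_le (H : 'M[R]_n.+1) i j : `|H i j| <= `|H|.
Proof.
rewrite [`|H|]/Num.norm/= mx_normrE.
by apply: (le_bigmax _ (fun ij : 'I_n.+1 * 'I_n.+1 => `|H ij.1 ij.2|) (i, j)).
Qed.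

Lemma norm_qform_le (H : 'M[R]_n.+1) (z : RN) : `|qform H z| <= N ^+ 2 * `|H| * `|z| ^+ 2.
Proof.
apply: (le_trans (ler_norm_sum _ _ _)).
apply: (@le_trans _ _ (\sum_(i < n.+1) (N * (`|H| * `|z| ^+ 2)))); last first.
  by rewrite sumr_const card_ord -(mulr_natl (N * _)) expr2 !mulrA.
apply: ler_sum => i _; apply: (le_trans (ler_norm_sum _ _ _)).
apply: (@le_trans _ _ (\sum_(j < n.+1) (`|H| * `|z| ^+ 2))); last first.
  by rewrite sumr_const card_ord -(mulr_natl (`|H| * _)).
apply: ler_sum => j _; rewrite !normrM ler_pM ?norm_entry_le ?mulr_ge0//.
by rewrite expr2 ler_pM ?normr_coord_le.
Qed.

Lemma qformZ (H : 'M[R]_n.+1) (e : R) z : qform H (e *: z) = e ^+ 2 * qform H z.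
Proof.
rewrite mulr_sumr; apply: eq_bigr => i _; rewrite mulr_sumr; apply: eq_bigr => j _.
by rewrite !mxE; ring.
Qed.

(** [D] and [Q] stand for the first and second order parts of an increment of [v]. Monotonicity of
    [K x] passes from [a] to its upper bound, and the square of that bound differs from
    [eps ^+ 2 * D ^+ 2] by a cubic term. The operator divides by [eps ^+ 2], so an error small
    compared with [eps ^+ 2] is what is needed. *)
Lemma reaction_expansion (x : RN) (s0 w1 Db Qb b1 : R) (eps D Q a : R) :
  good x -> 0 < eps <= 1 -> 0 <= w1 ->
  (forall s : R, `|s| <= s0 -> `|K x s - G0 x * s - G1 x * s ^+ 2| <= w1 * s ^+ 2) ->
  `|G1 x| <= b1 -> `|D| <= Db -> `|Q| <= Qb -> eps * (Db + Qb) <= s0 ->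
  a <= eps * D + eps ^+ 2 * Q ->
  K x a <= G0 x * (eps * D + eps ^+ 2 * Q) + G1 x * (eps ^+ 2 * D ^+ 2) +
     eps ^+ 2 * (eps * (b1 * (2 * Db * Qb + Qb ^+ 2)) + w1 * (Db + Qb) ^+ 2).
Proof.
move=> gx /andP[eps0 eps1] w10 tay Gb DDb QQb es aA; set A := eps * D + _.
have Db0 : 0 <= Db by exact: le_trans DDb.
have Qb0 : 0 <= Qb by exact: le_trans QQb.
have b10 : 0 <= b1 by exact: le_trans Gb.
have mono : K x a <= K x A.
  have /andP[h _] := setup_slope S gx aA.
  rewrite -subr_ge0 (le_trans _ h)// mulr_ge0 ?subr_ge0//.
  exact: ltW (setup_a1 S).
have AB : `|A| <= eps * (Db + Qb).
  rewrite (le_trans (ler_normD _ _))// !normrM (gtr0_norm eps0) mulrDr lerD//.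
    by rewrite ler_wpM2l// ltW.
  rewrite -mulrA ler_wpM2l ?(ltW eps0)//.
  by rewrite -[leRHS]mul1r ler_pM// ltW.
apply: (le_trans mono).
have := tay A (le_trans AB es); rewrite ler_norml => /andP[_ h1].
have A2 : A ^+ 2 <= eps ^+ 2 * (Db + Qb) ^+ 2.
  by rewrite -exprMn -real_normK ?num_real// !expr2 ler_pM.
have h2 : w1 * A ^+ 2 <= w1 * (eps ^+ 2 * (Db + Qb) ^+ 2) by rewrite ler_wpM2l.
have h3 : `|G1 x * (A ^+ 2 - eps ^+ 2 * D ^+ 2)| <=
    b1 * (eps ^+ 2 * (eps * (2 * Db * Qb + Qb ^+ 2))).
  rewrite normrM ler_pM//.
  have -> : A ^+ 2 - eps ^+ 2 * D ^+ 2 = eps ^+ 2 * (eps * (2 * D * Q + eps * Q ^+ 2)).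
    by rewrite /A; ring.
  rewrite normrM ger0_norm ?sqr_ge0// ler_wpM2l ?sqr_ge0// normrM gtr0_norm//.
  rewrite ler_wpM2l ?(ltW eps0)// (le_trans (ler_normD _ _))// lerD//.
    by rewrite !normrM ger0_norm// -!mulrA ler_wpM2l// ler_pM.
  rewrite normrM gtr0_norm// -[leRHS]mul1r ler_pM// ?(ltW eps0)//.
  by rewrite normrX !expr2 ler_pM.
move: h3; rewrite ler_norml => /andP[_ h3].
move: h1 h2 h3; slra.
Qed.

(** The normalisations [C x * G0 x * moment J = 2] and [C x * G1 x * moment J = m x] produce the
    local operator. It is at most [vt + d / 4] after all errors, whereas the summand [d * t] lifts
    the time slope to at least [vt + 3 / 4 d]. *)
Lemma interior_super (x0 : RN) (t0 d : R) : Om x0 -> 0 < t0 < T -> 0 < d ->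
  exists2 rho : R, 0 < rho & forall (eps w : R) (xs : RN) (ts : R),
    0 < eps < rho -> `|xs - x0| < rho -> `|ts - t0| < rho ->
    local_super eps cl 0 (fun x t => v x t + w + d * t) xs ts.
Proof.
move=> Ox0 t0T d0; have [vt pde] := setup_pde S Ox0 t0T.
have [rJ rJ0 HJ] := kernel_support hJ.
have [b1 Hb1] := setup_G1 S.
(* [ww] bounds the Taylor remainders of [v] in space and time and the defect of the equation; the
   space remainder [ww * sq z] contributes [2 N ww] to the operator. *)
have [ww ww0 wwE] : exists2 ww, 0 < ww & ww * (4 * (1 + 2 * N)) <= d / 4.
  exists (d / 4 / (4 * (1 + 2 * N))); last by rewrite divfK// gt_eqF// mulr_gt0// addr_gt0// mulr_gt0.
  by apply: divr_gt0; [exact: divr_gt0|rewrite mulr_gt0// addr_gt0// mulr_gt0].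
have [B0 [r [r0 Hr]]] := pde ww ww0.
have [B BB Bge0] : exists2 B, B0 <= B & 0 <= B by exists `|B0| => //; exact: ler_norm.
have [Db DbE Db0] : exists2 Db, N * B * rJ = Db & 0 <= Db.
  by exists (N * B * rJ) => //; rewrite !mulr_ge0// ltW.
have [Qb QbE Qb0] : exists2 Qb,
    N ^+ 2 * B * rJ ^+ 2 / 2 + ww * (N * rJ ^+ 2) = Qb & 0 <= Qb.
  eexists; first reflexivity.
  by rewrite addr_ge0// ?divr_ge0// !mulr_ge0// ?sqr_ge0// ltW.
have [Cm CmE Cm0] : exists2 Cm, 2 / moment J / a1 = Cm & 0 < Cm.
  by eexists; [reflexivity|rewrite !divr_gt0// (setup_a1 S)].
have [bb bbE bb0] : exists2 bb, `|b1| * (2 * Db * Qb + Qb ^+ 2) = bb & 0 <= bb.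
  eexists; first reflexivity.
  by apply: mulr_ge0 => //; apply: addr_ge0; rewrite ?sqr_ge0// !mulr_ge0.
have [w1 w10 w1E] : exists2 w1, 0 < w1 & Cm * (w1 * (Db + Qb) ^+ 2) <= d / 16.
  have q0 : 0 < Cm * ((Db + Qb) ^+ 2 + 1) by rewrite mulr_gt0// ltr_wpDl// sqr_ge0.
  exists (d / 16 / (Cm * ((Db + Qb) ^+ 2 + 1))); first by rewrite !divr_gt0.
  rewrite mulrCA; set e := d / 16; rewrite mulrAC ler_pdivrMr//.
  by rewrite ler_wpM2l ?divr_ge0 ?(ltW d0)// ler_wpM2l ?(ltW Cm0)// lerDl.
have [s0 s00 tay] := setup_taylor S w10.
have [rho [rho0 rho1 rhor rhos rhob]] : exists rho : R, [/\ 0 < rho, rho <= 1,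
    rho * (4 * (rJ + 1)) <= r, rho * (Db + Qb) <= s0 & Cm * (rho * bb) <= d / 16].
  have p1 : 0 < 4 * (rJ + 1) by rewrite mulr_gt0// addr_gt0.
  have p2 : 0 < Db + Qb + 1 by rewrite ltr_wpDl// addr_ge0.
  have p3 : 0 < Cm * (bb + 1) by rewrite mulr_gt0// ltr_wpDl.
  have q1 : 0 < r / (4 * (rJ + 1)) by exact: divr_gt0.
  have q2 : 0 < s0 / (Db + Qb + 1) by exact: divr_gt0.
  have q3 : 0 < d / 16 / (Cm * (bb + 1)) by rewrite !divr_gt0.
  have [|rho rho0 /= /and5P[/ltW c1 /ltW c2 /ltW c3 /ltW c4 _]] := @exists_lt_all R
      [:: 1; r / (4 * (rJ + 1)); s0 / (Db + Qb + 1); d / 16 / (Cm * (bb + 1))].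
    by rewrite /= ltr01 q1 q2 q3.
  exists rho; split => //.
  - by rewrite -ler_pdivlMr.
  - apply: (@le_trans _ _ (rho * (Db + Qb + 1))); last by rewrite -ler_pdivlMr.
    by rewrite ler_wpM2l ?(ltW rho0)// lerDl.
  - apply: (@le_trans _ _ (rho * (Cm * (bb + 1)))); last by rewrite -ler_pdivlMr.
    by rewrite mulrCA ler_wpM2l ?(ltW rho0)// ler_wpM2l ?(ltW Cm0)// lerDl.
have rho4 : rho <= r / 4.
  have : rho * 4 <= r.
    apply: le_trans rhor; rewrite ler_wpM2l ?(ltW rho0)//.
    by move: rJ0; slra.
  by slra.
exists rho => // eps w xs ts /andP[eps0 epsr] xsr tsr.
exists (vt + d / 4), (d / 2), (r / 4); split; rewrite ?divr_gt0//.
move=> x gx xxs; have clx := good_closure gx; split => // s s0' tss sts.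
have sr1 : `|s - t0| < r.
  move: tss sts (lt_le_trans tsr rho4); rewrite !ltr_distl => h1 h2 /andP[h3 h4].
  by apply/andP; split; move: h1 h2 h3 h4 r0; slra.
have tsr1 : `|ts - t0| < r.
  by apply: (lt_le_trans tsr); move: rho4 r0; slra.
have xr2 : `|x - x0| < r / 2.
  have -> : x - x0 = (x - xs) + (xs - x0) by rewrite addrA subrK.
  apply: (le_lt_trans (ler_normD _ _)); move: xxs (lt_le_trans xsr rho4).
  by slra.
have xr : `|x - x0| < r.
  by apply: (lt_trans xr2); move: r0; slra.
have ezr z : J z != 0 -> `|eps *: z| <= r / 4.
  move=> /HJ zr; rewrite normrZ gtr0_norm//.
  have h1 : eps * `|z| <= rho * (rJ + 1).
    by apply: ler_pM => //; [exact: ltW|exact: ltW|rewrite (le_trans zr)// lerDl].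
  by move: h1 rhor; slra.
split.
  have [_ _ /(_ s sr1) Hv _] := Hr x ts xr tsr1.
  have ts0 : 0 < ts - s by rewrite subr_gt0.
  move: Hv; rewrite (gtr0_norm ts0) ler_norml => /andP[Hv _].
  have h2 : ww * (ts - s) <= d / 4 * (ts - s).
    rewrite ler_wpM2r ?(ltW ts0)//; move: wwE ww0 (mulr_gt0 ww0 N0).
    by slra.
  by move: Hv h2; slra.
have [_ sT _ [gr [H [Htay grB HB Hpde]]]] := Hr x s xr sr1.
have grB' : `|gr| <= B by exact: le_trans BB.
have HB' : `|H| <= B by exact: le_trans BB.
pose Q (z : RN) := qform H z / 2 + ww * sq z.
pose err := eps * (`|b1| * (2 * Db * Qb + Qb ^+ 2)) + w1 * (Db + Qb) ^+ 2.
pose b (z : RN) := (G0 x * eps) * dot gr z + ((G0 x * eps ^+ 2 / 2) * qform H z +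
  ((G0 x * eps ^+ 2 * ww) * sq z + ((G1 x * eps ^+ 2) * dot gr z ^+ 2 + eps ^+ 2 * err))).
have k1 : kernel_bdd J (dot gr) by exact: kernel_bdd_dot.
have k2 : kernel_bdd J (qform H) by exact: kernel_bdd_qform.
have k3 : kernel_bdd J sq by exact: kernel_bdd_sq.
have k4 : kernel_bdd J (fun z => dot gr z ^+ 2).
  rewrite (_ : (fun z => _) = dot gr \* dot gr); first exact: kernel_bddM.
  by apply/funext => z; rewrite expr2.
have k5 : kernel_bdd J (fun=> eps ^+ 2 * err) by exact: kernel_bdd_cst.
have k1' := kernel_bddZ hJ (G0 x * eps) k1.
have k2' := kernel_bddZ hJ (G0 x * eps ^+ 2 / 2) k2.
have k3' := kernel_bddZ hJ (G0 x * eps ^+ 2 * ww) k3.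
have k4' := kernel_bddZ hJ (G1 x * eps ^+ 2) k4.
have k45 := kernel_bddD k4' k5.
have k345 := kernel_bddD k3' k45.
have k2345 := kernel_bddD k2' k345.
exists b; split; first exact: (kernel_bddD k1' k2345).
  move=> z Jz; have zr := ezr z Jz.
  have yOm : Om (x + eps *: z).
    have yr : `|x + eps *: z - x0| < r.
      have -> : x + eps *: z - x0 = (x - x0) + eps *: z by rewrite addrAC.
      apply: (le_lt_trans (ler_normD _ _)); move: xr2 zr r0.
      by slra.
    by have [] := Hr _ s yr sr1.
  split; first by left; exact: subset_closure.
  have zJ := HJ z Jz.
  have z2 : `|z| ^+ 2 <= rJ ^+ 2 by rewrite !expr2 ler_pM.
  have hD : `|dot gr z| <= Db.
    apply: (le_trans (norm_dot_le _ _)).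
    by rewrite -DbE ler_pM// ?mulr_ge0// ?(ltW N0)// ler_wpM2l// ltW.
  have hQ : `|Q z| <= Qb.
    rewrite -QbE (le_trans (ler_normD _ _))// lerD//.
      rewrite normrM [`|2^-1|]ger0_norm// ler_wpM2r//.
      rewrite (le_trans (norm_qform_le _ _))// ler_pM// ?mulr_ge0// ?sqr_ge0//.
      by rewrite ler_wpM2l// sqr_ge0.
    rewrite ger0_norm ?mulr_ge0 ?sq_ge0 ?(ltW ww0)// ler_wpM2l ?(ltW ww0)//.
    by rewrite (le_trans (sq_le_norm _))// ler_wpM2l// ltW.
  have ezr' : `|eps *: z| < r.
    by apply: (le_lt_trans zr); move: r0; slra.
  have := Htay _ ezr'; rewrite dotZr qformZ sqZ ler_norml => /andP[_ up].
  have es : eps * (Db + Qb) <= s0.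
    by apply: le_trans rhos; rewrite ler_wpM2r ?addr_ge0// ltW.
  have eps1 : 0 < eps <= 1 by rewrite eps0 (le_trans (ltW epsr)).
  have Gb : `|G1 x| <= `|b1| by rewrite (le_trans (Hb1 _ gx))// ler_norm.
  have -> : v (x + eps *: z) s + w + d * s - (v x s + w + d * s) =
    v (x + eps *: z) s - v x s by ring.
  have := @reaction_expansion x s0 w1 Db Qb `|b1| eps (dot gr z) (Q z)
    (v (x + eps *: z) s - v x s) gx eps1 (ltW w10) (fun s => tay x s gx) Gb hD hQ es.
  have -> : G0 x * (eps * dot gr z + eps ^+ 2 * Q z) + G1 x * (eps ^+ 2 * dot gr z ^+ 2) +
      eps ^+ 2 * (eps * (`|b1| * (2 * Db * Qb + Qb ^+ 2)) + w1 * (Db + Qb) ^+ 2) = b z.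
    by rewrite /b /Q /err; field.
  by apply; rewrite /Q; move: up; slra.
rewrite /b !EvD// (Ev_cst hJ) !(EvZ hJ)// Ev_dot// Ev_qform// Ev_sq// Ev_dot_sqr//.
have /andP[Cx0] := C_bound gx; rewrite CmE => CxCm.
have CG := setup_C S gx; have Cmu := setup_mu S gx.
have -> : C x / eps ^+ 2 * (G0 x * eps * 0 + (G0 x * eps ^+ 2 / 2 * (\tr H * moment J) +
    (G0 x * eps ^+ 2 * ww * (N * moment J) +
      (G1 x * eps ^+ 2 * (sq gr * moment J) + eps ^+ 2 * err)))) =
  (C x * G0 x) * moment J * (\tr H / 2 + ww * N) + (C x * G1 x * moment J) * sq gr + C x * err.
  by field; rewrite gt_eqF.
rewrite CG Cmu divfK ?gt_eqF//.
move: Hpde; rewrite ler_norml => /andP[_ Hpde].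
have h1 : C x * err <= d / 8.
  have e0 : 0 <= err.
    rewrite /err bbE; apply: addr_ge0; first by apply: mulr_ge0 => //; exact: ltW.
    by apply: mulr_ge0; [exact: ltW|exact: sqr_ge0].
  apply: (@le_trans _ _ (Cm * err)); first by rewrite ler_wpM2r.
  have h2 : Cm * (eps * bb) <= Cm * (rho * bb).
    by rewrite ler_wpM2l ?(ltW Cm0)// ler_wpM2r// ltW.
  rewrite /err bbE; move: h2 rhob w1E; slra.
move: Hpde h1 wwE ww0 d0; slra.
Qed.

Lemma limit_near (x0 : RN) (t0 w : R) : cl x0 -> 0 <= t0 <= T -> 0 < w ->
  exists2 r : R, 0 < r & forall (x : RN) (t : R), cl x -> 0 <= t <= T ->
    `|x - x0| < r -> `|t - t0| < r -> `|v x t - v x0 t0| < w.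
Proof.
move=> clx0 t0T w0.
have p0 : (cl `*` `[0, T]) (x0, t0) by split => //=; rewrite in_itv.
have [r r0 Hr] := (within_continuousP _ _).1 (setup_vcont S) _ p0 _ w0.
exists r => // x t clx tT xr tr; apply: (Hr (x, t)); first by split => //=; rewrite in_itv.
by rewrite prod_norm_lt xr.
Qed.

(** Compactness of the cylinder in its near-covering form, with the filter of small positive [eps]
    as parameter: finitely many neighbourhoods give one threshold. *)
Lemma uniform_of_local (T' : R) (P : R -> RN -> R -> Prop) :
  (forall (x0 : RN) (t0 : R), cl x0 -> 0 <= t0 <= T' ->
    exists2 r : R, 0 < r & forall (eps : R) (x : RN) (t : R), 0 < eps < r ->
      cl x -> 0 <= t <= T' -> `|x - x0| < r -> `|t - t0| < r -> P eps x t) ->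
  exists2 r : R, 0 < r & forall (eps : R) (x : RN) (t : R), 0 < eps < r ->
    cl x -> 0 <= t <= T' -> P eps x t.
Proof.
move=> loc.
have cX : compact (cl `*` `[0, T']).
  apply: compact_setX; last exact: segment_compact.
  exact: compact_closure_bounded (setup_bounded S).
pose Q (eps : R) (p : RN * R) := cl p.1 -> 0 <= p.2 <= T' -> P eps p.1 p.2.
have := (compact_near_coveringP _).1 cX R (0^'+) Q _.
move=> [].
  move=> [x0 t0] [/= clx0]; rewrite in_itv /= => t0T.
  have [r r0 Hr] := loc x0 t0 clx0 t0T.
  have nb : nbhs (x0, t0) [set p : RN * R | `|p.1 - x0| < r /\ `|p.2 - t0| < r].
    exists ([set x : RN | `|x - x0| < r], [set t : R | `|t - t0| < r]).
      by split => /=; exact: nbhs_dist_lt.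
    by move=> [x t] [].
  exists ([set p : RN * R | `|p.1 - x0| < r /\ `|p.2 - t0| < r], [set eps | 0 < eps < r]).
    split => //=; near=> e; apply/andP; split; near: e.
      exact: nbhs_right_gt.
    exact: nbhs_right_lt.
  by move=> [[x t] eps] [/= [xr tr] epsr] clx tT; exact: Hr.
move=> r /= r0 Hr; exists r => // eps x t /andP[eps0 epsr] clx tT.
have := Hr eps; rewrite /= sub0r normrN gtr0_norm// => /(_ epsr eps0 (x, t)).
by apply => //; split => //=; rewrite in_itv.
Unshelve. all: by end_near. Qed.

Definition good_at (w : R) (x0 : RN) (t0 : R) :=
  exists2 r : R, 0 < r & forall (eps : R) (x : RN) (t : R), 0 < eps < r ->
    cl x -> 0 <= t <= T -> `|x - x0| < r -> `|t - t0| < r ->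
    u eps x t <= v x t + w.

Lemma no_exterior_near (x0 : RN) : Om x0 -> exists2 r : R, 0 < r &
  forall y : RN, `|y - x0| < r -> cl y.
Proof.
move=> Ox0; have /nbhs_normP[r /= r0 Hr] := open_nbhs_nbhs (conj (setup_open S) Ox0).
exists r => // y yr; apply: subset_closure; apply: Hr.
by rewrite /= distrC.
Qed.

(** The forward barrier started at time 0. One third of [w] goes to the data near [x0], one to the
    barrier and one to the variation of [v]; near an interior [x0] there are no exterior data at
    all. *)
Lemma initial_good (x0 : RN) (w : R) : cl x0 -> 0 < w -> good_at w x0 0.
Proof.
move=> clx0 w0; have [w3 w3E w30] : exists2 w3 : R, w = w3 * 3 & 0 < w3.
  by exists (w / 3); rewrite ?divfK ?divr_gt0// pnatr_eq0.
have T0P : 0 <= (0 : R) <= T by rewrite lexx ltW.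
have [r1 r10 Hr1] := limit_near clx0 T0P w30.
have [r2 r20 Hr2] : exists2 r2 : R, 0 < r2 & forall (eps : R) (x z : RN) (t : R),
    0 < eps < r2 -> cl x -> J z != 0 -> ~ cl (x + eps *: z) -> 0 < t < T ->
    `|x + eps *: z - x0| < r2 -> `|t| < r2 ->
    u eps (x + eps *: z) t <= v x0 0 + w3.
  have [Ox0|nOx0] := pselect (Om x0).
    have [r r0 Hr] := no_exterior_near Ox0.
    by exists r => // eps x z t _ _ _ ncl _ /Hr.
  have [r r0 Hr] := setup_bdry S clx0 nOx0 T0P w30.
  exists r => // eps x z t e1 e2 e3 e4 e5 e6 e7.
  have := Hr eps x z t e1 e2 e3 e4 e5 e6; rewrite subr0 => /(_ e7).
  by rewrite ler_norml lerBlDl => /andP[].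
have [e1 [Mu [e10 HMu]]] := uniform_bound.
have [M MuM cM] : exists2 M : R, Mu <= M & `|v x0 0 + w3| <= M.
  by exists (Num.max Mu `|v x0 0 + w3|); rewrite le_max lexx ?orbT.
have [|r r0 /= /and3P[rr1 rr2 _]] := @exists_lt_all R [:: r1; r2].
  by rewrite /= r10 r20.
have [rho rho0 Hrho] := forward_barrier M r0 w30.
exists (Num.min (Num.min rho r1) (Num.min e1 r2)) => [|eps x t].
  by rewrite !lt_min rho0 r10 e10 r20.
rewrite !lt_min subr0 => /andP[eps0 /andP[/andP[epsr _] /andP[epse epsr2]]] clx tT.
move=> /andP[/andP[xr xr1] _] /andP[/andP[tr tr1] /andP[_ tr2]].
have /andP[t0 tT'] := tT.
have tt : t <= `|t| := ler_norm t.
have : u eps x t <= v x0 0 + w3 + w3.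
  apply: (Hrho eps x0 0 t) => //.
  - by rewrite eps0.
  - by rewrite subr0 (le_trans tt)// ltW.
  - by move=> y s cly sT; apply: (le_trans _ MuM); apply: HMu; rewrite ?eps0.
  - move=> y cly yr; rewrite (setup_init S eps0 cly).
    have := Hr1 y 0 cly T0P (le_lt_trans yr rr1); rewrite subrr normr0 => /(_ r10).
    by move=> /ltW; rewrite ler_norml lerBlDl => /andP[].
  - move=> y z s cly Jz ncl /andP[s0 st] yr; apply: Hr2 => //; rewrite ?eps0//.
    + by rewrite s0 (lt_le_trans st).
    + exact: le_lt_trans rr2.
    + by rewrite gtr0_norm// (lt_trans st)// (le_lt_trans tt).
  - exact: ltW.
  - by rewrite t0 lexx.
have := Hr1 x t clx tT xr1; rewrite subr0 => /(_ tr1).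
rewrite w3E ltr_norml => /andP[h1 _] h2; move: h1 h2 w30.
by slra.
Qed.

Lemma boundary_good (x0 : RN) (t0 w : R) : cl x0 -> ~ Om x0 -> 0 < t0 <= T -> 0 < w ->
  good_at w x0 t0.
Proof.
move=> clx0 nOx0 t0T w0; have w2 : 0 < w / 2 by rewrite divr_gt0.
have t0P : 0 <= t0 <= T by case/andP: t0T => h ->; rewrite ltW.
have [r1 r10 Hr1] := limit_near clx0 t0P w2.
have [r2 r20 Hr2] := boundary_barrier clx0 nOx0 t0T w2.
exists (Num.min r1 r2) => [|eps x t]; first by rewrite lt_min r10.
rewrite !lt_min => /andP[eps0 /andP[_ eps2]] clx tT /andP[x1 x2] /andP[h1 h2].
have := Hr1 x t clx tT x1 h1; rewrite ltr_norml => /andP[h3 _].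
have := Hr2 eps x t; rewrite eps0 => /(_ eps2 clx tT x2 h2) h4.
move: h3 h4; slra.
Qed.

(** Near interior points at positive times [psi] is a local supersolution. Near the initial and
    lateral boundary [u <= v + w / 2 <= psi] is known already, which excludes contact. [T' < T]
    keeps the interior points within the range of the local equation. *)
Lemma interior_upper_bound (T' w : R) : 0 <= T' -> T' < T -> 0 < w ->
  exists2 e : R, 0 < e & forall (eps : R) (x : RN) (t : R), 0 < eps < e ->
    cl x -> 0 <= t <= T' -> u eps x t <= v x t + w.
Proof.
move=> T'0 T'T w0; have w2 : 0 < w / 2 by rewrite divr_gt0.
pose d := w / (2 * T); have d0 : 0 < d by rewrite divr_gt0// mulr_gt0.
pose psi (x : RN) t := v x t + w / 2 + d * t.
have T'P t : 0 <= t <= T' -> 0 <= t <= T.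
  by move=> /andP[-> tT']; rewrite (le_trans tT')// ltW.
have [|e e0 He] := @uniform_of_local T' (fun eps x t => u eps x t <= v x t + w / 2 \/
    local_super eps cl 0 psi x t).
  move=> x0 t0 clx0 t0T'; have t0T := T'P _ t0T'.
  have [[t00 Ox0]|nint] := pselect (0 < t0 /\ Om x0).
    have t0T2 : 0 < t0 < T by rewrite t00 (le_lt_trans _ T'T)//; case/andP: t0T'.
    have [r r0 Hr] := interior_super Ox0 t0T2 d0.
    by exists r => // eps x t er clx tT xr tr; right; exact: Hr.
  have [r r0 Hr] : good_at (w / 2) x0 t0.
    have [t00|t00] := ltP 0 t0.
      apply: boundary_good => //; last by rewrite t00; case/andP: t0T.
      by move=> Ox0; apply: nint.
    have -> : t0 = 0 by apply/eqP; rewrite eq_le t00; case/andP: t0T.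
    exact: initial_good.
  exists r => // eps x t er clx tT xr tr; left; apply: Hr => //.
  exact: T'P.
exists e => // eps x t er clx tT'; have /andP[eps0 _] := er.
apply: (@le_trans _ _ (psi x t)).
  apply: (comparison eps0 (X := cl) (t1 := 0) (t2 := T')) => //.
  - exact: compact_closure_bounded (setup_bounded S).
  - exact: ltW.
  - have cv : {within cl `*` `[0, T'], continuous (uncurry v)}.
      apply: continuous_subspaceW (setup_vcont S) => -[y s] [/= cly].
      by rewrite !in_itv /= => sT; split => //=; rewrite T'P.
    have cl2 : continuous (fun p : RN * R => w / 2 + d * p.2).
      by apply: continuous_affine_cst => p; exact: cvg_snd.
    rewrite (_ : uncurry psi = (uncurry v + (fun p : RN * R => w / 2 + d * p.2))).
      by apply: within_continuousD => //; exact: continuous_subspaceT.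
    by apply/funext => -[y s]; rewrite /psi /= addrA.
  - move=> y cly; rewrite (setup_init S eps0 cly) /psi mulr0 addr0 lerDl.
    exact: ltW.
  - move=> y s cly /andP[s0 sT] us; have sP : 0 <= s <= T' by rewrite ltW.
    have [h|//] := He eps y s er cly sP.
    exfalso; move: us; rewrite ltNge => /negP; apply; apply: (le_trans h).
    by rewrite /psi lerDl mulr_ge0// ltW.
have /andP[t0 tT] := tT'.
rewrite /psi -addrA lerD2l [leRHS]splitr lerD2l.
have -> : w / 2 = d * T by rewrite /d; field; rewrite gt_eqF.
by rewrite ler_wpM2l ?(ltW d0)// (le_trans tT)// ltW.
Qed.

(** The bound at time [T - tau] serves as initial datum for the forward barrier, which relies on no
    equation for [v]. Its ball is taken inside the domain, so no exterior data occur. *)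
Lemma final_good (x0 : RN) (w : R) : Om x0 -> 0 < w -> good_at w x0 T.
Proof.
move=> Ox0 w0; have clx0 : cl x0 by exact: subset_closure.
have [w5 w5E w50] : exists2 w5 : R, w = w5 * 5 & 0 < w5.
  by exists (w / 5); rewrite ?divfK ?divr_gt0// pnatr_eq0.
have TP : 0 <= T <= T by rewrite lexx ltW.
have [r1 r10 Hr1] := limit_near clx0 TP w50.
have [r2 r20 Hr2] := no_exterior_near Ox0.
have [e1 [Mu [e10 HMu]]] := uniform_bound.
have [M MuM cM] : exists2 M : R, Mu <= M & `|v x0 T + 2 * w5| <= M.
  by exists (Num.max Mu `|v x0 T + 2 * w5|); rewrite le_max lexx ?orbT.
have [|r r0 /= /and3P[rr1 rr2 _]] := @exists_lt_all R [:: r1; r2].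
  by rewrite /= r10 r20.
have [rho rho0 Hrho] := forward_barrier M r0 w50.
have [|tau tau0 /= /and4P[/ltW taurho taur1 /ltW tauT _]] := @exists_lt_all R [:: rho; r1; T].
  by rewrite /= rho0 r10 T0.
have t10 : 0 <= T - tau by rewrite subr_ge0.
have t1T : T - tau < T by rewrite gtrBl.
have [e2 e20 He2] := interior_upper_bound t10 t1T w50.
exists (Num.min (Num.min rho r1) (Num.min (Num.min e1 e2) tau)) => [|eps x t].
  by rewrite !lt_min rho0 r10 e10 e20.
rewrite !lt_min => /andP[eps0 /andP[/andP[epsr _] /andP[/andP[epse1 epse2] _]]] clx tT.
move=> /andP[/andP[xr xr1] _] /andP[/andP[_ tr1] /andP[_ trt]].
have /andP[t0 tT'] := tT.
have t1t : T - tau <= t by move: trt; rewrite ltr_distl => /andP[/ltW].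
have : u eps x t <= v x0 T + 2 * w5 + w5.
  apply: (Hrho eps x0 (T - tau) t) => //.
  - by rewrite eps0.
  - apply: (le_trans _ taurho); move: tT'; slra.
  - by move=> y s cly sT; apply: (le_trans _ MuM); apply: HMu; rewrite ?eps0.
  - move=> y cly yr.
    have h1 : u eps y (T - tau) <= v y (T - tau) + w5.
      by apply: He2 => //; rewrite ?eps0// t10 lexx.
    have t1P : 0 <= T - tau <= T by rewrite t10 ltW.
    have h2 : `|T - tau - T| < r1 by rewrite addrAC subrr add0r normrN gtr0_norm.
    have := Hr1 y (T - tau) cly t1P (le_lt_trans yr rr1) h2.
    rewrite ltr_norml => /andP[_ h3]; move: h1 h3; slra.
  - by move=> y z s cly Jz ncl _ yr; exfalso; apply: ncl; apply: Hr2; exact: le_lt_trans rr2.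
  - exact: ltW.
  - by rewrite t1t lexx.
have := Hr1 x t clx tT xr1 tr1.
rewrite w5E ltr_norml => /andP[h1 _] h2; move: h1 h2 w50.
by slra.
Qed.

Theorem upper_bound (w : R) : 0 < w ->
  exists2 e : R, 0 < e & forall (eps : R) (x : RN) (t : R), 0 < eps < e ->
    cl x -> 0 <= t <= T -> u eps x t <= v x t + w.
Proof.
move=> w0; apply: uniform_of_local => x0 t0 clx0 t0T.
suff [r r0 Hr] : good_at w x0 t0 by exists r => // *; exact: Hr.
have /andP[t00 t0T'] := t0T.
have [t0lt|t0ge] := ltP t0 T; last first.
  have -> : t0 = T by apply/eqP; rewrite eq_le t0T'.
  have [Ox0|nOx0] := pselect (Om x0); first exact: final_good.
  by apply: boundary_good; rewrite // T0 lexx.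
pose T' := (t0 + T) / 2.
have T'0 : 0 <= T' by rewrite divr_ge0// addr_ge0// ltW.
have T'T : T' < T by rewrite /T'; move: t0lt; slra.
have t0T2 : 0 < T' - t0 by rewrite /T'; move: t0lt; slra.
have [e e0 He] := interior_upper_bound T'0 T'T w0.
exists (Num.min e (T' - t0)) => [|eps x t]; first by rewrite lt_min e0.
rewrite !lt_min => /andP[eps0 /andP[epse _]] clx /andP[tt0 _] _ /andP[_ tr].
apply: He => //; rewrite ?eps0// tt0 /=.
move: tr; rewrite ltr_distl => /andP[_ h]; apply: ltW; apply: (lt_le_trans h).
by rewrite addrC subrK.
Qed.

End Convergence.

(** * Expansions of the local solution *)

Section Taylor.
Context {R : realType}.

Lemma MVT_dist (g g' : R -> R) (a b l c : R) :
  (forall s : R, `|s - a| <= `|b - a| -> is_derive s 1 g (g' s) /\ `|g' s - l| <= c) ->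
  `|g b - g a - l * (b - a)| <= c * `|b - a|.
Proof.
move=> gd.
have key (s : R) : `|s - a| <= `|b - a| -> g b - g a = g' s * (b - a) ->
    `|g b - g a - l * (b - a)| <= c * `|b - a|.
  by move=> sab ->; rewrite -mulrBl normrM ler_wpM2r//; exact: (gd s sab).2.
have dg (x y : R) : x <= y -> (forall s : R, s \in `[x, y] -> `|s - a| <= `|b - a|) ->
    exists2 s, s \in `[x, y] & g y - g x = g' s * (y - x).
  move=> xy H; apply: MVT_segment => // [s sxy|].
    by apply: (gd s _).1; apply: H; exact: subset_itv_oo_cc.
  apply: derivable_within_continuous => s sxy.
  by have [[]] := gd s (H s sxy).
have [ab|/ltW ba] := leP a b.
  have inab (s : R) : s \in `[a, b] -> `|s - a| <= `|b - a|.
    by rewrite in_itv /= => /andP[sa sb]; rewrite !ger0_norm ?subr_ge0// lerB.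
  by have [s sab] := dg a b ab inab; apply: key; exact: inab.
have inba (s : R) : s \in `[b, a] -> `|s - a| <= `|b - a|.
  by rewrite in_itv /= => /andP[sa sb]; rewrite !ler0_norm ?subr_le0// lerN2 lerB.
have [s sab E] := dg b a ba inba; apply: (key s); first exact: inba.
by rewrite -[LHS]opprB E -mulrN opprB.
Qed.

(** Only partial derivatives of [v] are given, so differentiability along an oblique ray is obtained
    from a quadratic error estimate instead of the chain rule. *)
Lemma is_derive_quadratic (g : R -> R) (s l c d : R) : 0 < d ->
  (forall h : R, `|h| < d -> `|g (s + h) - g s - l * h| <= c * h ^+ 2) ->
  is_derive s 1 g l.
Proof.
move=> d0 H.
have cv : h^-1 *: (g (h *: 1 + s) - g s) @[h --> 0^'] --> l.
  apply/cvgrPdist_le => e e0; near=> h.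
  have h0 : h != 0 by near: h; exact: nbhs_dnbhs_neq.
  have [hd he] : `|h| < d /\ `|c| * `|h| <= e.
    have : `|h| < Num.min d (e / (`|c| + 1)).
      near: h; apply: dnbhs0_lt; rewrite lt_min d0 divr_gt0// ltr_wpDl.
    rewrite lt_min => /andP[-> ]; rewrite ltr_pdivlMr ?ltr_wpDl// => /ltW hc.
    by split => //; apply: le_trans hc; rewrite mulrC ler_wpM2l// lerDl.
  have h0' : 0 < `|h| by rewrite normr_gt0.
  rewrite distrC -(ler_pM2l h0') -normrM mulrBr [h *: 1]mulr1 [_ *: _]/(_ * _).
  rewrite mulVKf// [h + s]addrC [h * l]mulrC (le_trans (H h hd))//.
  rewrite -real_normK ?num_real// expr2 mulrCA ler_wpM2l//.
  by apply: le_trans he; rewrite ler_wpM2r// ler_norm.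
by split; [exact: cvgP cv|exact: cvg_lim cv].
Unshelve. all: by end_near. Qed.

Context {n : nat}.
Local Notation RN := 'rV[R]_n.+1.
Local Notation N := (n.+1%:R : R).

(** One coordinate is changed at a time, each step being the mean value inequality along an axis, so
    partial derivatives suffice. The partial vectors [P k] keep the intermediate points within [|y|]
    of [x] in the sup norm. *)
Lemma taylor1 (f : RN -> R) (x c y : RN) (M : R) :
  (forall (z : RN) i, `|z - x| <= `|y| ->
    derivable f z 'e_i /\ `|'D_'e_i f z - c 0 i| <= M) ->
  `|f (x + y) - f x - dot c y| <= M * N * `|y|.
Proof.
move=> H.
have M0 : 0 <= M.
  have [|_] := H x ord0; first by rewrite subrr normr0.
  exact: le_trans.
pose P k : RN := \row_i (if (i < k)%N then y 0 i else 0).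
suff key k : (k <= n.+1)%N ->
    `|f (x + P k) - f x - dot c (P k)| <= M * k%:R * `|y|.
  have -> : y = P n.+1 by apply/rowP => i; rewrite mxE ltn_ord.
  have <- : `|y| = `|P n.+1| by congr `|_|; apply/rowP => i; rewrite mxE ltn_ord.
  exact: key.
elim: k => [_|k IH kn].
  have -> : P 0%N = 0 by apply/rowP => i; rewrite !mxE.
  rewrite addr0 subrr /dot big1 ?subrr ?normr0 ?mulr0 ?mul0r// => i _.
  by rewrite mxE mulr0.
pose i0 := Ordinal kn.
have PS : P k.+1 = P k + y 0 i0 *: 'e_i0.
  apply/rowP => i; rewrite !mxE eqxx /= ltnS leq_eqVlt.
  have -> : (nat_of_ord i == k) = (i == i0) by [].
  have [->|_] := eqVneq i i0; first by rewrite ltnn mulr1 add0r.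
  by rewrite mulr0 addr0.
pose g (s : R) := f (x + P k + s *: 'e_i0).
have : `|g (y 0 i0) - g 0 - c 0 i0 * (y 0 i0 - 0)| <= M * `|y 0 i0 - 0|.
  apply: (MVT_dist (g' := fun s => 'D_'e_i0 f (x + P k + s *: 'e_i0))) => s.
  rewrite !subr0 => sy.
  have [|dz zM] := H (x + P k + s *: 'e_i0) i0; last by split; [exact: derive_line|exact: zM].
  rewrite addrAC [x + P k]addrC addrK; apply: normr_row_le => // i; rewrite !mxE eqxx /=.
  have [->|ii0] := eqVneq i i0.
    by rewrite ltnn add0r mulr1 (le_trans sy)// normr_coord_le.
  by rewrite mulr0 addr0; case: ifP => _; rewrite ?normr0// normr_coord_le.
rewrite !subr0 /g scale0r addr0 -(addrA x) -PS => step.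
have dE : dot c (P k.+1) = dot c (P k) + c 0 i0 * y 0 i0.
  rewrite PS dotDr dotZr mulrC; congr (_ + _ * _).
  rewrite /dot (bigD1 i0)//= big1 ?addr0 => [|i ii0]; first by rewrite mxE !eqxx mulr1.
  by rewrite mxE eqxx (negbTE ii0) mulr0.
have -> : f (x + P k.+1) - f x - dot c (P k.+1) =
    (f (x + P k.+1) - f (x + P k) - c 0 i0 * y 0 i0) +
    (f (x + P k) - f x - dot c (P k)) by rewrite dE; ring.
apply: (le_trans (ler_normD _ _)).
rewrite -natr1 mulrDr mulr1 mulrDl addrC lerD//; first exact: (IH (ltnW kn)).
by apply: (le_trans step); rewrite ler_wpM2l// normr_coord_le.
Qed.

(* The Hessian is not known to be symmetric here, so the second order term is
   obtained along the ray from [x] to [x + y]. *)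
Lemma taylor2 (f : RN -> R) (x0 x y : RN) (B w r : R) :
  (forall (z : RN) i j, `|z - x0| < r ->
    [/\ derivable f z 'e_i, derivable ('D_'e_i f) z 'e_j & `|hess f z| <= B]) ->
  (forall z : RN, `|z - x0| < r -> `|hess f z - hess f x| <= w) ->
  `|x - x0| < r / 3 -> `|y| < r / 3 ->
  `|f (x + y) - f x - dot (grad f x) y - qform (hess f x) y / 2| <= w * N ^+ 2 * `|y| ^+ 2.
Proof.
move=> df dw xr yr.
have r0 : 0 < r by rewrite -(@pmulr_lgt0 _ 3^-1)// (le_lt_trans _ yr).
have in_r (z a : RN) (s : R) : `|s| <= 1 -> `|z - x0| < r / 3 * 2 -> `|a| <= `|s *: y| ->
    `|z + a - x0| < r.
  move=> s1 zr ay; rewrite addrAC (le_lt_trans (ler_normD _ _))//.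
  have -> : r = r / 3 * 2 + r / 3 by field.
  rewrite ltrD// (le_lt_trans ay)// normrZ (le_lt_trans _ yr)//.
  by rewrite ler_piMl.
have xs (s : R) : `|s| <= 1 -> `|x + s *: y - x0| < r / 3 * 2.
  move=> s1; rewrite addrAC (le_lt_trans (ler_normD _ _))//.
  have -> : r / 3 * 2 = r / 3 + r / 3 by field.
  by rewrite ltrD// (le_lt_trans _ yr)// normrZ ler_piMl.
have x2 : `|x - x0| < r / 3 * 2 by rewrite (lt_le_trans xr)// ler_peMr ?divr_ge0 ?(ltW r0)// ler1n.
have xx : `|x - x0| < r.
  by rewrite (lt_le_trans xr)// ler_pdivrMr// ler_peMr ?(ltW r0)// ler1n.
have hessE (z : RN) i j : hess f z i j = 'D_'e_j ('D_'e_i f) z by rewrite mxE.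
pose Q := qform (hess f x) y.
(* With the quadratic term subtracted, [psi'] stays within [w N^2 |y|^2] of its value at 0, and the
   mean value inequality concludes. The cruder constant with [B] in the next step only certifies
   that [psi'] is the derivative. *)
pose psi (s : R) := f (x + s *: y) - Q / 2 * s ^+ 2.
pose psi' (s : R) := dot (grad f (x + s *: y)) y - Q * s.
have B0 : 0 <= B.
  by have [_ _] := df x ord0 ord0 xx; apply: le_trans.
have step (s : R) : `|s| <= 1 -> is_derive s 1 psi (psi' s).
  move=> s1; apply: (@is_derive_quadratic _ s _ (B * N ^+ 2 * `|y| ^+ 2 + `|Q|) 1) => // h h1.
  have -> : psi (s + h) - psi s - psi' s * h =
      (f (x + s *: y + h *: y) - f (x + s *: y) - dot (grad f (x + s *: y)) (h *: y)) -
      Q / 2 * h ^+ 2.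
    by rewrite /psi /psi' dotZr scalerDl addrA; field.
  apply: (le_trans (ler_normB _ _)); rewrite mulrDl lerD//.
    apply: (@le_trans _ _ (B * N * `|h *: y| * N * `|h *: y|)); last first.
      rewrite normrZ -[h ^+ 2]real_normK ?num_real// le_eqVlt; apply/orP; left.
      by apply/eqP; ring.
    apply: taylor1 => z i zh.
    have zE (z' : RN) : `|z' - (x + s *: y)| <= `|z - (x + s *: y)| -> `|z' - x0| < r.
      move=> z'z; have := in_r (x + s *: y) (z' - (x + s *: y)) h (ltW h1) (xs s s1).
      by rewrite addrCA subrr addr0; apply; exact: le_trans zh.
    split; first by have [] := df z i ord0 (zE z (lexx _)).
    rewrite mxE; have := @taylor1 ('D_'e_i f) (x + s *: y) 0 (z - (x + s *: y)) B.
    rewrite (addrCA (x + s *: y)) subrr addr0 /dot big1 ?subr0 => [|j _]; last by rewrite mxE mul0r.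
    move=> H; apply: (le_trans (H _)) => [z' j z'z|].
      have [_ d2 hB] := df z' i j (zE z' z'z); split => //.
      by rewrite mxE subr0 -hessE (le_trans _ hB)// norm_entry_le.
    by rewrite ler_wpM2l// mulr_ge0.
  rewrite normrM [`|h ^+ 2|]ger0_norm ?sqr_ge0// ler_wpM2r ?sqr_ge0//.
  by rewrite normrM ler_piMr// gtr0_norm ?invf_le1 ?ler1n// invr_gt0.
have := @MVT_dist psi psi' 0 1 (dot (grad f x) y) (w * N ^+ 2 * `|y| ^+ 2).
rewrite !subr0 normr1 !mulr1 /psi scale1r scale0r addr0 expr0n expr1n /= mulr0 mulr1 subr0.
move=> H; have -> : f (x + y) - f x - dot (grad f x) y - Q / 2 =
  f (x + y) - Q / 2 - f x - dot (grad f x) y by ring.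
apply: H => s; rewrite subr0 => s1; split; first exact: step.
rewrite /psi' /Q /qform /dot mulr_suml -!sumrB (le_trans (ler_norm_sum _ _ _))//.
have -> : w * N ^+ 2 * `|y| ^+ 2 = \sum_(i < n.+1) w * N * `|y| * `|y|.
  by rewrite sumr_const card_ord -[RHS]mulr_natr; ring.
apply: ler_sum => i _; rewrite !mxE.
have := @taylor1 ('D_'e_i f) x (row i (hess f x)) (s *: y) w.
move=> H; have {H} := H _.
have -> : dot (row i (hess f x)) (s *: y) = \sum_j hess f x i j * y 0 j * s.
  by apply: eq_bigr => j _; rewrite !mxE; ring.
move=> H.
have -> : 'D_'e_i f (x + s *: y) * y 0 i -
    (\sum_j hess f x i j * (y 0 i * y 0 j)) * s - 'D_'e_i f x * y 0 i =
    ('D_'e_i f (x + s *: y) - 'D_'e_i f x - \sum_j hess f x i j * y 0 j * s) * y 0 i.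
  rewrite !mulrBl addrAC; congr (_ - _); rewrite !mulr_suml; apply: eq_bigr => j _; ring.
rewrite normrM ler_pM ?normr_coord_le//.
apply: (le_trans (H _)) => [z j zy|].
  have zr : `|z - x0| < r.
    by have := in_r x (z - x) s s1 x2 zy; rewrite addrCA subrr addr0.
  have [_ d2 _] := df z i j zr; split => //.
  rewrite !mxE -!hessE.
  apply: (le_trans _ (dw z zr)).
  have := norm_entry_le (hess f z - hess f x) i j.
  by rewrite mxE [X in `|_ + X|]mxE.
have w0 : 0 <= w by apply: le_trans (dw x xx).
by rewrite ler_wpM2l ?mulr_ge0// normrZ ler_piMl.
Qed.

End Taylor.

Lemma powR_small (R : realType) (a e : R) : 0 < a -> 0 < e ->
  exists2 d : R, 0 < d & forall s : R, 0 <= s <= d -> s `^ a <= e.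
Proof.
move=> a0 e0; exists (e `^ a^-1); first exact: powR_gt0.
move=> s /andP[s0 sd]; have := ge0_ler_powR (ltW a0) _ _ sd.
rewrite -powRrM mulVf ?gt_eqF// powRr1 ?(ltW e0)//; apply.
  by rewrite nnegrE.
by rewrite nnegrE powR_ge0.
Qed.

Lemma dist_le3 (R : realType) (s t t0 tau r : R) :
  `|tau - s| <= `|t - s| -> `|s - t0| < r -> `|t - t0| < r -> `|tau - t0| <= 3 * r.
Proof.
move=> h1 h2 h3; have := ler_distD s tau t0; have := ler_distD t0 t s.
by rewrite [`|t0 - s|]distrC; move: h1 h2 h3; lra.
Qed.

(** * Uniform expansions near an interior point of the cylinder *)

Section Regularity.
Context {R : realType} {n : nat}.
Local Notation RN := 'rV[R]_n.+1.
Local Notation N := (n.+1%:R : R).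

Lemma bounded_norm_le (x0 : RN) (r : R) : bounded_set [set x : RN | `|x - x0| <= r].
Proof.
exists (`|x0| + r); split => [|B rB x /= xr]; first exact: num_real.
rewrite -[x](subrK x0) (le_trans (ler_normD _ _))// addrC.
by apply: le_trans (ltW rB); rewrite lerD2l.
Qed.

(** All derivatives are controlled by the parabolic norm on one compact neighbourhood of the point.
    The equation turns the trace and gradient terms at [(x, t)] into [dt v x t], so the last bound
    is only the continuity of [dt v]. *)
Lemma pde_expansion (al T : R) (Om : set RN) (m v0 : RN -> R) (h0 v : RN -> R -> R)
    (x0 : RN) (t0 : R) :
  0 < al -> open Om -> classical_solution al T Om m h0 v0 v ->
  Om x0 -> 0 < t0 < T -> exists vt : R,
    forall w : R, 0 < w ->
    exists B r : R, 0 < r /\ forall (x : RN) (t : R), `|x - x0| < r -> `|t - t0| < r ->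
    [/\ Om x, 0 < t < T,
      forall s : R, `|s - t0| < r -> `|v x t - v x s - vt * (t - s)| <= w * `|t - s| &
      exists (gr : RN) (H : 'M[R]_n.+1), [/\ forall y : RN, `|y| < r ->
          `|v (x + y) t - v x t - dot gr y - qform H y / 2| <= w * sq y,
        `|gr| <= B, `|H| <= B &
        `|\tr H + m x * sq gr - vt| <= w]].
Proof.
move=> al0 oOm [_ [vd vB] pde _ _] Ox0 t0T; exists (dt v x0 t0) => w w0.
have [r0 [r00 rOm rT]] : exists r0 : R, [/\ 0 < r0,
    forall x : RN, `|x - x0| <= r0 -> Om x &
    forall t : R, `|t - t0| <= r0 -> 0 < t < T].
  have /nbhs_normP[a /= a0 aOm] := open_nbhs_nbhs (conj oOm Ox0).
  have /andP[t00 t0T'] := t0T.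
  exists (Num.min (a / 2) (Num.min (t0 / 2) ((T - t0) / 2))); split.
  - by rewrite !lt_min !divr_gt0 ?subr_gt0.
  - move=> x; rewrite le_min => /andP[xa _]; apply: aOm => /=; rewrite distrC.
    by rewrite (le_lt_trans xa)// ltr_pdivrMr// ltr_pMr// ltr1n.
  - move=> t; rewrite !le_min => /and3P[_ h1 h2].
    move: h1 h2; rewrite !ler_norml => /andP[h1 _] /andP[_ h2].
    by apply/andP; split; move: h1 h2 t00 t0T'; lra.
pose K : set (RN * R) := [set x : RN | `|x - x0| <= r0] `*` `[t0 - r0, t0 + r0].
have KE (x : RN) (t : R) : `|x - x0| <= r0 -> `|t - t0| <= r0 -> K (x, t).
  by move=> xr tr; split => //=; rewrite in_itv /= -ler_distl.
have KQ : K `<=` Om `*` `]0, T[.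
  move=> [x t] [/= xr]; rewrite in_itv /= -ler_distl => tr.
  by split => /=; [exact: rOm|rewrite in_itv /= rT].
have cK : compact K.
  apply: compact_setX; last exact: segment_compact.
  by apply: bounded_closed_compact; [exact: bounded_norm_le|exact: closed_dist_le].
have [M [M1 _ M2]] := vB K cK KQ.
have M0 : 0 <= M.
  have [] := M1 x0 t0 (KE _ _ _ _); rewrite ?subrr ?normr0 ?(ltW r00)//.
  by move=> h _ _ _; exact: le_trans h.
have N1 : 1 <= N ^+ 2 by rewrite exprn_ege1// ler1n.
have N0 : 0 < N ^+ 2 by rewrite (lt_le_trans ltr01).
(* [taylor2] loses a factor [N ^+ 2], which is compensated here. *)
pose w1 := w / N ^+ 2; have w10 : 0 < w1 by rewrite divr_gt0.
have w1w : w1 <= w by rewrite ler_pdivrMr// ler_peMr// ltW.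
have e0 : 0 < w1 / (2 * (M + 1)) by rewrite divr_gt0// mulr_gt0// ltr_wpDl.
have eE : M * (w1 / (2 * (M + 1)) + w1 / (2 * (M + 1))) <= w1.
  have -> : w1 / (2 * (M + 1)) + w1 / (2 * (M + 1)) = w1 / (M + 1).
    by field; rewrite gt_eqF// ltr_wpDl.
  by rewrite mulrCA ler_piMr ?(ltW w10)// ler_pdivrMr ?ltr_wpDl// mul1r lerDl.
have [d1 d10 D1] := powR_small al0 e0.
have al20 : 0 < al / 2 by rewrite divr_gt0.
have [d2 d20 D2] := powR_small al20 e0.
have [|r r_gt0 /= /and4P[/ltW r3 /ltW rd1 /ltW rd2 _]] :=
    @exists_lt_all R [:: r0 / 3; d1 / 6; d2 / 6]; first by rewrite /= !divr_gt0.
move: r3 rd1 rd2; rewrite !ler_pdivlMr// ![r * _]mulrC => r3 rd1 rd2.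
(* [6 r] generously covers every distance that occurs, in space and in time. *)
have small (a b : R) : 0 <= a <= 6 * r -> 0 <= b <= 6 * r ->
    M * (a `^ al + b `^ (al / 2)) <= w1.
  move=> /andP[a0 ar] /andP[b0 br]; apply: le_trans eE; rewrite ler_wpM2l// lerD//.
    by apply: D1; rewrite a0 (le_trans ar).
  by apply: D2; rewrite b0 (le_trans br).
have r_r0 : r <= r0 by move: r_gt0 r3; lra.
exists M, r; split => // x t xr tr.
have xr0 : `|x - x0| <= r0 by rewrite (le_trans (ltW xr)).
have tr0 : `|t - t0| <= r0 by rewrite (le_trans (ltW tr)).
have Kxt := KE x t xr0 tr0.
have [Mv Mg MH Mt] := M1 _ _ Kxt.
have K00 : K (x0, t0) by apply: KE; rewrite subrr normr0 ltW.
have r6 : r <= 6 * r by rewrite ler_peMl ?(ltW r_gt0)// ler1n.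
have xP : 0 <= `|x - x0| <= 6 * r by rewrite normr_ge0 /= (le_trans (ltW xr)).
split; [exact: rOm|exact: rT| |].
  move=> s sr; apply: (MVT_dist (g := v x) (g' := dt v x)) => tau taus.
  have taur : `|tau - t0| <= 3 * r.
    exact: dist_le3 taus sr tr.
  have taur0 : `|tau - t0| <= r0 by rewrite (le_trans taur).
  have [d _ _] := vd x tau (KQ _ (KE _ _ xr0 taur0)).
  split; first by apply: derivableP.
  have [_ h] := M2 _ _ _ _ (KE x tau xr0 taur0) K00.
  apply: (le_trans h); apply: le_trans w1w; apply: small => //.
  by rewrite normr_ge0 /= (le_trans taur)// ler_pM2r// ler_nat.
exists (grad (v^~ t) x), (hess (v^~ t) x); split => // [y yr|].
  have K3 (z : RN) : `|z - x0| < 3 * r -> K (z, t).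
    by move=> zr; apply: KE => //; apply: le_trans r3; exact: ltW.
  have r33 : 3 * r / 3 = r by field.
  apply: (@le_trans _ _ (w1 * N ^+ 2 * `|y| ^+ 2)); last first.
    by rewrite /w1 divfK ?gt_eqF// ler_wpM2l ?(ltW w0)// sqr_norm_le_sq.
  apply: (@taylor2 _ _ (v^~ t) x0 x y M w1 (3 * r)); last 2 first.
  - by rewrite r33.
  - by rewrite r33.
  - move=> z i j zr; have [_ dz1 dz2] := vd z t (KQ _ (K3 z zr)).
    by have [_ _ ? _] := M1 _ _ (K3 z zr); split.
  move=> z zr; have [h _] := M2 z t x t (K3 z zr) Kxt.
  apply: (le_trans h); apply: small; last first.
    by rewrite subrr normr0 lexx mulr_ge0// ltW.
  rewrite normr_ge0 /= -[z](subrK x0) -addrA (le_trans (ler_normD _ _))//.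
  by rewrite [`|x0 - x|]distrC; move: xr zr r_gt0; lra.
have -> : sq (grad (v^~ t) x) = enorm (grad (v^~ t) x) ^+ 2.
  rewrite /enorm sqr_sqrtr; last by apply: sumr_ge0 => i _; exact: sqr_ge0.
  by apply: eq_bigr => i _; rewrite expr2.
have [Oxt] := KQ _ Kxt; rewrite /= => tT.
rewrite -[\tr _]/(laplacian (v^~ t) x) -pde//.
have [_ h] := M2 _ _ _ _ Kxt K00.
apply: (le_trans h); apply: le_trans w1w; apply: small => //.
by rewrite normr_ge0 /= (le_trans (ltW tr)).
Qed.

End Regularity.

(** * Boundary geometry *)

Section Graph.
Context {R : realType}.

(** The mean value inequality is used twice along the segment: for [g], and for its derivative in
    direction [w], whose own derivative is bounded by the norm. *)
Lemma C2_holder_taylor (V : normedModType R) (al : R) (U : set V) (g : V -> R) :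
  C2_holder al U g -> exists2 M : R, 0 <= M & forall p w : V,
    (forall s : R, `|s| <= 1 -> U (p + s *: w)) ->
    `|g (p + w) - g p - 'd g p w| <= M * `|w| ^+ 2.
Proof.
move=> [dg ddg [M HM]]; exists (Num.max 0 M); first by rewrite le_max lexx.
move=> p w Uw; have MM : M <= Num.max 0 M by rewrite le_max lexx orbT.
set M' := Num.max 0 M in MM *.
have M0 : 0 <= M' by rewrite le_max lexx.
have Up : U p by have := Uw 0; rewrite scale0r addr0; apply; rewrite normr0 ler01.
have := @MVT_dist R (fun s => g (p + s *: w)) (fun s => 'd g (p + s *: w) w) 0 1
  ('d g p w) (M' * `|w| ^+ 2).
rewrite !subr0 normr1 !mulr1 scale1r scale0r addr0; apply=> s; rewrite subr0 => s1.
have Ut (t : R) : 0 <= t <= 1 -> U (p + t *: (s *: w)).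
  move=> /andP[t0 t1]; rewrite scalerA; apply: Uw.
  by rewrite normrM mulr_ile1// ger0_norm.
have ds := dg _ (Uw s s1); split.
  by rewrite -deriveE//; apply: derive_line; exact: diff_derivable.
have der (t : R) : 0 <= t <= 1 -> derivable (fun z => 'd g z w) (p + t *: (s *: w)) (s *: w).
  by move=> t01; apply: diff_derivable; apply: ddg; exact: Ut.
have := @segment_lipschitz R V (fun z => 'd g z w) p (s *: w) (M' * `|w| ^+ 2); apply.
  move=> t /andP[/ltW t0 /ltW t1]; have t01 : 0 <= t <= 1 by rewrite t0.
  split; first exact: der.
  rewrite deriveE; last by apply: ddg; exact: Ut.
  have [_ _ + _] := HM _ _ w (s *: w) (Ut t t01) (Ut t t01); move=> /le_trans; apply.
  apply: (@le_trans _ _ (M' * `|w| * `|s *: w|)); first by rewrite !ler_wpM2r.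
  by rewrite expr2 mulrA ler_wpM2l ?mulr_ge0// normrZ ler_piMl.
apply: derivable_within_continuous => t; rewrite in_itv /= => t01.
by have [] := derive_line (der t t01).
Qed.

Context {n : nat}.
Local Notation RN := 'rV[R]_n.+1.

Lemma norm_col'_le (i : 'I_n.+1) (x : RN) : `|col' i x| <= `|x|.
Proof.
rewrite [`|col' i x|]/Num.norm/= mx_normrE.
apply/bigmax_leP; split => // -[k j] _ /=.
by rewrite mxE ord1 normr_coord_le.
Qed.

Lemma norm_col'B_le (i : 'I_n.+1) (x y : RN) : `|col' i x - col' i y| <= `|x - y|.
Proof. by rewrite -linearB norm_col'_le. Qed.

(** * A single boundary chart *)

Section Chart.
Context (Om : set RN) (x0 : RN) (i : 'I_n.+1) (b : bool) (r : R) (g : 'rV[R]_n -> R).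
Hypothesis gc : forall y : 'rV[R]_n, `|y - col' i x0| < r ->
  forall e : R, 0 < e -> exists2 d : R, 0 < d & forall z, `|z - y| < d -> `|g z - g y| < e.
Hypothesis chart : forall x : RN, `|x - x0| < r ->
  (Om x <-> 0 < (-1) ^+ b * (x 0 i - g (col' i x))).
Local Notation height x := ((-1) ^+ b * (x 0 i - g (col' i x))).

Let col_near (x : RN) : `|x - x0| < r -> `|col' i x - col' i x0| < r.
Proof. by apply: le_lt_trans; exact: norm_col'B_le. Qed.

Lemma chart_closure (x : RN) : closure Om x -> `|x - x0| < r -> 0 <= height x.
Proof.
move=> clx xr; rewrite leNgt; apply/negP => hx.
have e0 : 0 < - height x / 2 by rewrite divr_gt0// oppr_gt0.
have [d d0 Hd] := gc (col_near xr) e0.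
have q0 : 0 < Num.min (Num.min d (- height x / 2)) (r - `|x - x0|).
  by rewrite !lt_min d0 e0 subr_gt0.
have [y [Oy /= yx]] := clx _ (nbhs_dist_lt x q0).
move: yx; rewrite !lt_min => /andP[/andP[yd ye] yr].
have yr' : `|y - x0| < r.
  rewrite -[y](subrK x) -addrA (le_lt_trans (ler_normD _ _))//.
  by rewrite -ltrBrDr.
have := (chart yr').1 Oy.
have gd : `|g (col' i y) - g (col' i x)| < - height x / 2.
  by apply: Hd; exact: le_lt_trans (norm_col'B_le _ _ _) _.
have yi : `|y 0 i - x 0 i| < - height x / 2.
  by have := normr_coord_le (y - x) i; rewrite !mxE => /le_lt_trans; apply.
have -> : height y = height x + (-1) ^+ b * (y 0 i - x 0 i)
    - (-1) ^+ b * (g (col' i y) - g (col' i x)) by ring.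
have h1 : (-1) ^+ b * (y 0 i - x 0 i) <= `|y 0 i - x 0 i|.
  by rewrite -[leRHS](normrMsign b) ler_norm.
have h2 : - ((-1) ^+ b * (g (col' i y) - g (col' i x))) <= `|g (col' i y) - g (col' i x)|.
  by rewrite -[leRHS](normrMsign b) -normrN ler_norm.
move: h1 h2 gd yi; lra.
Qed.

(** A point of the graph is moved by a small [tau] along axis [i], to the side given by the sign;
    the other coordinates do not change, so the height becomes [tau] and the moved point is in the
    domain. *)
Lemma chart_graph_closure (x : RN) : `|x - x0| < r -> height x = 0 -> closure Om x.
Proof.
move=> xr hx B /nbhs_normP[e /= e0 eB].
pose tau := Num.min (e / 2) ((r - `|x - x0|) / 2).
have tau0 : 0 < tau by rewrite lt_min !divr_gt0// subr_gt0.
pose y : RN := x + ((-1) ^+ b * tau) *: 'e_i.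
have yx : `|y - x| <= tau.
  rewrite addrAC subrr add0r normrZ normrMsign gtr0_norm// ler_piMr ?(ltW tau0)//.
  by apply: normr_row_le => // j; rewrite mxE; case: (_ && _); rewrite ?normr1 ?normr0.
have cy : col' i y = col' i x.
  by apply/rowP => j; rewrite !mxE eqxx /= eq_sym (negbTE (neq_lift _ _)) mulr0 addr0.
exists y; split.
  apply/chart; last first.
    rewrite cy !mxE !eqxx mulr1 addrAC mulrDr hx add0r mulrA -expr2 sqrr_sign mul1r//.
  rewrite -[y](subrK x) -addrA (le_lt_trans (ler_normD _ _))// -ltrBrDr (le_lt_trans yx)//.
  by rewrite gt_min [(r - _) / 2 < _]ltr_pdivrMr// ltr_pMr ?subr_gt0// ltr1n orbT.
apply: eB => /=; rewrite distrC (le_lt_trans yx)//.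
by rewrite gt_min ltr_pdivrMr// ltr_pMr// ltr1n.
Qed.

Lemma chart_boundary : 0 < r -> closure Om x0 -> ~ Om x0 -> x0 0 i = g (col' i x0).
Proof.
move=> r0 clx0 nOx0; have x0r : `|x0 - x0| < r by rewrite subrr normr0.
have h1 := chart_closure clx0 x0r.
have h2 : height x0 <= 0 by rewrite leNgt; apply/negP => /(chart x0r).2.
apply/eqP; rewrite -subr_eq0; have /eqP : height x0 = 0 by apply/eqP; rewrite eq_le h2.
by rewrite mulf_eq0 signr_eq0.
Qed.

(** The vertical projection onto the graph. Unlike a nearest point it is explicit, and the segment
    to [y] keeps the same base point, so the height does not change sign along it. *)
Definition foot (y : RN) : RN := \row_k (if k == i then g (col' i y) else y 0 k).

Lemma col'_foot (y : RN) : col' i (foot y) = col' i y.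
Proof. by apply/rowP => j; rewrite !mxE eq_sym (negbTE (neq_lift _ _)). Qed.

Lemma foot_i (y : RN) : foot y 0 i = g (col' i y).
Proof. by rewrite mxE eqxx. Qed.

Lemma foot_height (y : RN) : height (foot y) = 0.
Proof. by rewrite foot_i col'_foot subrr mulr0. Qed.

Lemma foot_norm (y p : RN) (d : R) : `|y - p| <= d -> `|g (col' i y) - p 0 i| <= d ->
  `|foot y - p| <= d.
Proof.
move=> yp gp; apply: normr_row_le => [|k]; first exact: le_trans yp.
rewrite !mxE; case: eqP => [->//|_].
by have := normr_coord_le (y - p) k; rewrite !mxE => /le_trans; apply.
Qed.

Lemma foot_segment (y : RN) (s : R) : height y < 0 -> 0 < s ->
  col' i (foot y + s *: (y - foot y)) = col' i y /\
  height (foot y + s *: (y - foot y)) < 0.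
Proof.
move=> hy s0.
have cE : col' i (foot y + s *: (y - foot y)) = col' i y.
  by rewrite linearD linearZ linearB /= col'_foot subrr scaler0 addr0.
split=> //; rewrite cE.
have -> : (foot y + s *: (y - foot y)) 0 i - g (col' i y) = s * (y 0 i - g (col' i y)).
  by rewrite !mxE eqxx; ring.
by rewrite mulrCA pmulr_rlt0.
Qed.

End Chart.
End Graph.

(** * Exterior spheres and a fixed exterior collar *)

Section Domain.
Context {R : realType} {n : nat}.
Local Notation RN := 'rV[R]_n.+1.
Local Notation N := (n.+1%:R : R).

Lemma C2_holder_chart (al : R) (Om : set RN) (x0 : RN) :
  C2_holder_domain al Om -> closure Om x0 -> ~ Om x0 ->
  exists (i : 'I_n.+1) (b : bool) (r : R) (g : 'rV[R]_n -> R),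
  [/\ 0 < r, C2_holder al [set y : 'rV[R]_n | `|y - col' i x0| < r] g,
    forall y : 'rV[R]_n, `|y - col' i x0| < r ->
      forall e : R, 0 < e -> exists2 d : R, 0 < d & forall z, `|z - y| < d -> `|g z - g y| < e &
    forall x : RN, `|x - x0| < r ->
      (Om x <-> 0 < (-1) ^+ b * (x 0 i - g (col' i x)))].
Proof.
move=> [_ _ _ _ H] clx0 nOx0.
have [i [b [r [g [r0 gC chart]]]]] := H x0 (conj clx0 nOx0).
have ballE : (ball (col' i x0 : 'rV[R]_n) r : set 'rV[R]_n) = [set y : 'rV[R]_n | `|y - col' i x0| < r].
  by apply/seteqP; split => y /=; rewrite -ball_normE /= distrC.
rewrite ballE in gC.
exists i, b, r, g; split => // [y yr e e0|x xr].
  have [dg _ _] := gC; have := differentiable_continuous (dg y yr).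
  move=> /cvgrPdist_lt/(_ e e0)/nbhs_normP[d /= d0 dH]; exists d => // z zy.
  by rewrite distrC; apply: dH => /=; rewrite distrC.
by apply: chart; rewrite -ball_normE /= distrC.
Qed.

(** The height over the graph is nonnegative on the closure and vanishes at [x0]. Its linear part
    there is [dot l], and the second order remainder of [g] is absorbed by the quadratic term. *)
Lemma exterior_sphere (al : R) (Om : set RN) (x0 : RN) :
  C2_holder_domain al Om -> closure Om x0 -> ~ Om x0 ->
  exists (l : RN) (M r : R),
    [/\ l != 0, 0 <= M, 0 < r & forall x, closure Om x -> `|x - x0| < r ->
      - M * sq (x - x0) <= dot l (x - x0)].
Proof.
move=> hOm clx0 nOx0.
have [i [b [r [g [r0 gC gc chart]]]]] := C2_holder_chart hOm clx0 nOx0.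
have [M M0 HM] := C2_holder_taylor gC.
have [dg _ _] := gC.
have g0 := chart_boundary gc chart r0 clx0 nOx0.
pose y0 : 'rV[R]_n := col' i x0.
have dgZ (c : R) (w : 'rV[R]_n) : 'd g y0 (c *: w) = c * 'd g y0 w by rewrite linearZ.
(* The gradient of the height at [x0]; its entry at [i] is a sign, hence nonzero. *)
pose l : RN := \row_k (if unlift i k is Some j then - ((-1) ^+ b * 'd g y0 'e_j) else (-1) ^+ b).
have lE z : dot l z = (-1) ^+ b * (z 0 i - 'd g y0 (col' i z)).
  rewrite /dot (bigD1_ord i)//= mxE unlift_none mulrBr; congr (_ + _).
  rewrite [in RHS](row_sum_delta (col' i z)) linear_sum mulr_sumr -sumrN.
  by apply: eq_bigr => j _; rewrite mxE liftK dgZ !mxE; ring.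
exists l, M, r; split => //.
  apply/eqP => /rowP/(_ i); rewrite !mxE unlift_none => /eqP.
  by rewrite signr_eq0.
move=> x clx xr; have hx := chart_closure gc chart clx xr.
have y0E s : y0 + s *: (col' i x - y0) - y0 = s *: (col' i x - y0).
  by rewrite addrAC subrr add0r.
have := HM y0 (col' i x - y0).
have -> : y0 + (col' i x - y0) = col' i x by rewrite addrCA subrr addr0.
move=> {}HM; have {}HM : `|g (col' i x) - g y0 - 'd g y0 (col' i x - y0)| <= M * sq (x - x0).
  apply: (le_trans (HM _)) => [s s1 /=|].
    rewrite y0E normrZ (le_lt_trans _ xr)//.
    by apply: (le_trans _ (norm_col'B_le i x x0)); rewrite ler_piMl.
  rewrite ler_wpM2l//; apply: (le_trans _ (sqr_norm_le_sq _)).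
  by rewrite ler_pXn2r ?nnegrE// norm_col'B_le.
rewrite lE.
have -> : (-1) ^+ b * ((x - x0) 0 i - 'd g y0 (col' i (x - x0))) =
    (-1) ^+ b * (x 0 i - g (col' i x)) +
    (-1) ^+ b * (g (col' i x) - g y0 - 'd g y0 (col' i x - y0)).
  by rewrite linearB /= !mxE [x0 0 i]g0 -/y0; ring.
have : - (M * sq (x - x0)) <= (-1) ^+ b * (g (col' i x) - g y0 - 'd g y0 (col' i x - y0)).
  move: HM; rewrite -(normrMsign b) ler_norml => /andP[+ _].
  by rewrite -signr_odd oddb.
rewrite mulNr; move: hx; lra.
Qed.

(** The defect is a square in each coordinate. It shows that no point is close to both of two
    distinct points. *)
Lemma sq_parallelogram_le (p a b : RN) : sq (a - b) <= 2 * sq (p - a) + 2 * sq (p - b).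
Proof.
rewrite /sq /dot !mulr_sumr -big_split /=; apply: ler_sum => k _; rewrite !mxE.
have : 0 <= (p 0 k - a 0 k + (p 0 k - b 0 k)) ^+ 2 by exact: sqr_ge0.
lra.
Qed.

Lemma connected_sq_value (Om : set RN) (p a b : RN) (c : R) : connected Om ->
  Om a -> Om b -> sq (p - a) <= c -> c <= sq (p - b) ->
  exists2 x, Om x & sq (p - x) = c.
Proof.
move=> cOm Oa Ob ac cb.
have sqC z : sq (p - z) = sq (z - p).
  by rewrite /sq /dot; apply: eq_bigr => k _; rewrite !mxE; ring.
have cI : connected ((fun x : RN => sq (x - p)) @` Om).
  apply: connected_continuous_connected => //.
  by apply: continuous_subspaceT; exact: continuous_sq.
have /connected_intervalP I := cI.
have [x Ox xc] : ((fun x : RN => sq (x - p)) @` Om) c.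
  apply: (I (sq (a - p)) (sq (b - p))); [by exists a|by exists b|].
  by rewrite -!sqC ac.
by exists x; rewrite // sqC.
Qed.

Lemma enorm_sq (z : RN) : enorm z = Num.sqrt (sq z).
Proof. by congr Num.sqrt; apply: eq_bigr => i _; rewrite expr2. Qed.

(* The radial kernel is nonzero on a whole sphere; a connected open set meets the
   sphere of that radius, rescaled by a small fixed [e0], about each point near
   its closure. So the exterior data are controlled by their [C^{1+al}] norm at
   the single scale [e0]. *)
Lemma OmJ_nbhs_closure (J : RN -> R) (Om : set RN) :
  kernel_assumptions J -> open Om -> connected Om -> Om !=set0 ->
  exists e0 d : R, [/\ 0 < e0, 0 < d &
    forall x y : RN, closure Om x -> `|y - x| < d -> OmJ J e0 Om y].
Proof.
move=> hJ oOm cOm [a Oa]; have [z1 [Jz1 z1N]] := kernel_neq0 hJ.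
have q0 : 0 < sq z1.
  apply: (lt_le_trans _ (sqr_norm_le_sq _)); rewrite exprn_gt0// normr_gt0.
  by apply: contraNneq z1N => ->; rewrite mxE.
have [b Ob ab] : exists2 b, Om b & b != a.
  have /nbhs_normP[r /= r0 rOm] := open_nbhs_nbhs (conj oOm Oa).
  pose v : RN := (r / 2) *: 'e_ord0.
  have v0 : v 0 ord0 = r / 2 by rewrite !mxE !eqxx mulr1.
  exists (a + v).
    apply: rOm => /=; rewrite opprD addNKr normrN normrZ gtr0_norm ?divr_gt0//.
    apply: (@le_lt_trans _ _ (r / 2)); last by rewrite ltr_pdivrMr// ltr_pMr// ltr1n.
    rewrite ler_piMr ?divr_ge0 ?(ltW r0)//.
    by apply: normr_row_le => // j; rewrite mxE; case: (_ && _); rewrite ?normr1 ?normr0.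
  rewrite -subr_eq0 addrAC subrr add0r; apply/eqP => /rowP/(_ ord0).
  by rewrite v0 mxE => /eqP; rewrite mulf_eq0 invr_eq0 pnatr_eq0 orbF gt_eqF.
have D0 : 0 < sq (b - a).
  by apply: (lt_le_trans _ (sqr_norm_le_sq _)); rewrite exprn_gt0// normr_gt0 subr_eq0.
(* Every [y] has squared distance at least [c] from [a] or from [b], so the domain reaches the
   sphere of radius [sqrt c] about [y] from outside. [e0] scales [z1] to that length, and [d]
   ensures that some point of the domain lies inside the sphere. *)
pose c := sq (b - a) / 4; have c0 : 0 < c by rewrite divr_gt0.
pose e0 := Num.sqrt (c / sq z1); have e00 : 0 < e0 by rewrite sqrtr_gt0 divr_gt0.
have N0 : 0 < N by rewrite ltr0n.
pose d := Num.sqrt (c / N) / 2; have d0 : 0 < d by rewrite divr_gt0// sqrtr_gt0 divr_gt0.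
exists e0, d; split => // x y clx yx.
have [x' [Ox' /= x'x]] := clx _ (nbhs_dist_lt x d0).
have near_x' : sq (y - x') <= c.
  apply: (le_trans (sq_le_norm _)); rewrite -ler_pdivlMl// mulrC.
  have yx' : `|y - x'| <= Num.sqrt (c / N).
    rewrite -[y](subrK x) -addrA (le_trans (ler_normD _ _))//.
    have -> : Num.sqrt (c / N) = d + d by rewrite /d; field.
    by rewrite lerD ?(ltW yx)// distrC ltW.
  rewrite -[leRHS]sqr_sqrtr; last by rewrite divr_ge0// ltW.
  by rewrite ler_pXn2r ?nnegrE ?sqrtr_ge0.
have [w Ow far] : exists2 w, Om w & c <= sq (y - w).
  have [ya|ya] := leP c (sq (y - a)); first by exists a.
  exists b => //; have := sq_parallelogram_le y b a; rewrite /c in ya *.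
  by move: ya; lra.
have [x1 Ox1 x1c] := connected_sq_value cOm Ox' Ow near_x' far.
have -> : y = x1 + e0 *: (e0^-1 *: (y - x1)).
  by rewrite scalerA mulfV ?gt_eqF// scale1r addrCA subrr addr0.
apply: reach_OmJ => //; first exact: subset_closure.
have [_ Jr _ _ _] := hJ; rewrite (Jr _ z1)// !enorm_sq; congr Num.sqrt.
rewrite sqZ x1c exprVn /e0 sqr_sqrtr; last by rewrite divr_ge0// ltW.
by field; rewrite !gt_eqF.
Qed.

End Domain.

(** * The reaction near zero, and the conclusion *)

Section ReactionAtZero.
Context {R : realType} (a1 a2 : R) (g : R -> R).
Hypothesis cg : continuous g.
Hypothesis slopes : forall s s' : R, s != s' ->
  a1 <= (g s * s - g s' * s') / (s - s') <= a2.

(** Away from 0 this is the slope bound against [s' = 0]; the value at 0 follows by continuity. *)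
Lemma reaction_range (s : R) : a1 <= g s <= a2.
Proof.
have H (t : R) : t != 0 -> a1 <= g t <= a2.
  by move=> t0; have := slopes t0; rewrite mulr0 !subr0 mulfK.
have [->|/H//] := eqVneq s 0.
have close (e : R) : 0 < e -> exists2 t : R, t != 0 & `|g 0 - g t| < e.
  move=> e0; have /cvgrPdist_lt/(_ e e0)/nbhs_normP[d /= d0 dH] := @cg 0.
  exists (d / 2); first by rewrite gt_eqF// divr_gt0.
  by apply: dH => /=; rewrite sub0r normrN gtr0_norm ?divr_gt0// ltr_pdivrMr// ltr_pMr// ltr1n.
apply/andP; split; rewrite leNgt; apply/negP => h.
  have [|t /H /andP[t1 _]] := close (a1 - g 0); first by rewrite subr_gt0.
  by rewrite ltr_norml; move: t1; lra.
have [|t /H /andP[_ t2]] := close (g 0 - a2); first by rewrite subr_gt0.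
by rewrite ltr_norml; move: t2; lra.
Qed.

Lemma reaction_taylor (k al w s0 : R) : (forall s, derivable g s 1) ->
  (forall s s', `|s| <= 1 -> `|s'| <= 1 -> `|'D_1 g s - 'D_1 g s'| <= k * `|s - s'| `^ al) ->
  (forall s, 0 <= s <= s0 -> `|k| * s `^ al <= w) -> s0 <= 1 ->
  forall s, `|s| <= s0 -> `|g s * s - g 0 * s - 'D_1 g 0 * s ^+ 2| <= w * s ^+ 2.
Proof.
move=> dg hg small s01 s ss0.
have : `|g s - g 0 - 'D_1 g 0 * (s - 0)| <= w * `|s - 0|.
  apply: (MVT_dist (g' := fun t => 'D_1 g t)) => t; rewrite !subr0 => ts.
  split; first exact: derivableP.
  have ts0 := le_trans ts ss0.
  have t1 := le_trans ts0 s01.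
  apply: (le_trans (hg t 0 t1 _)); first by rewrite normr0.
  rewrite subr0; apply: (@le_trans _ _ (`|k| * `|t| `^ al)).
    by rewrite ler_wpM2r ?powR_ge0// ler_norm.
  by apply: small; rewrite normr_ge0.
rewrite subr0 => h.
have -> : g s * s - g 0 * s - 'D_1 g 0 * s ^+ 2 = (g s - g 0 - 'D_1 g 0 * s) * s by ring.
rewrite normrM -[s ^+ 2]real_normK ?num_real// expr2 mulrA.
by rewrite ler_wpM2r.
Qed.

End ReactionAtZero.

Lemma norm_leN (R : realType) (a b c : R) : b = - a -> `|a| <= c -> `|b| <= c.
Proof. by move=> ->; rewrite normrN. Qed.

(** * Symmetry under a change of sign *)

Section Negation.
Context {R : realType} {n : nat}.
Local Notation RN := 'rV[R]_n.+1.

(** The reflected reaction [- K x (- s)] keeps the slope bounds and the first Taylor coefficient and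
    reverses the second, hence also [m]. The two one-sided forms of the nonlocal equation change
    places. *)
Lemma setup_neg (J : RN -> R) (T a1 a2 : R) (Om good : set RN)
    (C G0 G1 m : RN -> R) (K : RN -> R -> R) (u : R -> RN -> R -> R)
    (v : RN -> R -> R) :
  setup J T a1 a2 Om good C G0 G1 m K u v ->
  setup J T a1 a2 Om good C G0 (fun x => - G1 x) (fun x => - m x)
    (fun x s => - K x (- s)) (fun eps x t => - u eps x t) (fun x t => - v x t).
Proof.
move=> S.
have opp_cont (V : normedModType R) (A : set V) (f f' : V -> R) : (forall x, f' x = - f x) ->
    {within A, continuous f} -> {within A, continuous f'}.
  move=> ff' /within_continuousP cf; apply/within_continuousP => x Ax e e0.
  have [d d0 dH] := cf x Ax e e0; exists d => // y Ay yx.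
  by rewrite !ff' -opprD normrN; exact: dH.
have hJ := setup_J S.
have opp_bdd b : kernel_bdd J b -> kernel_bdd J (fun z => -1 * b z).
  by move=> bb; exact: kernel_bddZ.
constructor; try by case: S.
- by move=> x gx; rewrite oppr0 (setup_K0 S gx) oppr0.
- move=> x s s' gx ss'.
  have nss : - s <= - s' by rewrite lerN2.
  have := setup_slope S gx nss.
  by rewrite !opprK [- s' + s]addrC [- K x (- s) + _]addrC.
- move=> w w0; have [s0 s00 H] := setup_taylor S w0; exists s0 => // x s gx ss0.
  have := H x (- s) gx; rewrite normrN sqrrN => /(_ ss0).
  by apply: norm_leN; ring.
- by have [b Hb] := setup_G1 S; exists b => x gx; rewrite normrN; exact: Hb.
- by move=> x gx; rewrite mulrN mulNr (setup_mu S gx).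
- by move=> eps eps0; apply: opp_cont (setup_cont S eps0) => -[].
- by move=> eps x eps0 clx; rewrite (setup_init S eps0 clx).
- move=> eps x s t c eps0 gx s0 st tT H.
  have : - c * (t - s) <= u eps x t - u eps x s.
    apply: (setup_ge S) => // tau /H[b [bb Kb Eb]].
    exists (fun z => -1 * b z); split; first exact: opp_bdd.
      move=> z Jz; rewrite mulN1r lerNl.
      by have := Kb z Jz; rewrite opprB opprK addrC.
    by rewrite EvZ// mulN1r mulrN lerN2.
  by rewrite mulNr lerNl opprB opprK [- _ + _]addrC.
- move=> eps x s t c eps0 gx s0 st tT H.
  have : u eps x t - u eps x s <= - c * (t - s).
    apply: (setup_le S) => // tau /H[b [bb Kb Eb]].
    exists (fun z => -1 * b z); split; first exact: opp_bdd.
      move=> z Jz; rewrite mulN1r lerNr.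
      by have := Kb z Jz; rewrite opprB opprK addrC.
    by rewrite EvZ// mulN1r mulrN lerN2.
  by rewrite mulNr lerNr opprB opprK [- _ + _]addrC.
- have [e1 [M [e10 H]]] := setup_ext S; exists e1, M; split => // *.
  by rewrite normrN; exact: H.
- move=> x0 t0 w clx0 nOx0 t0T w0; have [r r0 H] := setup_bdry S clx0 nOx0 t0T w0.
  by exists r => // *; rewrite -opprD normrN; exact: H.
- by apply: opp_cont (setup_vcont S) => -[].
- move=> x0 t0 Ox0 t0T; have [vt Hvt] := setup_pde S Ox0 t0T; exists (- vt) => w w0.
  have [B [r [r0 H]]] := Hvt w w0; exists B, r; split => // x t xr tr.
  have [Ox tT Ht [gr [Hs [Hy grB HB Hpde]]]] := H x t xr tr; split => //.
    move=> s sr; by apply: norm_leN (Ht s sr); ring.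
  exists (- gr), (- Hs); split; rewrite ?normrN//.
    move=> y yr; apply: norm_leN (Hy y yr).
    rewrite -(scaleN1r gr) dotZl -(scaleN1r Hs).
    have -> : qform (-1 *: Hs) y = - qform Hs y.
      rewrite /qform -sumrN; apply: eq_bigr => i _; rewrite -sumrN.
      by apply: eq_bigr => j _; rewrite !mxE; ring.
    by field.
  rewrite raddfN /= -[- gr]scaleN1r sqZ sqrrN expr1n mul1r.
  by apply: norm_leN Hpde; ring.
Qed.

End Negation.

Lemma segment_dist_lt (R : realType) (V : normedModType R) (p y x0 : V) (r s : R) :
  `|p - x0| < r -> `|y - x0| < r -> 0 <= s <= 1 -> `|p + s *: (y - p) - x0| < r.
Proof.
move=> pr yr /andP[s0 s1].
have -> : p + s *: (y - p) - x0 = (1 - s) *: (p - x0) + s *: (y - x0).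
  rewrite scalerBl scale1r -[RHS]addrA [- _ + _]addrC -scalerBr opprB addrA subrK.
  by rewrite addrAC.
apply: (le_lt_trans (ler_normD _ _)); rewrite !normrZ !ger0_norm ?subr_ge0//.
move: s0; rewrite le_eqVlt => /predU1P[<-|s0]; first by rewrite subr0 mul1r mul0r addr0.
have -> : r = (1 - s) * r + s * r by ring.
by apply: ler_ltD; [rewrite ler_wpM2l ?subr_ge0// ltW|rewrite ltr_pM2l].
Qed.

(** Connects an exterior point to a boundary point by a segment outside the closure, along which the
    exterior data can be integrated. *)
Lemma boundary_foot (R : realType) (n : nat) (al : R) (Om : set 'rV[R]_n.+1)
    (x0 : 'rV[R]_n.+1) (r1 : R) :
  C2_holder_domain al Om -> closure Om x0 -> ~ Om x0 -> 0 < r1 ->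
  exists2 q : R, 0 < q & forall y : 'rV[R]_n.+1, `|y - x0| < q -> ~ closure Om y ->
    exists p : 'rV[R]_n.+1, [/\ `|p - x0| <= r1, closure Om p, ~ Om p &
      forall s : R, 0 < s <= 1 -> ~ closure Om (p + s *: (y - p))].
Proof.
move=> hOm clx0 nOx0 r10.
have [i [b [r [g [r0 _ gc chart]]]]] := C2_holder_chart hOm clx0 nOx0.
have g0 := chart_boundary gc chart r0 clx0 nOx0.
have [|r2 r20 /= /and3P[r2r /ltW r2r1 _]] := @exists_lt_all R [:: r; r1].
  by rewrite /= r0 r10.
have x0r : `|col' i x0 - col' i x0| < r by rewrite subrr normr0.
have [q1 q10 Hq1] := gc (col' i x0) x0r r2 r20.
exists (Num.min r2 q1) => [|y]; first by rewrite lt_min r20.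
rewrite lt_min => /andP[yr2 yq1] ncl.
have fr : `|foot i g y - x0| <= r2.
  apply: foot_norm; first exact: ltW.
  by rewrite g0 ltW// Hq1// (le_lt_trans (norm_col'B_le _ _ _)).
have fr' := le_lt_trans fr r2r.
have yr := lt_trans yr2 r2r.
have hy : (-1) ^+ b * (y 0 i - g (col' i y)) < 0.
  rewrite lt_neqAle leNgt; apply/andP; split.
    by apply/eqP => /(chart_graph_closure chart yr).
  by apply/negP => /(chart _ yr) Oy; apply: ncl; exact: subset_closure.
exists (foot i g y); split.
- exact: le_trans fr r2r1.
- by apply: (chart_graph_closure chart fr'); exact: foot_height.
- by move=> /(chart _ fr'); rewrite foot_height ltxx.
move=> s /andP[s0 s1] cls; have [_ hs] := foot_segment hy s0.
have := chart_closure gc chart cls (segment_dist_lt fr' yr _).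
by rewrite (ltW s0) s1 leNgt hs => /(_ isT).
Qed.

Lemma Linfty_norm_le (R : realType) (n : nat) (A : set 'rV[R]_n.+1)
    (f : 'rV[R]_n.+1 -> R) (w : R) : 0 <= w -> (forall x, A x -> `|f x| <= w) ->
  (Linfty_norm A f <= w%:E)%E.
Proof.
move=> w0 fw; rewrite /Linfty_norm unlock; case: ifP => _; last by rewrite lee_fin.
apply: ess_sup_ler => x /=; rewrite lee_fin patchE.
by case: ifPn => [/set_mem/fw//|_]; rewrite normr0.
Qed.

Lemma remainder_bound (R : realType) (p q d m e : R) :
  `|p - q - d| <= e -> p <= m -> q <= m -> 0 <= p -> 0 <= q -> `|d| <= m *+ 2 + e.
Proof.
rewrite !ler_norml => /andP[h1 h2] h3 h4 h5 h6.
by apply/andP; split; move: h1 h2 h3 h4 h5 h6; lra.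
Qed.

(** * From the hypotheses to the abstract setting *)

Section Main.
Context {R : realType} {n : nat}.
Local Notation RN := 'rV[R]_n.+1.
Context (al T : R) (Om : set RN) (J : RN -> R) (G : RN -> R -> R)
    (C mu v0 : RN -> R) (h0 h v : RN -> R -> R) (u : R -> RN -> R -> R).
Hypotheses (hal : 0 < al < 1) (hT : 0 < T) (hOm : C2_holder_domain al Om)
    (hJ : kernel_assumptions J).
Local Notation cl := (closure Om).

(** Collects the almost-everywhere hypotheses, with common constants. The bound on the derivative is
    kept for [|s| <= 1] only, enough for an expansion at 0. *)
Definition good_set (a1 a2 k : R) : set RN := [set x | [/\ Om x, continuous (G x),
  forall s s' : R, s != s' -> a1 <= (G x s * s - G x s' * s') / (s - s') <= a2,
  (C x)^-1 = 2^-1 * moment J * G x 0 /\ mu x = 2 * 'D_1 (G x) 0 / G x 0 &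
  (forall s, derivable (G x) s 1) /\
  (forall s s', `|s| <= 1 -> `|s'| <= 1 ->
     `|'D_1 (G x) s - 'D_1 (G x) s'| <= k * `|s - s'| `^ al)]].

Lemma good_set_dense :
  G_assumptions G -> G_C1_holder al Om G ->
  {ae @lebN R n, forall x, Om x -> (C x)^-1 = 2^-1 * moment J * G x 0} ->
  {ae @lebN R n, forall x, Om x -> mu x = 2 * 'D_1 (G x) 0 / G x 0} ->
  exists a1 a2 k : R, [/\ 0 < a1, a1 <= a2 & forall (x : RN) (r : R), cl x -> 0 < r ->
    exists2 y, good_set a1 a2 k y & `|y - x| < r].
Proof.
move=> [_ _ aecont [a1 [a2 [/andP[a10 a12] aeslope]]]] /(_ 1)[k aeC1] aeC aemu.
exists a1, a2, k; split => // x r clx r0.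
have FF : Filter (nbhs (almost_everywhere (@lebN R n))) := ae_filter_ringOfSetsType _.
have ae : {ae @lebN R n, forall y, Om y -> good_set a1 a2 k y}.
  have I := @filterI _ _ FF.
  apply: (@filterS _ _ FF _ _ _ (I _ _ aecont (I _ _ aeslope (I _ _ aeC (I _ _ aemu aeC1))))).
  by move=> y [cy [sy [Cy [my dy]]]] Oy; split => //; [split; [exact: Cy|exact: my]|exact: dy].
have [_ oOm _ _ _] := hOm.
have [z [Oz /= zx]] := clx _ (nbhs_dist_lt x r0).
have zx' : ball x r z by rewrite -ball_normE /= distrC.
have oU : open (Om `&` ball x r) by apply: openI => //; exact: ball_open.
have [|y [Oy yx] gy] := ae_dense (mu_setT_gt0 hJ) ae oU; first by exists z.
exists y; [exact: gy|by move: yx; rewrite -ball_normE /= distrC].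
Qed.

Hypothesis hv0 : C1_holder al cl v0.
Hypothesis hv : classical_solution al T Om mu h0 v0 v.
Hypothesis hh : forall eps : R, 0 < eps ->
  C1_holder al ((OmJ J eps Om `\` Om) `*` `]0, T]) (uncurry h).
Hypothesis hh0 : forall x t, (cl `\` Om) x -> t \in `]0, T[ -> h x t = h0 x t.
Hypothesis hu : forall eps : R, 0 < eps -> regular_solution T J G C Om h v0 eps (u eps).

Let vcont : {within cl `*` `[0, T], continuous (uncurry v)}.
Proof. by have [] := hv. Qed.
Let vbd x t : (cl `\` Om) x -> t \in `]0, T[ -> v x t = h0 x t.
Proof. by have [_ _ _ + _] := hv; apply. Qed.

(** [h] does not depend on [eps], so its bounds at the single scale [e0] hold in a whole collar of
    width [d], and every small [eps] reaches only into this collar. In the second bound the segment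
    starts on the boundary itself. *)
Lemma exterior_data_near : exists d M : R, [/\ 0 < d, 0 <= M,
  forall (x y : RN) (t : R), cl x -> `|y - x| < d -> ~ cl y -> 0 < t < T -> `|h y t| <= M &
  forall (p w : RN) (t : R), cl p -> ~ Om p -> 0 < t < T -> `|w| < d ->
    (forall s : R, 0 < s <= 1 -> ~ cl (p + s *: w)) ->
    `|h (p + w) t - h p t| <= M * `|w|].
Proof.
have [Om0 oOm cOm bOm _] := hOm.
have [e0 [d [e00 d0 near]]] := OmJ_nbhs_closure hJ oOm cOm Om0.
have [M M0 [Hb Hseg]] := C1_holder_segment (hh e00).
have int (x y : RN) (t : R) : cl x -> `|y - x| < d -> ~ cl y -> 0 < t < T ->
    ((OmJ J e0 Om `\` Om) `*` `]0, T]%classic)° (y, t).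
  move=> clx yx ncl tT.
  apply: (@interior_prod _ _ _ _ _ _ (OmJ J e0 Om `&` ~` cl)) => //.
  - apply: openI; first exact: open_OmJ.
    by apply: closed_openC; exact: closed_closure.
  - by move=> z [Jz ncz]; split => // Oz; apply: ncz; exact: subset_closure.
  - by split => //; exact: near yx.
exists d, M; split => // [x y t clx yx ncl tT|p w t clp nOp tT wd ncl].
  exact: (Hb (y, t) (int x y t clx yx ncl tT)).
have E s : (p, t) + s *: (w, 0) = (p + s *: w, t).
  by congr (_, _) => /=; rewrite scaler0 addr0.
have := Hseg (p, t) (w, 0).
have -> : `|(w, 0 : R)| = `|w|.
  by rewrite prod_normE /= normr0; apply/max_idPl.
have -> : (p, t) + (w, 0) = (p + w, t) by rewrite -{1}[(w, 0)]scale1r E scale1r.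
apply.
  split => /=.
    by split => //; apply: (near p) => //; rewrite subrr normr0.
  by rewrite in_itv /=; case/andP: tT => -> /ltW.
move=> s s01; rewrite E; apply: (int p) => //; last exact: ncl.
rewrite addrAC subrr add0r normrZ (le_lt_trans _ wd)// ler_piMl//.
by case/andP: s01 => ? ?; rewrite gtr0_norm.
Qed.

Lemma exterior_solution (eps : R) (x z : RN) (t : R) : 0 < eps -> cl x -> J z != 0 ->
  ~ cl (x + eps *: z) -> 0 < t < T -> u eps (x + eps *: z) t = h (x + eps *: z) t.
Proof.
move=> eps0 clx Jz ncl tT; have [_ oOm _ bOm _] := hOm.
by apply: (solution_exterior (hu eps0)) => //; split => //; exact: reach_OmJ.
Qed.

Lemma reach_small (d : R) : 0 < d -> exists2 e : R, 0 < e &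
  forall (eps : R) (x z : RN), 0 < eps < e -> J z != 0 -> `|x + eps *: z - x| < d.
Proof.
move=> d0; have [r r0 Hr] := kernel_support hJ.
exists (d / r) => [|eps x z /andP[eps0 epsd] /Hr zr]; first by rewrite divr_gt0.
rewrite addrAC subrr add0r normrZ gtr0_norm//.
by rewrite (@le_lt_trans _ _ (eps * r)) ?ler_pM2l// -ltr_pdivlMr.
Qed.

Lemma exterior_bounded : exists e1 M : R, 0 < e1 /\
  forall (eps : R) (x z : RN) (t : R), 0 < eps < e1 ->
    cl x -> J z != 0 -> ~ cl (x + eps *: z) -> 0 < t < T ->
    `|u eps (x + eps *: z) t| <= M.
Proof.
have [d [M [d0 M0 Hb _]]] := exterior_data_near.
have [e e0 He] := reach_small d0.
exists e, M; split => // eps x z t epse clx Jz ncl tT.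
have /andP[eps0 _] := epse.
by rewrite exterior_solution//; apply: (Hb x) => //; exact: He.
Qed.

(** Half of [w] pays for the change of [h] along the segment from the exterior point to its foot
    [p]. At [p] the data equal [v], and the other half pays for the variation of [v] between [p] and
    [x0]. *)
Lemma exterior_near_boundary (x0 : RN) (t0 w : R) : cl x0 -> ~ Om x0 -> 0 <= t0 <= T -> 0 < w ->
  exists2 r : R, 0 < r & forall (eps : R) (x z : RN) (t : R), 0 < eps < r ->
    cl x -> J z != 0 -> ~ cl (x + eps *: z) -> 0 < t < T ->
    `|x + eps *: z - x0| < r -> `|t - t0| < r ->
    `|u eps (x + eps *: z) t - v x0 t0| <= w.
Proof.
move=> clx0 nOx0 t0T w0.
have [d [M [d0 M0 _ Hseg]]] := exterior_data_near.
have p0 : (cl `*` `[0, T]) (x0, t0) by split => //=; rewrite in_itv.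
have w2 : 0 < w / 2 by rewrite divr_gt0.
have [q q0 Hq] := (within_continuousP _ _).1 vcont _ p0 _ w2.
have M1 : 0 < 4 * (M + 1) by rewrite mulr_gt0// ltr_wpDl.
have [|r1 r10 /= /and4P[r1q r1d' r1w' _]] :=
    @exists_lt_all R [:: q; d / 2; w / (4 * (M + 1))]; first by rewrite /= q0 !divr_gt0.
have r1d : 2 * r1 < d by rewrite mulrC -ltr_pdivlMr.
have r1w : M * (2 * r1) <= w / 2.
  by move: r1w'; rewrite ltr_pdivlMr//; move: r10; lra.
have [q1 q10 Hq1] := boundary_foot hOm clx0 nOx0 r10.
exists (Num.min r1 q1) => [|eps x z t /andP[eps0 _] clx Jz ncl tT]; first by rewrite lt_min r10.
rewrite !lt_min => /andP[yr1 yq1] /andP[tr1 _].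
rewrite exterior_solution//; move: ncl yr1 yq1; move: (x + eps *: z) => y ncl yr1 yq1.
have [p [pr1 clp nOp pseg]] := Hq1 y yq1 ncl.
have yp : `|y - p| <= 2 * r1.
  rewrite -[y](subrK x0) -addrA (le_trans (ler_normD _ _))//.
  by rewrite [2 * _]mulr_natl mulr2n lerD ?(ltW yr1)// distrC.
have seg : `|h y t - h p t| <= w / 2.
  apply: (le_trans _ r1w); apply: (@le_trans _ _ (M * `|y - p|)); last by rewrite ler_wpM2l.
  have := Hseg p (y - p) t clp nOp tT (le_lt_trans yp r1d) pseg.
  by rewrite (addrC p) subrK.
have tI : t \in `]0, T[ by rewrite in_itv.
have hp : h p t = v p t by rewrite hh0// vbd.
have vp : `|v p t - v x0 t0| <= w / 2.
  apply: ltW; apply: (Hq (p, t)).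
    by split => //=; rewrite in_itv /= !ltW//; case/andP: tT.
  by rewrite prod_norm_lt (le_lt_trans pr1)//= (lt_trans tr1).
rewrite -[h y t](subrK (h p t)) -addrA (le_trans (ler_normD _ _))//.
by rewrite [leRHS]splitr lerD// hp.
Qed.

(** [v] is known to equal [v0] at time 0 only inside [Om]; continuity of both extends this to the
    boundary, where [u] already equals [v0]. *)
Lemma initial_value (eps : R) (x : RN) : 0 < eps -> cl x -> u eps x 0 = v x 0.
Proof.
move=> eps0 clx; have [_ _ _ hE _] := hu eps0.
rewrite hE//; last by rewrite in_itv /= lexx ltW.
rewrite set_itv1 Rintegral_set1 addr0.
have [vc _ _ _ vi] := hv; have [v0c _ _] := hv0.
apply/eqP/contraT; rewrite -subr_eq0 -normr_gt0 => e0.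
have e2 : 0 < `|v0 x - v x 0| / 2 by rewrite divr_gt0.
have p0 : (cl `*` `[0, T]) (x, 0) by split => //=; rewrite in_itv /= lexx ltW.
have [d d0 Hd] := (within_continuousP _ _).1 vc _ p0 _ e2.
have [d' d'0 Hd'] := (within_continuousP _ _).1 v0c _ clx _ e2.
have dd0 : 0 < Num.min d d' by rewrite lt_min d0.
have [y [Oy /=]] := clx _ (nbhs_dist_lt x dd0); rewrite lt_min => /andP[yd yd'].
have cly : cl y by exact: subset_closure.
have h1 := Hd' y cly yd'.
have h2 : `|v y 0 - v x 0| < `|v0 x - v x 0| / 2.
  apply: (Hd (y, 0)); first by split => //=; rewrite in_itv /= lexx ltW.
  by rewrite prod_norm_lt yd /= subrr normr0.
rewrite vi// in h2; rewrite distrC in h1.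
have := ler_distD (v0 y) (v0 x) (v x 0).
by rewrite leNgt [X in _ < X]splitr ltrD.
Qed.

Lemma theorem_setup (a1 a2 k : R) : 0 < a1 -> a1 <= a2 ->
  (forall (x : RN) (r : R), cl x -> 0 < r ->
    exists2 y, good_set a1 a2 k y & `|y - x| < r) ->
  setup J T a1 a2 Om (good_set a1 a2 k) C (fun x => G x 0) (fun x => 'D_1 (G x) 0) mu
    (fun x s => G x s * s) u v.
Proof.
move=> a10 a12 dense; have [Om0 oOm cOm bOm _] := hOm; have /andP[al0 _] := hal.
have [vc _ _ vb vi] := hv; have mJ0 := moment_gt0 hJ.
have range x s : good_set a1 a2 k x -> a1 <= G x s <= a2.
  by move=> [_ cg sl _ _]; exact: reaction_range.
have G0gt x : good_set a1 a2 k x -> 0 < G x 0.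
  by move=> gx; have /andP[h1 _] := range x 0 gx; exact: lt_le_trans h1.
have CE x : good_set a1 a2 k x -> C x = 2 / (moment J * G x 0).
  move=> gx; have g0 := G0gt x gx; have [_ _ _ [HC _] _] := gx.
  rewrite -[C x]invrK HC; field.
  by rewrite !gt_eqF.
have C0 x : good_set a1 a2 k x -> 0 <= C x.
  by move=> gx; rewrite CE// divr_ge0// mulr_ge0 ?ltW// G0gt.
have taylor (w : R) : 0 < w -> exists2 s0 : R, 0 < s0 & forall (x : RN) (s : R),
    good_set a1 a2 k x -> `|s| <= s0 ->
    `|G x s * s - G x 0 * s - 'D_1 (G x) 0 * s ^+ 2| <= w * s ^+ 2.
  move=> w0; have e0 : 0 < w / (`|k| + 1) by rewrite divr_gt0// ltr_wpDl.
  have [d d0 Hd] := powR_small al0 e0.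
  exists (Num.min d 1) => [|x s [_ cg sl _ [dg hg]]]; first by rewrite lt_min d0 ltr01.
  apply: (reaction_taylor dg hg) => [t /andP[t0]|]; last by rewrite ge_min lexx orbT.
  rewrite le_min => /andP[td _].
  apply: (@le_trans _ _ (`|k| * (w / (`|k| + 1)))).
    by rewrite ler_wpM2l//; apply: Hd; rewrite t0.
  by rewrite mulrCA ler_piMr ?(ltW w0)// ler_pdivrMr ?ltr_wpDl// mul1r lerDl.
constructor => //.
- by move=> x [].
- by move=> x gx; rewrite mulr0.
- by move=> x s s' [_ _ sl _ _] ss; exact: reaction_slope.
- by move=> x gx; exact: range.
(* The remainder estimate with [w = 1] at the single value [s0] bounds the second coefficient
   uniformly in [x], because [G] stays between [a1] and [a2]. *)
- have [s0 s00 H] := taylor 1 ltr01.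
  exists (s0 ^- 2 * (a2 * s0 *+ 2 + s0 ^+ 2)) => x gx.
  have := H x s0 gx; rewrite gtr0_norm// lexx mul1r => /(_ isT) hx.
  rewrite ler_pdivlMl ?exprn_gt0//.
  have -> : s0 ^+ 2 * `|'D_1 (G x) 0| = `|'D_1 (G x) 0 * s0 ^+ 2|.
    by rewrite normrM mulrC [`|s0 ^+ 2|]ger0_norm ?sqr_ge0.
  have /andP[l1 r1] := range x s0 gx; have /andP[l2 r2] := range x 0 gx.
  have b1 : G x s0 * s0 <= a2 * s0 by rewrite ler_wpM2r// ltW.
  have b2 : G x 0 * s0 <= a2 * s0 by rewrite ler_wpM2r// ltW.
  have b3 : 0 <= G x s0 * s0 by rewrite mulr_ge0 ?(ltW s00)// (le_trans (ltW a10)).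
  have b4 : 0 <= G x 0 * s0 by rewrite mulr_ge0 ?(ltW s00)// (le_trans (ltW a10)).
  exact: remainder_bound hx b1 b2 b3 b4.
- move=> x gx; rewrite CE//; field; rewrite !gt_eqF//; exact: G0gt.
- move=> x gx; have [_ _ _ [_ ->] _] := gx; rewrite CE//; field.
  by rewrite !gt_eqF//; exact: G0gt.
- by move=> eps eps0; exact: (solution_continuous (hu eps0)).
- by move=> eps x eps0 clx; exact: initial_value.
- move=> eps x s t c eps0 gx; have [Ox cg sl _ _] := gx.
  exact: (solution_increment_le eps0 oOm bOm hJ (hh eps0) (hu eps0) a10 a12 Ox cg sl (C0 x gx)).
- move=> eps x s t c eps0 gx; have [Ox cg sl _ _] := gx.
  exact: (solution_increment_ge eps0 oOm bOm hJ (hh eps0) (hu eps0) a10 a12 Ox cg sl (C0 x gx)).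
- exact: exterior_bounded.
- exact: exterior_near_boundary.
- by move=> x0 t0 Ox0 t0T; exact: (pde_expansion al0 oOm hv Ox0 t0T).
- by move=> x0 clx0 nOx0; exact: (exterior_sphere hOm clx0 nOx0).
Qed.

End Main.

Theorem theorem2p8 (R : realType) (n : nat) (al T : R)
    (Om : set 'rV[R]_n.+1) (J : 'rV[R]_n.+1 -> R) (G : 'rV[R]_n.+1 -> R -> R)
    (C mu v0 : 'rV[R]_n.+1 -> R) (h0 h v : 'rV[R]_n.+1 -> R -> R)
    (u : R -> 'rV[R]_n.+1 -> R -> R)
    (hal : 0 < al < 1) (hT : 0 < T)
    (hOm : C2_holder_domain al Om)
    (hJ : kernel_assumptions J)
    (hG : G_assumptions G)
    (hGC1 : G_C1_holder al Om G)
    (hC : {ae @lebN R n, forall x, Om x ->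
             (C x)^-1 = 2^-1 * moment J * G x 0})
    (hmu : {ae @lebN R n, forall x, Om x ->
              mu x = 2 * 'D_1 (G x) 0 / G x 0})
    (hmu_holder : holder al (closure Om) mu)
    (hv0 : C1_holder al (closure Om) v0)
    (hv : classical_solution al T Om mu h0 v0 v)
    (hh : forall eps : R, 0 < eps ->
            C1_holder al ((OmJ J eps Om `\` Om) `*` `]0, T]) (uncurry h))
    (hh0 : forall x t, (closure Om `\` Om) x -> t \in `]0, T[ -> h x t = h0 x t)
    (hu : forall eps : R, 0 < eps ->
            regular_solution T J G C Om h v0 eps (u eps)) :
  ereal_sup [set Linfty_norm Om (fun x => u eps x t - v x t) | t in `[0, T]]
    @[eps --> 0^'+] --> 0%E.
Proof.
have [a1 [a2 [k [a10 a12 dense]]]] := good_set_dense hOm hJ hG hGC1 hC hmu.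
have S := theorem_setup hal hT hOm hJ hv0 hv hh hh0 hu a10 a12 dense.
have key (w : R) : 0 < w -> exists2 e : R, 0 < e & forall eps : R, 0 < eps < e ->
    (ereal_sup [set Linfty_norm Om (fun x => (u eps x t - v x t)%R) | t in `[0%R, T]] <= w%:E)%E.
  move=> w0; have [e1 e10 H1] := upper_bound S w0.
  have [e2 e20 H2] := upper_bound (setup_neg S) w0.
  exists (Num.min e1 e2) => [|eps]; first by rewrite lt_min e10.
  rewrite lt_min => /andP[eps0 /andP[l1 l2]].
  apply: ge_ereal_sup => _ [t /= + <-]; rewrite in_itv /= => tT.
  apply: Linfty_norm_le => [|x Ox]; first exact: ltW.
  have clx : closure Om x by exact: subset_closure.
  have := H1 eps x t; rewrite eps0 => /(_ l1 clx tT) h1.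
  have := H2 eps x t; rewrite eps0 => /(_ l2 clx tT) h2.
  by rewrite ler_norml; apply/andP; split; move: h1 h2; lra.
have ge0 (eps : R) :
    (0 <= ereal_sup [set Linfty_norm Om (fun x => (u eps x t - v x t)%R) | t in `[0%R, T]])%E.
  apply: (@le_trans _ _ (Linfty_norm Om (fun x => u eps x 0 - v x 0))); first exact: Lnorm_ge0.
  by apply: ereal_sup_ubound; exists 0 => //=; rewrite in_itv /= lexx ltW.
apply/fine_cvgP; split.
  have [e e0 He] := key 1 ltr01; near=> eps.
  rewrite ge0_fin_numE//; apply: (@le_lt_trans _ _ 1%:E); last exact: ltry.
  apply: He; apply/andP; split; near: eps; first exact: nbhs_right_gt.
  exact: nbhs_right_lt.
apply/cvgrPdist_le => w w0; have [e e0 He] := key w w0; near=> eps.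
have Hw : (ereal_sup [set Linfty_norm Om (fun x => (u eps x t - v x t)%R) | t in `[0%R, T]] <= w%:E)%E.
  apply: He; apply/andP; split; near: eps; first exact: nbhs_right_gt.
  exact: nbhs_right_lt.
rewrite sub0r normrN ger0_norm /=; last exact: fine_ge0.
rewrite -lee_fin fineK// ge0_fin_numE//.
by apply: (le_lt_trans Hw); exact: ltry.
Unshelve. all: by end_near. Qed.
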